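(* For measurable $B\subset P(\mathbb{R})$ consisting of probability measures, let $\mathrm{LISPP}(B)\subset\mathfrak{L}$ be the set of distributions of Lévy processes $(X_t)_{t\ge0}$ such that for some $\mu\in B$, $\mathbb{E}[e^{iuX_1}]=\exp\{\int_{\mathbb{R}}(e^{iux}-1)\,d\mu(x)\}$ for all $u\in\mathbb{R}$. For $A\subset\mathbb{R}$ let $F_A$ be the set of probability measures on $\mathbb{R}$ supported in $A$. \begin{enumerate} \item Let $\nu_1,\nu_2,\nu_3$ be probability measures on $[0,\infty)$ and let $C$ be the convex hull of $\{\nu_1,\nu_2,\nu_3\}$. Then $\mathrm{LISPP}(C)$ is good. \item If $A$ is a discrete (no accumulation points in $\mathbb{R}$), countable set of real numbers that is linearly independent over $\mathbb{Q}$, then $\mathrm{LISPP}(F_A)$ is good. \item $\mathrm{LISPP}(F_{\{0,1,2,3\}})$ is not good. \end{enumerate}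
   Context: $P(\mathbb{R})$ denotes the set of Borel probability measures on $\mathbb{R}$, with the $\sigma$-algebra generated by the maps $\mu\mapsto\mu(B)$, $B\subset\mathbb{R}$ Borel. A Lévy process is a real-valued process $(Z_t)_{t\ge0}$ with stationary independent increments, continuous in probability, with $Z_0=0$. $\mathfrak{L}$ is the set of distributions (laws on $\mathbb{R}^{[0,\infty)}$ with the product $\sigma$-algebra) of Lévy processes, equipped with the smallest $\sigma$-algebra making the passage from a law to each of its one-time marginals (in $P(\mathbb{R})$) measurable. A mixture of Lévy processes with mixing measure $\Theta$, a probability measure on $\mathfrak{L}$, is a process $S=(S_t)_{t\ge 0}$ such that $\mathbb{P}(S\in D)=\int_{\mathfrak{L}}\gamma(D)\,d\Theta(\gamma)$ for every product measurable $D\subset\mathbb{R}^{[0,\infty)}$. A measurable subset $L\subset\mathfrak{L}$ is good if whenever $S,T$ are mixtures of Lévy processes whose mixing measures $\Theta_1,\Theta_2$ are concentrated on $L$, and $S_t$ and $T_t$ have the same distribution for every $t\ge0$, then $S$ and $T$ have the same (joint) distribution. *)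

(* Defs.v *)
From HB Require Import structures.
From mathcomp Require Import all_boot all_order all_algebra.
From mathcomp Require Import all_classical reals interval_inference ereal topology.
From mathcomp Require Import normedtype sequences exp trigo measure.
From mathcomp Require Import lebesgue_measure lebesgue_integral giry probability.
From mathcomp.real_closed Require Import complex.

Set Implicit Arguments.
Unset Strict Implicit.
Unset Printing Implicit Defensive.
Import Order.TTheory GRing.Theory Num.Theory.
Import numFieldNormedType.Exports.
Local Open Scope classical_set_scope.
Local Open Scope ring_scope.

(* A term of type [probability T R] also has values on non-measurable sets, so
   two measures are identified when they agree on measurable sets, which is
   [measure_eq], written mu ≡μ nu; never by [=]. *)

Section path_space.
Variable R : realType.

Definition cylinder : set (set ({nonneg R} -> R)) :=
  \bigcup_t preimage_set_system setT (fun w => w t) measurable.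

(* R^[0,oo) with the product sigma-algebra. *)
Definition path_space : measurableType cylinder.-sigma :=
  g_sigma_algebraType cylinder.

Definition coord (t : {nonneg R}) (w : path_space) : R := w t.

Lemma measurable_coord t : measurable_fun [set: path_space] (coord t).
Proof.
move=> _ B mB; apply: sub_sigma_algebra; exists t => //.
by exists B.
Qed.

HB.instance Definition _ t :=
  isMeasurableFun.Build _ _ path_space R (coord t) (@measurable_coord t).

End path_space.

Section process.
Context {R : realType} {d : measure_display} {Omega : measurableType d}.
Variable P : probability Omega R.
Implicit Type X : {nonneg R} -> {RV P >-> R}.

Definition sample_path X (w : Omega) : path_space R := fun t => X t w.

Lemma measurable_sample_path X : measurable_fun [set: Omega] (sample_path X).
Proof.
apply: (measurability (@cylinder R : set (set (path_space R)))) => //.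
move=> _ [_ [t _ [B mB <-]] <-].
have := measurable_funP (X t) measurableT B mB.
by rewrite !setTI.
Qed.

HB.instance Definition _ X :=
  isMeasurableFun.Build _ _ Omega (path_space R) (sample_path X)
    (measurable_sample_path X).

Definition law X : probability (path_space R) R :=
  distribution P (sample_path X).

(* Mutual independence; the product rule for a subfamily is the case B i = R
   for the other indices i. *)
Definition independent_RVs (n : nat) (Y : 'I_n -> Omega -> R) : Prop :=
  forall B : 'I_n -> set R, (forall i, measurable (B i)) ->
    P (\bigcap_i (Y i @^-1` B i)) = (\prod_(i < n) P (Y i @^-1` B i))%E.

Definition increment X (s t : {nonneg R}) (w : Omega) : R := X t w - X s w.

(* The times t_0 <= ... <= t_n are the first n + 1 terms of a nondecreasing
   sequence. *)
Definition independent_increments X : Prop :=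
  forall (n : nat) (t : nat -> {nonneg R}),
    (forall i, (t i)%:num <= (t i.+1)%:num) ->
    independent_RVs (fun i : 'I_n => increment X (t i) (t i.+1)).

Definition stationary_increments X : Prop :=
  forall (s t h : {nonneg R}) (B : set R), measurable B ->
    P (increment X s (s%:num + h%:num)%:nng @^-1` B) =
    P (increment X t (t%:num + h%:num)%:nng @^-1` B).

Definition continuous_in_probability X : Prop :=
  forall (t : {nonneg R}) (eps eta : R), 0 < eps -> 0 < eta ->
    exists2 delta : R, 0 < delta &
      forall s : {nonneg R}, `|s%:num - t%:num| < delta ->
        (P [set w | eps < `|X s w - X t w|]%R < eta%:E)%E.

Definition levy_process X : Prop :=
  [/\ {ae P, forall w, X 0%:nng w = 0},
      stationary_increments X,
      independent_increments X &
      continuous_in_probability X].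

End process.

Definition is_levy_law {R : realType} (g : probability (path_space R) R) :=
  exists (d : measure_display) (Omega : measurableType d)
    (P : probability Omega R) (X : {nonneg R} -> {RV P >-> R}),
    levy_process X /\ law X ≡μ g.

(* A type rather than a set of laws on the path space: the sigma-algebra
   generated by the marginals only fits laws of Levy processes. *)
Record levy_law (R : realType) := LevyLaw {
  levy_law_val :> probability (path_space R) R;
  levy_lawP : is_levy_law levy_law_val }.

Section levy_law_measurable.
Variable R : realType.

Let P0 : probability R R := \d_(point : R).

Let zero_process (t : {nonneg R}) : {RV P0 >-> R} := cst 0.

Let increment_zero s t : increment zero_process s t = cst 0.
Proof. by apply/funext => w; rewrite /increment /= subrr. Qed.

Let zero_process_levy : levy_process zero_process.
Proof.
split.
- exact: aeW.
- by move=> s t h B mB; rewrite !increment_zero.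
- move=> n t _ B mB; rewrite /P0 /=.
  under eq_bigr do rewrite diracE.
  rewrite diracE; case: (pselect (forall i : 'I_n, (increment zero_process (t i)
      (t i.+1) @^-1` B i) (point : R))) => [Bp|/existsNP[i Bi]].
    rewrite big1 => [|i _]; first by rewrite mem_set// => i _; exact: Bp.
    by rewrite mem_set//; exact: Bp.
  rewrite memNset => [|/(_ i I)//].
  by rewrite (bigD1 i)//= memNset// mul0e.
- move=> t eps eta e0 n0; exists 1 => // s _.
  rewrite (_ : [set w | _] = set0) ?measure0 ?lte_fin//.
  apply/seteqP; split => // w /=; rewrite subrr normr0.
  by move=> /(lt_trans e0); rewrite ltxx.
Qed.

Let zero_levy_law : levy_law R.
Proof.
apply: (@LevyLaw R (law zero_process)).
by exists _, _, P0, zero_process; split.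
Qed.

HB.instance Definition _ := gen_eqMixin (levy_law R).
HB.instance Definition _ := gen_choiceMixin (levy_law R).
HB.instance Definition _ := isPointed.Build (levy_law R) zero_levy_law.

Definition marginal (t : {nonneg R}) (g : levy_law R) : pprobability R R :=
  distribution g (coord t).

Definition marginal_preimages : set (set (levy_law R)) :=
  \bigcup_t preimage_set_system setT (marginal t) measurable.

Definition levy_space : measurableType marginal_preimages.-sigma :=
  g_sigma_algebraType marginal_preimages.

End levy_law_measurable.

Section mixture.
Context {R : realType}.

Definition mixture_of_levy {d : measure_display} {Omega : measurableType d}
    (P : probability Omega R) (S : {nonneg R} -> {RV P >-> R})
    (Theta : probability (levy_space R) R) : Prop :=
  forall D : set (path_space R), measurable D ->
    law S D = (\int[Theta]_(g in [set: levy_space R]) levy_law_val g D)%E.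

(* [measurable L] is part of goodness: the notion is defined for measurable
   subsets only. *)
Definition good (L : set (levy_space R)) : Prop :=
  measurable L /\
  forall (d1 d2 : measure_display)
    (Omega1 : measurableType d1) (Omega2 : measurableType d2)
    (P1 : probability Omega1 R) (P2 : probability Omega2 R)
    (S : {nonneg R} -> {RV P1 >-> R}) (T : {nonneg R} -> {RV P2 >-> R})
    (Theta1 Theta2 : probability (levy_space R) R),
    mixture_of_levy S Theta1 -> mixture_of_levy T Theta2 ->
    Theta1 L = 1%E -> Theta2 L = 1%E ->
    (forall t, distribution P1 (S t) ≡μ distribution P2 (T t)) ->
    law S ≡μ law T.

End mixture.

Section complex_exponential.
Context {R : realType}.
Local Open Scope complex_scope.

Definition cexp (z : R[i]) : R[i] :=
  (expR (complex.Re z) * cos (complex.Im z)) +i*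
  (expR (complex.Re z) * sin (complex.Im z)).

Definition cintegral {d : measure_display} {T : measurableType d}
    (mu : {measure set T -> \bar R}) (f : T -> R[i]) : R[i] :=
  (\int[mu]_x complex.Re (f x)) +i* (\int[mu]_x complex.Im (f x)).

End complex_exponential.

Section families.
Context {R : realType}.
Local Open Scope complex_scope.

Definition LISPP (B : set (pprobability R R)) : set (levy_space R) :=
  [set g | exists (d : measure_display) (Omega : measurableType d)
      (P : probability Omega R) (X : {nonneg R} -> {RV P >-> R}),
    [/\ levy_process X, law X ≡μ levy_law_val g &
      exists2 mu, B mu & forall u : R,
        cintegral P (fun w => cexp (0 +i* (u * X 1%:nng w))) =
        cexp (cintegral mu (fun x => cexp (0 +i* (u * x)) - 1))]].

(* [negligible] is outer nullity, so that A need not be measurable. *)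
Definition supported_in (A : set R) : set (pprobability R R) :=
  [set mu | mu.-negligible (~` A)].

Definition convex_hull (V : set (pprobability R R)) : set (pprobability R R) :=
  [set mu | exists (n : nat) (w : 'I_n -> R) (nu : 'I_n -> pprobability R R),
    [/\ forall i, 0 <= w i, \sum_(i < n) w i = 1, forall i, V (nu i) &
      forall U : set R, measurable U ->
        mu U = (\sum_(i < n) (w i)%:E * nu i U)%E]].

Definition rat_independent (A : set R) : Prop :=
  forall (n : nat) (a : 'I_n -> R) (q : 'I_n -> rat),
    injective a -> (forall i, A (a i)) ->
    \sum_(i < n) ratr (q i) * a i = 0 -> forall i, q i = 0.

End families.

(* Main.v *)
(* Levy laws in LISPP are those of compound Poisson processes of rate 1, and the
   law of a mixture at successive increments of lengths s_i is the average over
   the mixing measure of the products of the marginals at the times s_i. So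
   goodness asks whether the averages of single marginals determine the averages
   of products of marginals.

   Convex hull: for the jump law u nu1 + v nu2 + (1 - u - v) nu3 the logarithm of
   the Laplace transform at (t, l) is t (c(l) + u F(l) + v G(l)), so that the
   marginals give the law of u F(l) + v G(l) for each l. F and G are analytic. If
   they are proportional this law is all that products depend on; otherwise G / F
   takes infinitely many values, and the homogeneous polynomial of degree k whose
   coefficients are the differences of the mixed moments of (u, v) of degree k
   vanishes identically.

   Independent jumps: a sum of elements of A determines the summands with their
   multiplicities, hence P(X_t = sum of l) = W(t, l) * prod_(a in l) mu {a} with W
   independent of mu. Products of such probabilities are, up to such factors,
   probabilities of the same form for the concatenated list.

   Jumps in {0, 1, 2, 3}: perturbing the jump law by (x1, x2, x3) adds to its
   generating function a multiple of (1 - z) (x1 + x2 z + x3 z^2). The marginals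
   see the moment generating function of a random (x1, x2, x3) only at multiples
   of (1, z, z^2), that is on the cone t2^2 = t1 t3, whereas two increments also
   see it off the cone; and there are two random vectors whose moment generating
   functions agree exactly on this cone. *)

Require Import Defs.
From HB Require Import structures.
From mathcomp Require Import all_boot all_order all_algebra.
From mathcomp Require Import all_classical reals interval_inference ereal topology.
From mathcomp Require Import normedtype sequences esum derive realfun exp trigo measure.
From mathcomp Require Import measurable_realfun numfun lebesgue_measure lebesgue_integral giry probability kernel.
From mathcomp.real_closed Require Import complex.
From mathcomp Require Import ring lra.
Set Implicit Arguments.
Unset Strict Implicit.
Unset Printing Implicit Defensive.
Import Order.TTheory GRing.Theory Num.Theory.
Import numFieldNormedType.Exports.
Local Open Scope classical_set_scope.
Local Open Scope ring_scope.

(** * Uniqueness of measures *)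

(** Goodness compares products of probabilities of Borel sets, while each argument controls a
    transform: Laplace transforms or point masses. The passage is made one factor at a time with the
    other factors as a weight, which is why uniqueness is proved beyond probability laws. Membership
    in [LISPP] speaks of time 1 only. The other marginals come from the semigroup of characteristic
    functions, where continuity in [u] and in time removes the choice of roots. Goodness also
    demands a measurable family, although [LISPP] is an existential over jump laws: countably many
    conditions on the marginal at time 1 must detect a jump law. The negative part needs actual
    processes; they are built on the unit interval, whose binary digits supply all independent
    variables. Its two random vectors come from a differential operator: d2 d2 - d1 d3, applied to
    the indicator of a square in variables 1 and 3 times a tent in variable 2, is a finite signed
    measure, and its positive and negative parts are the two laws. *)

Section bounded_integrals.
Context {R : realType} {d : measure_display} {T : measurableType d}.
Implicit Types (m : {finite_measure set T -> \bar R}) (f g : T -> R).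

Lemma bounded_integrable m f (C : R) : measurable_fun setT f ->
  (forall x, `|f x| <= C) -> m.-integrable setT (EFin \o f).
Proof.
move=> mf fC; apply: measurable_bounded_integrable => //.
  by rewrite -ge0_fin_numE// fin_num_measure.
exists C; split; first exact: num_real.
by move=> M CM x _ /=; rewrite (le_trans (fC x))// ltW.
Qed.

Lemma EFin_Rintegral m f (C : R) : measurable_fun setT f ->
  (forall x, `|f x| <= C) ->
  (\int[m]_x f x)%:E = (\int[m]_x (f x)%:E)%E.
Proof.
move=> mf fC; rewrite fineK//.
by apply: integrable_fin_num => //; exact: (bounded_integrable m mf fC).
Qed.

Lemma Rintegral_bounded_cvg m (f_ : nat -> T -> R) f (C : R) :
  (forall n, measurable_fun setT (f_ n)) ->
  (forall n x, `|f_ n x| <= C) ->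
  (forall x, f_ ^~ x @ \oo --> f x) ->
  (fun n => \int[m]_x f_ n x) @ \oo --> \int[m]_x f x.
Proof.
move=> mf fC ff.
have mlim : measurable_fun setT f by apply: measurable_fun_cvg mf _ => x _.
have flim x : `|f x| <= C.
  apply: (closed_cvg (fun y => `|y| <= C)) (ff x) => //.
    exact/(closed_comp _ (@closed_le _ C))/(fun x _ => @norm_continuous _ R^o x).
  exact: nearW.
apply: fine_cvg; rewrite (EFin_Rintegral m mlim flim).
apply: (@dominated_cvg _ _ _ _ _ _ _ _ (cst C%:E)) => //.
- by move=> n; exact/measurable_EFinP.
- by move=> x _; apply: cvg_EFin (ff x); exact: nearW.
- by apply: (bounded_integrable m (f := cst C) (C := `|C|)) => //=.
- by move=> n x _ /=; rewrite lee_fin.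
Qed.

Lemma Rintegral_lin2 m (a b : R) f g (C D : R) :
  measurable_fun setT f -> measurable_fun setT g ->
  (forall x, `|f x| <= C) -> (forall x, `|g x| <= D) ->
  \int[m]_x (a * f x + b * g x) = a * \int[m]_x f x + b * \int[m]_x g x.
Proof.
move=> mf mg fC gD.
have I (c : R) (h : T -> R) (E : R) : measurable_fun setT h -> (forall x, `|h x| <= E) ->
    m.-integrable setT (EFin \o (fun x => c * h x)).
  move=> mh hE; apply: (bounded_integrable m (C := `|c| * E)).
    exact: measurable_funM.
  by move=> x; rewrite normrM ler_wpM2l.
rewrite RintegralD//; try by apply: I; eauto.
by rewrite !RintegralZl//; [exact: bounded_integrable gD|exact: bounded_integrable fC].
Qed.

Lemma Rintegral_sum m (I : Type) (s : seq I) (F : I -> T -> R) (C : I -> R) :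
  (forall i, measurable_fun setT (F i)) -> (forall i x, `|F i x| <= C i) ->
  \int[m]_x (\sum_(i <- s) F i x) = \sum_(i <- s) \int[m]_x F i x.
Proof.
move=> mF FC; elim: s => [|i s ih].
  under eq_Rintegral do rewrite big_nil.
  by rewrite big_nil Rintegral_cst// mul0r.
under eq_Rintegral do rewrite big_cons.
rewrite RintegralD//; first by rewrite ih big_cons.
- exact: bounded_integrable (FC i).
- apply: (bounded_integrable m (C := \sum_(j <- s) C j)).
    by apply: measurable_sum => j; exact: mF.
  move=> x; apply: (le_trans (ler_norm_sum _ _ _)).
  by apply: ler_sum => j _; exact: FC.
Qed.

Lemma Rintegral_horner m f (p : {poly R}) (C : R) : measurable_fun setT f ->
  (forall x, `|f x| <= C) ->
  \int[m]_x p.[f x] = \sum_(i < size p) p`_i * \int[m]_x f x ^+ i.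
Proof.
move=> mf fC.
under eq_Rintegral do rewrite horner_coef.
rewrite (@Rintegral_sum _ _ _ _ (fun i : 'I_(size p) => `|p`_i| * C ^+ i)).
- apply: eq_bigr => i _; rewrite RintegralZl//.
  apply: (bounded_integrable m (C := C ^+ i)).
    exact: measurable_funX.
  by move=> x; rewrite normrX lerXn2r// ?nnegrE// (le_trans _ (fC x)).
- by move=> i; apply: measurable_funM => //; exact: measurable_funX.
- move=> i x; rewrite normrM ler_wpM2l// normrX lerXn2r// ?nnegrE//.
  by rewrite (le_trans _ (fC x)).
Qed.

End bounded_integrals.

(** * Polynomials converging to a step function on [0, 1] *)

Section step_polynomials.
Context {R : realType}.
Implicit Types (y : R) (n : nat).

(** Iterates of y -> 3 y^2 - 2 y^3, which has attracting fixed points 0 and 1 and the repelling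
    fixed point 1/2. They are explicit polynomials tending to a step function on [0, 1], so that no
    approximation theorem is called for. *)
Fixpoint smoothstep n : {poly R} :=
  if n is k.+1 then 3%:P * smoothstep k ^+ 2 - 2%:P * smoothstep k ^+ 3 else 'X.

(** The iterates keep the value 1/2 at the jump. The factor 2 s - 1 sends the limits 0, 1/2, 1 to 0,
    0, 1, which is the indicator of an open half-line. *)
Definition step_poly n : {poly R} := smoothstep n * (2%:P * smoothstep n - 1).

Lemma smoothstepS n y : (smoothstep n.+1).[y] =
  3 * (smoothstep n).[y] ^+ 2 - 2 * (smoothstep n).[y] ^+ 3.
Proof. by rewrite /= !hornerE. Qed.

Lemma smoothstep_itv n y : 0 <= y <= 1 -> 0 <= (smoothstep n).[y] <= 1.
Proof.
move=> y01; elim: n => [|n]; first by rewrite /= hornerX.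
rewrite smoothstepS; move: (_.[y]) => z /andP[z0 z1].
have -> : 3 * z ^+ 2 - 2 * z ^+ 3 = z ^+ 2 * (3 - 2 * z) by ring.
have A : 0 <= z ^+ 2 * (3 - 2 * z) by rewrite mulr_ge0 ?sqr_ge0//; lra.
have B : 0 <= (1 - z) ^+ 2 * (1 + 2 * z) by rewrite mulr_ge0 ?sqr_ge0//; lra.
by rewrite A -subr_ge0 (le_trans B)// le_eqVlt; apply/orP; left; apply/eqP; ring.
Qed.

Lemma smoothstep_sym n y : (smoothstep n).[1 - y] = 1 - (smoothstep n).[y].
Proof.
elim: n => [|n ih]; first by rewrite /= !hornerX.
by rewrite !smoothstepS ih; ring.
Qed.

Lemma smoothstep_half n : (smoothstep n).[2^-1] = 2^-1.
Proof. by have := smoothstep_sym n 2^-1; rewrite (_ : 1 - 2^-1 = 2^-1); lra. Qed.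

Lemma smoothstep_cvg0 y : 0 <= y < 2^-1 ->
  (fun n => (smoothstep n).[y]) @ \oo --> 0.
Proof.
(* [1 - r = (1 - y) (1 - 2 y)] is positive, and since the iterates stay below [y] each is at most
   [r] times the one before it. *)
move=> /andP[y0 y2]; set r := y * (3 - 2 * y).
have r0 : 0 <= r by rewrite /r; nra.
have r1 : r < 1 by rewrite /r; nra.
have H n : 0 <= (smoothstep n).[y] <= r ^+ n * y.
  elim: n => [|n /andP[z0 zr]]; first by rewrite /= hornerX expr0 mul1r y0 lexx.
  rewrite smoothstepS.
  have zy : (smoothstep n).[y] <= y.
    by apply: (le_trans zr); rewrite ler_piMl// exprn_ile1// ltW.
  rewrite [r ^+ _]exprS -mulrA; move: (_.[y]) z0 zr zy => z z0 zr zy.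
  have -> : 3 * z ^+ 2 - 2 * z ^+ 3 = z * (3 - 2 * z) * z by ring.
  have zz : 0 <= z * (3 - 2 * z) <= r by rewrite /r; nra.
  case/andP: zz => zz0 zz1.
  by apply/andP; split; [exact: mulr_ge0|exact: ler_pM].
apply: (@squeeze_cvgr _ _ _ _ (cst 0) (fun n => r ^+ n * y)).
- by apply: nearW => n; exact: H.
- exact: cvg_cst.
- rewrite -(mul0r y); apply: cvgMl => //.
  by apply: cvg_expr; rewrite ger0_norm.
Qed.

Lemma step_poly_le1 n y : 0 <= y <= 1 -> `|(step_poly n).[y]| <= 1.
Proof.
move=> /(smoothstep_itv n); rewrite /step_poly !hornerE ler_norml.
by move: (_.[y]) => z /andP[z0 z1]; apply/andP; split; nra.
Qed.

Lemma step_poly_cvg y : 0 <= y <= 1 ->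
  (fun n => (step_poly n).[y]) @ \oo --> ((2^-1 < y)%R%:R : R).
Proof.
move=> /andP[y0 y1].
have E (l : R) : (fun n => (smoothstep n).[y]) @ \oo --> l ->
    (fun n => (step_poly n).[y]) @ \oo --> (l * (2 * l - 1) : R).
  move=> sl; rewrite (_ : (fun n => (step_poly n).[y]) =
    (fun n => (smoothstep n).[y] * (2 * (smoothstep n).[y] - 1))); last first.
    by apply/funext => n; rewrite /step_poly !hornerE.
  by apply: cvgM => //; apply: cvgB; [apply: cvgMr|exact: cvg_cst].
case: ltgtP => y2.
- have -> : (1 : R) = 1 * (2 * 1 - 1) by ring.
  apply: E; rewrite (_ : (fun n => (smoothstep n).[y]) =
      fun n => 1 - (smoothstep n).[1 - y]); last first.
    by apply/funext => n; rewrite smoothstep_sym; ring.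
  rewrite -[X in _ --> X]subr0; apply: cvgB; first exact: cvg_cst.
  by apply: smoothstep_cvg0; lra.
- have -> : (false%:R : R) = 0 * (2 * 0 - 1) by rewrite mul0r.
  by apply: E; apply: smoothstep_cvg0; rewrite y0.
- have -> : (false%:R : R) = 2^-1 * (2 * 2^-1 - 1) by rewrite mulfV ?subrr ?mulr0.
  apply: E; rewrite -y2 (_ : (fun n => (smoothstep n).[2^-1]) = cst 2^-1).
    exact: cvg_cst.
  by apply/funext => n; rewrite smoothstep_half.
Qed.

End step_polynomials.

Section uniqueness.
Context {R : realType}.

Lemma Rintegral_indic d (T : measurableType d) (m : {finite_measure set T -> \bar R})
  (A : set T) : measurable A -> \int[m]_x (\1_A x : R) = fine (m A).
Proof. by move=> mA; rewrite /Rintegral integral_indic// setIT. Qed.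

Lemma measure_null_setI d (T : measurableType d) (m : {measure set T -> \bar R})
  (A K : set T) : measurable A -> measurable K -> m (~` K) = 0%E ->
  m (A `&` K) = m A.
Proof.
move=> mA mK mK0; rewrite -[in RHS](setIT A) -(setUv K) setIUr measureU//.
- rewrite [X in (_ + X)%E](_ : _ = 0%E) ?adde0//.
  by apply: (subset_measure0 _ _ _ mK0) => //;
    [apply: measurableI => //|]; exact: measurableC.
- exact: measurableI.
- by apply: measurableI => //; exact: measurableC.
- by rewrite setIACA setICr setI0.
Qed.

Lemma measure_eq_rays (m1 m2 : {measure set R -> \bar R}) :
  (m1 setT < +oo)%E ->
  (forall c, m1 `]c, +oo[%classic = m2 `]c, +oo[%classic) ->
  forall B, measurable B -> m1 B = m2 B.
Proof.
move=> m1oo m12; apply: (@measure_unique _ _ _ (@RGenOInfty.G R)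
    (fun k => `]- k%:R, +oo[%classic)).
- exact: RGenOInfty.measurableE.
- move=> _ _ [x ->] [y ->]; exists (Num.max x y); apply/seteqP; split => z /=.
    by rewrite !in_itv/= !andbT gt_max => -[-> ->].
  by rewrite !in_itv/= !andbT gt_max => /andP[].
- by move=> k; exists (- k%:R).
- apply/seteqP; split => // x _; exists (Num.trunc `|x|).+1 => //=.
  rewrite in_itv/= andbT ltrNl (le_lt_trans (ler_norm _))// normrN.
  by rewrite truncnS_gt.
- by move=> _ [c ->].
- move=> k; apply: le_lt_trans m1oo; apply: le_measure => //; rewrite ?inE//.
Qed.

(** [step_poly] composed with an affine map gives polynomials, uniformly bounded on the common
    range, that converge to the indicator of a ray; so moments determine the probabilities of
    rays. *)
Lemma eq_from_moments d1 d2 (T1 : measurableType d1) (T2 : measurableType d2)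
    (m1 : {finite_measure set T1 -> \bar R})
    (m2 : {finite_measure set T2 -> \bar R}) (h1 : T1 -> R) (h2 : T2 -> R) (C : R) :
  measurable_fun setT h1 -> measurable_fun setT h2 ->
  (forall x, `|h1 x| <= C) -> (forall x, `|h2 x| <= C) ->
  (forall n, \int[m1]_x h1 x ^+ n = \int[m2]_x h2 x ^+ n) ->
  forall B, measurable B -> m1 (h1 @^-1` B) = m2 (h2 @^-1` B).
Proof.
move=> mh1 mh2 h1C h2C h12.
have Eray c : m1 (h1 @^-1` `]c, +oo[) = m2 (h2 @^-1` `]c, +oo[).
  (* [K] bounds [|y - c|] for [|y| <= C], so the affine [q] maps the range into [0, 1] and sends [c]
     to 1/2, where the step polynomials jump in the limit. *)
  pose K := `|C| + `|c| + 1.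
  have K0 : 0 < K by rewrite /K ltr_pwDr// addr_ge0.
  pose q : {poly R} := 2^-1%:P + (2 * K)^-1 *: ('X - c%:P).
  have qE y : q.[y] = 2^-1 + (2 * K)^-1 * (y - c) by rewrite /q !hornerE.
  have q01 y : `|y| <= C -> 0 <= q.[y] <= 1.
    move=> yC; rewrite qE.
    have : `|(2 * K)^-1 * (y - c)| <= 2^-1.
      rewrite normrM gtr0_norm ?invr_gt0 ?mulr_gt0// invfM -mulrA ler_piMr//.
      rewrite ler_pdivrMl// mulr1 (le_trans (ler_normB _ _))// /K.
      by rewrite -addrA lerD// ?(le_trans yC) ?ler_norm// lerDl.
    by rewrite ler_norml => /andP[]; move: (_ * _) => z *; apply/andP; split; lra.
  have qc y : (2^-1 < q.[y]) = (c < y).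
    by rewrite qE ltrDl pmulr_rgt0 ?subr_gt0// invr_gt0 mulr_gt0.
  have L d (T : measurableType d) (m : {finite_measure set T -> \bar R})
      (h : T -> R) : measurable_fun setT h -> (forall x, `|h x| <= C) ->
      (fun n => \int[m]_x (step_poly n \Po q).[h x]) @ \oo -->
      fine (m (h @^-1` `]c, +oo[)).
    move=> mh hC.
    have mhc : measurable (h @^-1` `]c, +oo[).
      by rewrite -[X in measurable X]setTI; exact: mh.
    rewrite -Rintegral_indic//; apply: (@Rintegral_bounded_cvg _ _ _ _ _ _ 1).
    - move=> n; apply: (measurableT_comp (f := horner (step_poly n \Po q))) => //.
      by apply: continuous_measurable_fun; exact: continuous_horner.
    - by move=> n x; rewrite horner_comp; apply: step_poly_le1; exact: q01.
    - move=> x; rewrite indicE.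
      rewrite (_ : (x \in _) = (2^-1 < q.[h x])); last first.
        by rewrite qc; apply/idP/idP; rewrite inE/= in_itv/= andbT.
      under eq_fun do rewrite horner_comp.
      by apply: step_poly_cvg; exact: q01.
  have E n : \int[m1]_x (step_poly n \Po q).[h1 x] =
      \int[m2]_x (step_poly n \Po q).[h2 x].
    rewrite (Rintegral_horner _ _ mh1 h1C) (Rintegral_horner _ _ mh2 h2C).
    by apply: eq_bigr => i _; rewrite h12.
  have := L _ _ m1 h1 mh1 h1C; under eq_fun do rewrite E.
  move=> /(cvg_unique _ (L _ _ m2 h2 mh2 h2C)) => /(_ (@Rhausdorff R)) Ef.
  rewrite -[LHS]fineK ?fin_num_measure//; last first.
    by rewrite -[X in measurable X]setTI; exact: mh1.
  rewrite -Ef fineK// fin_num_measure//.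
  by rewrite -[X in measurable X]setTI; exact: mh2.
pose f1 : {mfun T1 >-> R} := HB.pack h1 (isMeasurableFun.Build _ _ _ _ h1 mh1).
pose f2 : {mfun T2 >-> R} := HB.pack h2 (isMeasurableFun.Build _ _ _ _ h2 mh2).
move=> B mB; apply: (@measure_eq_rays (pushforward m1 f1) (pushforward m2 f2)) => //.
change (m1 setT < +oo)%E; by rewrite -ge0_fin_numE// fin_num_measure.
Qed.

Lemma eq_from_transform (m1 m2 : {finite_measure set R -> \bar R})
    (h g : R -> R) (K : set R) (C : R) :
  measurable_fun setT h -> measurable_fun setT g -> measurable K ->
  (forall x, `|h x| <= C) -> (forall x, K x -> g (h x) = x) ->
  m1 (~` K) = 0%E -> m2 (~` K) = 0%E ->
  (forall n, \int[m1]_x h x ^+ n = \int[m2]_x h x ^+ n) ->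
  forall B, measurable B -> m1 B = m2 B.
Proof.
move=> mh mg mK hC gh m1K m2K h12 B mB.
have mgB : measurable (g @^-1` B) by rewrite -[X in measurable X]setTI; exact: mg.
have E : B `&` K = h @^-1` (g @^-1` B) `&` K.
  by apply/seteqP; split => x [/= Bx Kx]; split => //; move: Bx; rewrite /= gh.
have mhB : measurable (h @^-1` (g @^-1` B)).
  by rewrite -[X in measurable X]setTI; exact: mh.
rewrite -(measure_null_setI mB mK m1K) -(measure_null_setI mB mK m2K) E.
rewrite (measure_null_setI mhB mK m1K) (measure_null_setI mhB mK m2K).
exact: (eq_from_moments mh mh hC hC h12).
Qed.

Lemma measurable_cos_affine (u v : R) :
  measurable_fun setT (fun x : R => cos (u * x + v)).
Proof.
apply: continuous_measurable_fun => x.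
apply: continuous_comp; last exact: continuous_cos.
by apply: cvgD; [exact: mulrl_continuous|exact: cvg_cst].
Qed.

Lemma measurable_cosM (u : R) : measurable_fun setT (fun x : R => cos (u * x)).
Proof.
by have := measurable_cos_affine u 0; under eq_fun do rewrite addr0.
Qed.

Lemma measurable_sinM (u : R) : measurable_fun setT (fun x : R => sin (u * x)).
Proof.
have := measurable_cos_affine u (- (pi / 2)).
by under eq_fun do rewrite cosBpihalf.
Qed.

Lemma normr_cos_le1 (x : R) : `|cos x| <= 1.
Proof. by rewrite ler_norml cos_geN1 cos_le1. Qed.

Lemma normr_sin_le1 (x : R) : `|sin x| <= 1.
Proof. by rewrite ler_norml sin_geN1 sin_le1. Qed.

(** Products of cosines linearise, so the hypotheses give all moments of each cos (u x + v), hence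
    the law of that variable. The sign of sin (pi (x - c) / (n + 1)) agrees with that of x - c once
    |x - c| < n + 1, so the events where it is positive converge to the ray above [c]. *)
Lemma eq_from_fourier (m1 m2 : {finite_measure set R -> \bar R}) :
  (forall u, \int[m1]_x cos (u * x) = \int[m2]_x cos (u * x)) ->
  (forall u, \int[m1]_x sin (u * x) = \int[m2]_x sin (u * x)) ->
  forall B, measurable B -> m1 B = m2 B.
Proof.
move=> Ecos Esin.
have mcos := measurable_cos_affine.
have mX u v n : measurable_fun setT (fun x : R => cos (u * x + v) ^+ n).
  exact: measurable_funX.
have cos1 := normr_cos_le1.
have sin1 := normr_sin_le1.
(* The extra factor cos (a x + b) makes the induction run: one factor is taken out of the power and
   absorbed into it by the product formula. *)
have E n : forall u v a b, \int[m1]_x (cos (u * x + v) ^+ n * cos (a * x + b)) =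
    \int[m2]_x (cos (u * x + v) ^+ n * cos (a * x + b)).
  elim: n => [|n ih] u v a b.
    have S (m : {finite_measure set R -> \bar R}) :
        \int[m]_x (cos (u * x + v) ^+ 0 * cos (a * x + b)) =
        cos b * \int[m]_x cos (a * x) - sin b * \int[m]_x sin (a * x).
      rewrite -mulNr -(Rintegral_lin2 _ _ _ (C := 1) (D := 1))//.
      - apply: eq_Rintegral => x _; rewrite expr0 mul1r cosD.
        by rewrite [_ * cos b]mulrC [_ * sin b]mulrC mulNr.
      - exact: measurable_cosM.
      - exact: measurable_sinM.
    by rewrite !S Ecos Esin.
  have S (m : {finite_measure set R -> \bar R}) :
      \int[m]_x (cos (u * x + v) ^+ n.+1 * cos (a * x + b)) =
      2^-1 * \int[m]_x (cos (u * x + v) ^+ n * cos ((a + u) * x + (b + v))) +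
      2^-1 * \int[m]_x (cos (u * x + v) ^+ n * cos ((a - u) * x + (b - v))).
    have mcc s t : measurable_fun setT
        (fun x => cos (u * x + v) ^+ n * cos (s * x + t)).
      exact: measurable_funM.
    have cc s t x : `|cos (u * x + v) ^+ n * cos (s * x + t)| <= 1.
      by rewrite normrM normrX mulr_ile1// exprn_ile1.
    rewrite -(Rintegral_lin2 _ _ _ (C := 1) (D := 1))//.
    apply: eq_Rintegral => x _.
    rewrite (_ : (a + u) * x + (b + v) = (a * x + b) + (u * x + v)); last ring.
    rewrite (_ : (a - u) * x + (b - v) = (a * x + b) - (u * x + v)); last ring.
    by move: (a * x + b) (u * x + v) => p q; rewrite cosD cosB exprS; field.
  by rewrite !S !ih.
have En n u v : \int[m1]_x cos (u * x + v) ^+ n = \int[m2]_x cos (u * x + v) ^+ n.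
  have := E n u v 0 0.
  under eq_Rintegral do rewrite mul0r addr0 cos0 mulr1.
  by under [X in _ = X -> _]eq_Rintegral do rewrite mul0r addr0 cos0 mulr1.
apply: measure_eq_rays; first by rewrite -ge0_fin_numE// fin_num_measure.
move=> c.
pose h n (x : R) := cos (pi / n.+1%:R * x + (- (pi / n.+1%:R * c) - pi / 2)).
have hE n x : h n x = sin (pi / n.+1%:R * (x - c)).
  by rewrite /h addrA cosBpihalf -mulrN -mulrDr.
have mh n : measurable (h n @^-1` `]0, +oo[).
  by rewrite -[X in measurable X]setTI; exact: mcos.
have Eh n : m1 (h n @^-1` `]0, +oo[) = m2 (h n @^-1` `]0, +oo[).
  apply: (eq_from_moments (mcos _ _) (mcos _ _) (C := 1)) => //= *; exact: En.
have L (m : {finite_measure set R -> \bar R}) :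
    (fun n => fine (m (h n @^-1` `]0, +oo[))) @ \oo --> fine (m `]c, +oo[%classic).
  rewrite -Rintegral_indic//; under eq_fun do rewrite -Rintegral_indic//.
  apply: (@Rintegral_bounded_cvg _ _ _ _ _ _ 1).
  - by move=> n; exact: measurable_indic.
  - by move=> n x; rewrite indicE normr_nat; case: (_ \in _); rewrite ?ler01.
  - move=> x; apply: cvg_near_cst.
    near=> n.
    rewrite !indicE; congr (_ %:R); congr nat_of_bool.
    have n0 : (0 : R) < n.+1%:R by rewrite ltr0n.
    have xcn : `|x - c| < n.+1%:R.
      rewrite (lt_le_trans (truncnS_gt _))// ler_nat ltnS.
      by near: n; exact: nbhs_infty_ge.
    have itv (y : R) : 0 < y -> y < n.+1%:R -> 0 < sin (pi / n.+1%:R * y).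
      move=> y0 yn; apply: sin_gt0_pi.
      rewrite mulr_gt0 ?divr_gt0 ?pi_gt0//=.
      rewrite mulrAC ltr_pdivrMr// ltr_pM2l ?pi_gt0//.
    apply/idP/idP; rewrite !inE/= !in_itv/= !andbT hE.
      rewrite ltNge; apply: contraTT; rewrite -leNgt le_eqVlt => /predU1P[->|xc].
        by rewrite subrr mulr0 sin0 lexx.
      rewrite negbK -oppr_ge0 -sinN -mulrN ltW// opprB; apply: itv.
        by rewrite subr_gt0.
      by rewrite (le_lt_trans _ xcn)// distrC ler_norm.
    move=> cx; apply: itv; first by rewrite subr_gt0.
    by rewrite (le_lt_trans _ xcn)// ler_norm.
have := L m1; under eq_fun do rewrite Eh.
move=> /(cvg_unique _ (L m2)) => /(_ (@Rhausdorff R)) Ef.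
by rewrite -[LHS]fineK ?fin_num_measure// -Ef fineK// fin_num_measure.
Unshelve. all: by end_near.
Qed.

End uniqueness.

(** * Weighted kernels and products of several kernels *)

Section kernels.
Context {R : realType}.

Lemma subprobability_fine_itv d (T : measurableType d) (m : subprobability T R)
  (B : set T) : measurable B -> 0 <= fine (m B) <= 1.
Proof.
move=> mB; rewrite fine_ge0//= -lee_fin fineK ?fin_num_measure//.
apply: le_trans (@sprobability_setT _ _ _ m).
by apply: le_measure; rewrite ?inE.
Qed.

Lemma Rintegral_itv01 d (T : measurableType d) (m : subprobability T R)
    (f : T -> R) : measurable_fun setT f -> (forall x, 0 <= f x <= 1) ->
  0 <= \int[m]_x f x <= 1.
Proof.
move=> mf f01; have f1 x : `|f x| <= 1 by rewrite ger0_norm; case/andP: (f01 x).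
apply/andP; split; first by apply: Rintegral_ge0 => x _; case/andP: (f01 x).
have -> : 1 = 1%R * 1 :> R by rewrite mulr1.
apply: (@le_trans _ _ (1 * fine (m setT))); last first.
  by rewrite ler_wpM2l//; case/andP: (subprobability_fine_itv m measurableT).
rewrite -Rintegral_cst//; apply: le_Rintegral => //.
- exact: bounded_integrable f1.
- by apply: (bounded_integrable m (C := 1)) => // x; rewrite normr1.
- by move=> x _; case/andP: (f01 x).
Qed.

Section weighted.
Context {d} {T : measurableType d} {d'} {Y : measurableType d'}.
Variables (k : T -> subprobability Y R)
  (mk : forall B, measurable B -> measurable_fun setT (fun x => k x B)).

Let kg (x : T) : giry Y R := k x.

Let mkg : measurable_fun setT kg.
Proof. exact: measurable_giry_codensity. Qed.

Lemma measurable_Rintegral_kernel (f : Y -> R) : measurable_fun setT f ->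
  (forall y, 0 <= f y <= 1) -> measurable_fun setT (fun x => \int[k x]_y f y).
Proof.
move=> mf f01.
apply: (measurableT_comp (f := fine)) => //.
apply: (measurableT_comp (f := giry_int ^~ (EFin \o f)) (g := kg)) => //.
apply: measurable_giry_int; first exact/measurable_EFinP.
by move=> y; rewrite lee_fin; case/andP: (f01 y).
Qed.

Variables (G : T -> R) (mG : measurable_fun setT G)
  (G01 : forall x, 0 <= G x <= 1).

Let G0 x : 0 <= G x. Proof. by case/andP: (G01 x). Qed.

Let wk (x : T) := mscale (NngNum (G0 x)) (k x).

Let wk_setT x : (wk x setT <= 1)%E.
Proof.
rewrite /wk /mscale/= -[leRHS]mule1; apply: lee_pmul => //.
- by rewrite lee_fin.
- by rewrite lee_fin; case/andP: (G01 x).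
- exact: sprobability_setT.
Qed.

HB.instance Definition _ x := Measure.on (wk x).
HB.instance Definition _ x :=
  Measure_isSubProbability.Build _ _ _ (wk x) (wk_setT x).

Let wkg (x : T) : giry Y R := wk x.

Let mwkg : measurable_fun setT wkg.
Proof.
apply: measurable_giry_codensity => // B mB.
apply: emeasurable_funM; last exact: mk.
exact/measurable_EFinP.
Qed.

(** The measure B |-> E [G; k B] is the Giry bind of [Theta] with the kernel scaled by [G]; since
    [G <= 1] it is again a subprobability, to which uniqueness results apply. *)
Lemma weighted_kernel (Theta : subprobability T R) :
  exists m : subprobability Y R,
    (forall B, measurable B -> m B = (\int[Theta]_x ((G x)%:E * k x B))%E) /\
    (forall f : Y -> R, measurable_fun setT f -> (forall y, 0 <= f y <= 1) ->
      \int[m]_y f y = \int[Theta]_x (G x * \int[k x]_y f y)).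
Proof.
exists (giry_bind (Theta : giry T R) mwkg); split.
  move=> B mB; rewrite /giry_bind/=.
  rewrite [LHS](giry_int_map mwkg (Theta : giry T R)
    (measurable_giry_ev (R := R) mB)) //.
move=> f mf f01; rewrite /Rintegral; congr fine.
have f0 y : (0 <= (f y)%:E)%E by rewrite lee_fin; case/andP: (f01 y).
rewrite [LHS](giry_int_bind (Theta : giry T R) mwkg (h := EFin \o f))//; last first.
  exact/measurable_EFinP.
apply: eq_integral => x _; rewrite /giry_int/= ge0_integral_mscale//; last first.
  exact/measurable_EFinP.
rewrite EFinM (EFin_Rintegral (k x) (C := 1))//.
by move=> y; rewrite ger0_norm; case/andP: (f01 y).
Qed.

End weighted.

Section multi.
Context {d1 d2} {T1 : measurableType d1} {T2 : measurableType d2}.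
Variables (Theta1 : probability T1 R) (Theta2 : probability T2 R).
Variables (I : eqType) (J : Type) (j0 : J).
Variables (k1 : I -> T1 -> subprobability R R) (k2 : I -> T2 -> subprobability R R).
Hypotheses
  (mk1 : forall i B, measurable B -> measurable_fun setT (fun x => k1 i x B))
  (mk2 : forall i B, measurable B -> measurable_fun setT (fun x => k2 i x B)).
Variables (K : set R) (test : J -> R -> R).
Hypotheses (mK : measurable K)
  (k1K : forall i, {ae Theta1, forall x, k1 i x (~` K) = 0%E})
  (k2K : forall i, {ae Theta2, forall x, k2 i x (~` K) = 0%E})
  (mtest : forall j, measurable_fun setT (test j))
  (test01 : forall j x, 0 <= test j x <= 1)
  (test_det : forall m1 m2 : subprobability R R,
    m1 (~` K) = 0%E -> m2 (~` K) = 0%E ->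
    (forall j, \int[m1]_x test j x = \int[m2]_x test j x) ->
    forall B, measurable B -> m1 B = m2 B).

Let prod01 (A : Type) (s : seq A) (f : A -> R) :
  (forall i, 0 <= f i <= 1) -> 0 <= \prod_(i <- s) f i <= 1.
Proof.
move=> f01; elim: s => [|i s /andP[p0 p1]]; first by rewrite big_nil ler01 lexx.
case/andP: (f01 i) => i0 i1.
by rewrite big_cons mulr_ge0// mulr_ile1.
Qed.

Lemma weighted_kernel_null d (T : measurableType d) (Theta : probability T R)
    (k : T -> subprobability R R) (G : T -> R) : measurable_fun setT G ->
  {ae Theta, forall x, k x (~` K) = 0%E} ->
  measurable_fun setT (fun x => k x (~` K)) ->
  (\int[Theta]_x ((G x)%:E * k x (~` K)))%E = 0%E.
Proof.
move=> mG kK mkK; rewrite -[RHS](@integral0 _ _ _ Theta setT).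
apply: ae_eq_integral => //.
- by apply: emeasurable_funM => //; exact/measurable_EFinP.
- by move: kK; apply: filterS => x kx _; rewrite kx mule0.
Qed.

(** Tests are replaced by Borel sets one index at a time. All other factors are frozen into a weight
    [G], and [test_det] is applied to the two weighted measures, whose integrals against every test
    agree by the induction hypothesis. *)
Lemma eq_multi_kernel (l : seq I) : uniq l ->
  (forall j : I -> J,
    \int[Theta1]_x \prod_(i <- l) \int[k1 i x]_y test (j i) y =
    \int[Theta2]_x \prod_(i <- l) \int[k2 i x]_y test (j i) y) ->
  forall B : I -> set R, (forall i, measurable (B i)) ->
    \int[Theta1]_x \prod_(i <- l) fine (k1 i x (B i)) =
    \int[Theta2]_x \prod_(i <- l) fine (k2 i x (B i)).
Proof.
move=> ul H B mB.
have b01 (T : Type) (k : I -> T -> subprobability R R) x i :=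
  subprobability_fine_itv (k i x) (mB i).
(* [l1] holds the indices already evaluated on sets, [l2] those still paired with test functions. *)
suff: forall l1 l2 : seq I, uniq (l1 ++ l2) ->
    (forall j : I -> J,
      \int[Theta1]_x \prod_(i <- l1 ++ l2) \int[k1 i x]_y test (j i) y =
      \int[Theta2]_x \prod_(i <- l1 ++ l2) \int[k2 i x]_y test (j i) y) ->
    forall j : I -> J,
      \int[Theta1]_x (\prod_(i <- l1) fine (k1 i x (B i)) *
        \prod_(i <- l2) \int[k1 i x]_y test (j i) y) =
      \int[Theta2]_x (\prod_(i <- l1) fine (k2 i x (B i)) *
        \prod_(i <- l2) \int[k2 i x]_y test (j i) y).
  move=> W; have := W l [::]; rewrite cats0 => /(_ ul H (fun=> j0)).
  under eq_Rintegral do rewrite big_nil mulr1.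
  by under [X in _ = X -> _]eq_Rintegral do rewrite big_nil mulr1.
elim=> [|i l1 ih] l2 ul12 Hl j.
  under eq_Rintegral do rewrite big_nil mul1r.
  under [RHS]eq_Rintegral do rewrite big_nil mul1r.
  exact: Hl.
have il2 : i \notin l2.
  by move: ul12; rewrite /= mem_cat negb_or => /andP[/andP[]].
have pE : perm_eq (l1 ++ i :: l2) ((i :: l1) ++ l2) 
  by rewrite -(cat1s i l2) perm_catCA.
have ul12' : uniq (l1 ++ i :: l2) by rewrite (perm_uniq pE).
have Hl' j' : \int[Theta1]_x \prod_(i <- l1 ++ i :: l2) \int[k1 i x]_y test (j' i) y =
    \int[Theta2]_x \prod_(i <- l1 ++ i :: l2) \int[k2 i x]_y test (j' i) y.
  under eq_Rintegral do rewrite (perm_big _ pE).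
  under [RHS]eq_Rintegral do rewrite (perm_big _ pE).
  exact: Hl.
have {}ih := ih _ ul12' Hl'.
pose G (T : Type) (k : I -> T -> subprobability R R) (x : T) : R := \prod_(i <- l1) fine (k i x (B i) : \bar R) *
  \prod_(i <- l2) \int[k i x]_y test (j i) y.
have mG d (T : measurableType d) (k : I -> T -> subprobability R R) :
    (forall i B, measurable B -> measurable_fun setT (fun x => k i x B)) ->
    measurable_fun setT (G T k).
  move=> mk; apply: measurable_funM; apply: measurable_prod => i' _.
    by apply: (measurableT_comp (f := fine)) => //; exact: mk.
  by apply: measurable_Rintegral_kernel => //; exact: mk.
have G01 d (T : measurableType d) (k : I -> T -> subprobability R R) x :
    0 <= G T k x <= 1.
  have /andP[p0 p1] := prod01 l1 (b01 T k x).
  have /andP[q0 q1] := prod01 l2 (fun i => Rintegral_itv01 (k i x) (mtest (j i)) (test01 (j i))).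
  by rewrite mulr_ge0//= mulr_ile1.
have [n1 [n1B n1f]] := weighted_kernel (mk1 i) (mG _ _ _ mk1) (G01 _ _ k1) Theta1.
have [n2 [n2B n2f]] := weighted_kernel (mk2 i) (mG _ _ _ mk2) (G01 _ _ k2) Theta2.
have nB : n1 (B i) = n2 (B i).
  apply: test_det => //.
  - rewrite n1B; last exact: measurableC.
    apply: weighted_kernel_null; [exact: mG|exact: k1K|].
    by apply: mk1; exact: measurableC.
  - rewrite n2B; last exact: measurableC.
    apply: weighted_kernel_null; [exact: mG|exact: k2K|].
    by apply: mk2; exact: measurableC.
  - move=> j'; rewrite n1f// n2f//.
    (* The test at [i] varies while the others follow [j]; uniqueness of the indices ensures that
       the change does not reach [l2]. *)
    have := ih (fun i' => if i' == i then j' else j i').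
    have E d (T : measurableType d) (Theta : probability T R)
        (k : I -> T -> subprobability R R) :
      \int[Theta]_x (\prod_(i <- l1) fine (k i x (B i)) *
        \prod_(i0 <- i :: l2)
          \int[k i0 x]_y test (if i0 == i then j' else j i0) y) =
      \int[Theta]_x (G T k x * \int[k i x]_y test j' y).
      apply: eq_Rintegral => x _; rewrite big_cons eqxx /G -[RHS]mulrA.
      congr (_ * _); rewrite mulrC; congr (_ * _).
      rewrite big_seq_cond [RHS]big_seq_cond; apply: eq_bigr => i' /andP[i'l2 _].
      by case: eqP => // i'i; move: i'l2; rewrite i'i (negbTE il2).
    by rewrite !E.
have E d (T : measurableType d) (Theta : probability T R)
    (k : I -> T -> subprobability R R) :
    (forall i B, measurable B -> measurable_fun setT (fun x => k i x B)) ->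
    \int[Theta]_x (\prod_(i <- i :: l1) fine (k i x (B i)) *
      \prod_(i <- l2) \int[k i x]_y test (j i) y) =
    fine (\int[Theta]_x ((G T k x)%:E * k i x (B i)))%E.
  move=> mk; congr fine; apply: eq_integral => x _.
  by rewrite big_cons -mulrA EFinM fineK ?fin_num_measure// muleC.
by rewrite !E// -n1B// -n2B// nB.
Qed.

End multi.
End kernels.

(** * Compound Poisson laws *)

(* Formulas for nonnegative functions extend to [-1, 1]-valued ones by
   f = 2 ((f + 1) / 2) - 1. *)
Section recenter.
Context {R : realType} {d : measure_display} {T : measurableType d}.
Implicit Types f g : T -> R.

Lemma recenter_itv01 f : (forall x, `|f x| <= 1) ->
  forall x, 0 <= 2^-1 * f x + 2^-1 * 1 <= 1.
Proof.
move=> f1 x; have := f1 x; rewrite ler_norml => /andP[? ?].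
by apply/andP; split; lra.
Qed.

Lemma measurable_recenter f : measurable_fun setT f ->
  measurable_fun setT (fun x => 2^-1 * f x + 2^-1 * 1).
Proof. by move=> mf; apply: measurable_funD => //; exact: measurable_funM. Qed.

Lemma itv01_norm g : (forall x, 0 <= g x <= 1) -> forall x, `|g x| <= 1.
Proof. by move=> g01 x; rewrite ger0_norm; case/andP: (g01 x). Qed.

Lemma Rintegral_recenter (m : {finite_measure set T -> \bar R}) f :
  measurable_fun setT f -> (forall x, `|f x| <= 1) ->
  \int[m]_x f x = 2 * \int[m]_x (2^-1 * f x + 2^-1 * 1) + (-1) * \int[m]_x 1.
Proof.
move=> mf f1.
rewrite -(Rintegral_lin2 m 2 (-1) (measurable_recenter mf)
  (measurable_cst (1 : R)) (itv01_norm (recenter_itv01 f1)) (D := 1)).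
  by apply: eq_Rintegral => x _ /=; field.
by move=> x; rewrite normr1.
Qed.

Lemma normr_Rintegral_le1 (m : subprobability T R) f : measurable_fun setT f ->
  (forall x, `|f x| <= 1) -> `|\int[m]_x f x| <= 1.
Proof.
move=> mf f1; apply: (le_trans (le_normr_Rintegral _ _)) => //.
  exact: bounded_integrable f1.
have mnf : measurable_fun setT (fun x => `|f x|) by exact: measurableT_comp.
have nf01 x : 0 <= `|f x| <= 1 by rewrite normr_ge0 f1.
by have /andP[] := Rintegral_itv01 m mnf nf01.
Qed.

End recenter.

Lemma giry_bind_Rintegral {R : realType} d1 d2 (T1 : measurableType d1)
    (T2 : measurableType d2) (mu : giry T1 R) (k : T1 -> giry T2 R)
    (mk : measurable_fun setT k) (f : T2 -> R) :
  measurable_fun setT f -> (forall x, `|f x| <= 1) ->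
  \int[giry_bind mu mk]_y f y = \int[mu]_x \int[k x]_y f y.
Proof.
have mkB B : measurable B -> measurable_fun setT (fun x => k x B).
  move=> mB; apply: (measurableT_comp (f := giry_ev ^~ B) (g := k)) => //.
  exact: measurable_giry_ev.
have E01 (g : T2 -> R) : measurable_fun setT g -> (forall x, 0 <= g x <= 1) ->
    \int[giry_bind mu mk]_y g y = \int[mu]_x \int[k x]_y g y.
  move=> mg g01; rewrite {1}/Rintegral; congr fine.
  rewrite [LHS](giry_int_bind mu mk (h := EFin \o g)).
  - apply: eq_integral => x _; rewrite (EFin_Rintegral (k x) (C := 1))//.
    exact: itv01_norm.
  - exact/measurable_EFinP.
  - by move=> x; rewrite lee_fin; case/andP: (g01 x).
move=> mf f1.
rewrite Rintegral_recenter// E01; last 2 first.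
- exact: measurable_recenter.
- exact: recenter_itv01.
have one01 y : 0 <= (cst 1 : T2 -> R) y <= 1 by rewrite /= ler01 lexx.
rewrite (E01 (cst 1))//.
rewrite -(Rintegral_lin2 mu 2 (-1) (C := 1) (D := 1)).
- by apply: eq_Rintegral => x _; rewrite [RHS]Rintegral_recenter.
- exact: (measurable_Rintegral_kernel mkB (measurable_recenter mf) (recenter_itv01 f1)).
- exact: (measurable_Rintegral_kernel mkB (measurable_cst (1 : R)) one01).
- apply: itv01_norm => x.
  exact: (Rintegral_itv01 _ (measurable_recenter mf) (recenter_itv01 f1)).
- apply: itv01_norm => x.
  exact: (Rintegral_itv01 _ (measurable_cst (1 : R)) one01).
Qed.

Lemma Rintegral_nat_series {R : realType} (m : {finite_measure set nat -> \bar R})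
    (a : nat -> R) (C : R) : (forall n, `|a n| <= C) ->
  series (fun n => fine (m [set n]) * a n) @ \oo --> \int[m]_n a n.
Proof.
move=> aC.
have C0 : 0 <= C := le_trans (normr_ge0 _) (aC 0%N).
pose f N n : R := \sum_(i < N) a i * \1_[set (i : nat)] n.
have fE N n : f N n = if (n < N)%N then a n else 0.
  rewrite /f; case: ifPn => nN.
    rewrite (bigD1 (Ordinal nN))//= indicE mem_set// mulr1 big1 ?addr0// => i iN.
    rewrite indicE memNset ?mulr0// => /= ni.
    by move/eqP: iN; apply; apply: val_inj => /=.
  rewrite big1// => i _; rewrite indicE memNset ?mulr0// => /= ni.
  by move: nN; rewrite ni ltn_ord.
rewrite (_ : series _ = fun N => \int[m]_n f N n); last first.
  apply/funext => N; rewrite /f (@Rintegral_sum _ _ _ _ _ _ _ (fun=> C)).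
  - rewrite /series/= big_mkord; apply: eq_bigr => i _; rewrite RintegralZl//.
      by rewrite mulrC Rintegral_indic.
    apply: (bounded_integrable m (C := 1)) => // n.
    by rewrite indicE normr_nat; case: (_ \in _); rewrite ?ler01.
  - by [].
  - move=> i n; rewrite normrM -[leRHS]mulr1 ler_pM//.
    by rewrite indicE normr_nat; case: (_ \in _); rewrite ?ler01.
apply: (@Rintegral_bounded_cvg _ _ _ _ _ _ C) => //.
- by move=> N n; rewrite fE; case: ifP; rewrite ?normr0.
- move=> n; apply: cvg_near_cst; near=> N; rewrite fE ifT//.
  by near: N; exists n.+1.
Unshelve. all: by end_near.
Qed.

(** * Convolution powers and compound Poisson laws *)

Section convolution.
Context {R : realType}.
Implicit Types (mu nu : giry R R) (f : R -> R).

Let addp (p : R * R) : R := p.1 + p.2.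

Let measurable_addp : measurable_fun setT addp.
Proof. by apply: measurable_funD; [exact: measurable_fst|exact: measurable_snd]. Qed.

Definition conv mu nu : giry R R := giry_map measurable_addp (giry_prod (mu, nu)).

Lemma conv_integral01 mu nu f : measurable_fun setT f ->
  (forall x, 0 <= f x <= 1) ->
  \int[conv mu nu]_x f x = \int[mu]_x \int[nu]_y f (x + y).
Proof.
move=> mf f01.
have f0 x : (0 <= (f x)%:E)%E by rewrite lee_fin; case/andP: (f01 x).
rewrite {1}/Rintegral; congr fine.
rewrite [LHS](giry_int_map measurable_addp (giry_prod (mu, nu))
  (h := EFin \o f))//; last exact/measurable_EFinP.
have mfa : measurable_fun setT (EFin \o f \o addp).
  by apply: measurableT_comp => //; exact/measurable_EFinP.
rewrite /giry_int [LHS](fubini_tonelli1 (m1 := mu) (m2 := nu) _ mfa)//; last first.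
  by move=> p; exact: f0.
apply: eq_integral => x _; rewrite /fubini_F/=.
rewrite (EFin_Rintegral nu (C := 1))//.
  by apply: measurableT_comp => //; exact: measurable_funD.
by move=> y; rewrite ger0_norm; case/andP: (f01 (x + y)).
Qed.

Let measurable_shift f (x : R) : measurable_fun setT f ->
  measurable_fun setT (fun y : R => f (x + y)).
Proof. by move=> mf; apply: measurableT_comp => //; exact: measurable_funD. Qed.

Let measurable_Rintegral_shift01 nu f : measurable_fun setT f ->
  (forall x, 0 <= f x <= 1) -> measurable_fun setT (fun x : R => \int[nu]_y f (x + y)).
Proof.
move=> mf f01.
have f0 x : (0 <= (f x)%:E)%E by rewrite lee_fin; case/andP: (f01 x).
apply: (measurableT_comp (f := fine)) => //.
have mfa : measurable_fun setT (EFin \o f \o addp).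
  by apply: measurableT_comp => //; exact/measurable_EFinP.
exact: (@measurable_fun_fubini_tonelli_F _ _ _ _ _ nu _ mfa (fun p => f0 _)).
Qed.

Lemma measurable_Rintegral_shift nu f : measurable_fun setT f ->
  (forall x, `|f x| <= 1) -> measurable_fun setT (fun x : R => \int[nu]_y f (x + y)).
Proof.
move=> mf f1.
under eq_fun => x do rewrite (Rintegral_recenter nu (f := fun y : R => f (x + y))
  (measurable_shift x mf) (fun y : R => f1 (x + y))).
apply: measurable_funD => //; apply: measurable_funM => //.
exact: (measurable_Rintegral_shift01 nu (measurable_recenter mf) (recenter_itv01 f1)).
Qed.

Lemma conv_integral mu nu f : measurable_fun setT f ->
  (forall x, `|f x| <= 1) ->
  \int[conv mu nu]_x f x = \int[mu]_x \int[nu]_y f (x + y).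
Proof.
move=> mf f1.
rewrite Rintegral_recenter// conv_integral01//; last 2 first.
- exact: measurable_recenter.
- exact: recenter_itv01.
rewrite (conv_integral01 mu nu (f := cst 1))//; last first.
  by move=> x; rewrite /= ler01 lexx.
have b01 (g : R -> R) : measurable_fun setT g -> (forall x, 0 <= g x <= 1) ->
    forall x : R, `|\int[nu]_y g (x + y)| <= 1.
  move=> mg g01 x.
  have /andP[h0 h1] := Rintegral_itv01 nu (measurable_shift x mg) (fun y : R => g01 (x + y)).
  by rewrite ger0_norm.
rewrite -(Rintegral_lin2 mu 2 (-1) (C := 1) (D := 1)); last 4 first.
- exact: (measurable_Rintegral_shift01 nu (measurable_recenter mf) (recenter_itv01 f1)).
- by apply: (measurable_Rintegral_shift nu (measurable_cst (1 : R))) => x; rewrite normr1.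
- exact: (b01 _ (measurable_recenter mf) (recenter_itv01 f1)).
- by apply: (b01 (cst 1)) => // x; rewrite /= ler01 lexx.
apply: eq_Rintegral => x _.
by rewrite [RHS](Rintegral_recenter nu (f := fun y : R => f (x + y))
  (measurable_shift x mf) (fun y : R => f1 (x + y))).
Qed.

Fixpoint convpow mu n : giry R R :=
  if n is k.+1 then conv mu (convpow mu k) else giry_ret (0 : R).

Let measurable_convpow mu : measurable_fun setT (convpow mu).
Proof. by []. Qed.

Definition compound_poisson (t : R) mu : giry R R :=
  giry_bind (poisson_prob t 0 : giry nat R) (measurable_convpow mu).

Lemma Rintegral_giry_ret (x : R) f : measurable_fun setT f ->
  \int[giry_ret x]_y f y = f x.
Proof.
move=> mf; rewrite /Rintegral.
rewrite [X in fine X](giry_int_ret (R := R) x (f := EFin \o f))//.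
exact/measurable_EFinP.
Qed.

Lemma poisson_prob1 (t : R) n : 0 <= t ->
  fine (poisson_prob t 0 [set n]) = expR (- t) * (t ^+ n / n`!%:R).
Proof.
move=> t0; rewrite /poisson_prob; case: ifPn => [tp|].
  by rewrite esum_set1 ?lee_fin ?poisson_pmf_ge0//= /poisson_pmf tp mulrC.
rewrite -leNgt => tn; have -> : t = 0 by apply/eqP; rewrite eq_le tn.
rewrite oppr0 expR0 mul1r diracE; case: n => [|n].
  by rewrite mem_set//= expr0 fact0 divr1.
by rewrite memNset//= expr0n mul0r.
Qed.

Lemma compound_poisson_integral t mu f : 0 <= t -> measurable_fun setT f ->
  (forall x, `|f x| <= 1) ->
  series (fun n => expR (- t) * (t ^+ n / n`!%:R) * \int[convpow mu n]_x f x)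
    @ \oo --> \int[compound_poisson t mu]_x f x.
Proof.
move=> t0 mf f1; rewrite giry_bind_Rintegral//.
under [X in X @ _]eq_fun do under eq_bigr do rewrite -poisson_prob1//.
apply: (@Rintegral_nat_series _ _ _ 1) => n.
exact: normr_Rintegral_le1.
Qed.

Lemma compound_poisson_measure t mu (B : set R) : 0 <= t -> measurable B ->
  series (fun n => expR (- t) * (t ^+ n / n`!%:R) * fine (convpow mu n B))
    @ \oo --> fine (compound_poisson t mu B).
Proof.
move=> t0 mB; rewrite -Rintegral_indic//.
under [X in X @ _]eq_fun do under eq_bigr do rewrite -Rintegral_indic//.
apply: compound_poisson_integral => // x.
by rewrite indicE normr_nat; case: (_ \in _); rewrite ?ler01.
Qed.

End convolution.

(** * The power series of exp ((a + i b) x) in real terms *)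

Section exponential_series.
Context {R : realType}.

(* The real and imaginary parts of (a + ib)^n. *)
Fixpoint cpow (a b : R) n : R * R :=
  if n is k.+1 then
    (a * (cpow a b k).1 - b * (cpow a b k).2, a * (cpow a b k).2 + b * (cpow a b k).1)
  else (1, 0).

Lemma cpow_bound a b n :
  `|(cpow a b n).1| <= (`|a| + `|b|) ^+ n /\ `|(cpow a b n).2| <= (`|a| + `|b|) ^+ n.
Proof.
elim: n => [|n [ih1 ih2]] /=; first by rewrite normr1 normr0 expr0 lexx ler01.
rewrite exprS mulrDl; split.
  by rewrite (le_trans (ler_normB _ _))// !normrM lerD// ler_wpM2l.
by rewrite (le_trans (ler_normD _ _))// !normrM lerD// ler_wpM2l.
Qed.

Lemma pseries_fact_cvg (c : nat -> R) (M r : R) : 0 <= M -> 0 <= r ->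
  (forall n, `|c n| <= M * r ^+ n) ->
  forall x : R, cvgn (pseries (fun n => c n / n`!%:R) x).
Proof.
move=> M0 r0 cr x; apply: normed_cvg.
apply: (series_le_cvg (v_ := fun n => M * exp_coeff (r * `|x|) n)).
- by move=> n /=.
- by move=> n; rewrite mulr_ge0// exp_coeff_ge0// mulr_ge0.
- move=> n /=; rewrite /exp_coeff/= normrM normrX normrM exprMn mulrAC.
  rewrite [`|_^-1|]ger0_norm ?invr_ge0// mulrA ler_wpM2r ?invr_ge0// mulrA.
  by rewrite ler_wpM2r.
- by apply: is_cvg_seriesZ; exact: is_cvg_series_exp_coeff.
Qed.

Lemma is_derive_pseries_fact (c : nat -> R) (r x : R) : 0 <= r ->
  (forall n, `|c n| <= r ^+ n) ->
  is_derive x 1 (fun y : R => limn (pseries (fun n => c n / n`!%:R) y))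
    (limn (pseries (fun n => c n.+1 / n`!%:R) x)).
Proof.
move=> r0 cr.
have D (c' : nat -> R) : pseries_diffs (fun n => c' n / n`!%:R) =
    fun n => c' n.+1 / n`!%:R.
  apply/funext => n; rewrite /pseries_diffs factS natrM invfM.
  by rewrite mulrCA mulVKf ?pnatr_eq0.
have B k n : `|c (n + k)%N| <= r ^+ k * r ^+ n by rewrite -exprD addnC.
have C k : forall y : R, cvgn (pseries (fun n => c (n + k)%N / n`!%:R) y).
  by apply: (pseries_fact_cvg (M := r ^+ k) (r := r)) => //; exact: exprn_ge0.
have {}C k (y : R) : cvgn (pseries (fun n => c (n + k)%N / n`!%:R) y) by exact: C.
have E0 : (fun n => c n / n`!%:R) = (fun n => c (n + 0)%N / n`!%:R).
  by apply/funext => n; rewrite addn0.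
have E1 : (fun n => c n.+1 / n`!%:R) = (fun n => c (n + 1)%N / n`!%:R).
  by apply/funext => n; rewrite addn1.
have E2 : (fun n => c n.+2 / n`!%:R) = (fun n => c (n + 2)%N / n`!%:R).
  by apply/funext => n; rewrite addn2.
rewrite -[X in limn (pseries X x)](D c).
apply: (@pseries_snd_diffs _ _ (`|x| + 1)).
- by rewrite E0; exact: C.
- by rewrite D E1; exact: C.
- by rewrite D (D (fun n => c n.+1)) E2; exact: C.
- by rewrite [ltRHS]ger0_norm ?addr_ge0// ltrDl.
Qed.

Section cpow_series.
Variables a b : R.

Let f (x : R) : R := limn (pseries (fun n => (cpow a b n).1 / n`!%:R) x).
Let g (x : R) : R := limn (pseries (fun n => (cpow a b n).2 / n`!%:R) x).

Let cvg1 (x : R) : cvgn (pseries (fun n => (cpow a b n).1 / n`!%:R) x).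
Proof.
apply: (pseries_fact_cvg (M := 1) (r := `|a| + `|b|)) => // n.
by rewrite mul1r; case: (cpow_bound a b n).
Qed.

Let cvg2 (x : R) : cvgn (pseries (fun n => (cpow a b n).2 / n`!%:R) x).
Proof.
apply: (pseries_fact_cvg (M := 1) (r := `|a| + `|b|)) => // n.
by rewrite mul1r; case: (cpow_bound a b n).
Qed.

Let limD (s t x : R) :
  limn (pseries (fun n => (s * (cpow a b n).1 + t * (cpow a b n).2) / n`!%:R) x) =
  s * f x + t * g x.
Proof.
apply: cvg_lim => //.
rewrite (_ : pseries _ x = fun N =>
    s * pseries (fun n => (cpow a b n).1 / n`!%:R) x N +
    t * pseries (fun n => (cpow a b n).2 / n`!%:R) x N); last first.
  apply/funext => N; rewrite /pseries/series/= !mulr_sumr -big_split/=.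
  by apply: eq_bigr => i _; ring.
by apply: cvgD; apply: cvgMr; [exact: cvg1|exact: cvg2].
Qed.

Let df (x : R) : is_derive x 1 f (a * f x - b * g x).
Proof.
have := @is_derive_pseries_fact (fun n => (cpow a b n).1) (`|a| + `|b|) x
  (addr_ge0 (normr_ge0 _) (normr_ge0 _)) (fun n => (cpow_bound a b n).1).
rewrite -/f -mulNr -limD /=.
by under [in X in _ -> X]eq_fun do rewrite mulNr.
Qed.

Let dg (x : R) : is_derive x 1 g (a * g x + b * f x).
Proof.
have := @is_derive_pseries_fact (fun n => (cpow a b n).2) (`|a| + `|b|) x
  (addr_ge0 (normr_ge0 _) (normr_ge0 _)) (fun n => (cpow_bound a b n).2).
rewrite -/g addrC -limD /=.
by under [in X in _ -> X]eq_fun do rewrite addrC.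
Qed.

Let f0 : f 0 = 1.
Proof.
apply: cvg_lim => //; apply: cvg_near_cst; near=> N.
rewrite /pseries/series/=; have -> : N = N.-1.+1 by rewrite prednK//; near: N; exists 1%N.
rewrite big_nat_recl//= expr0 fact0 divr1 mulr1 big1 ?addr0// => i _.
by rewrite exprS mul0r mulr0.
Unshelve. all: by end_near.
Qed.

Let g0 : g 0 = 0.
Proof.
apply: cvg_lim => //; apply: cvg_near_cst; near=> N.
rewrite /pseries/series/= big1// => -[|i] _; first by rewrite /= mul0r mul0r.
by rewrite exprS mul0r mulr0.
Unshelve. all: by end_near.
Qed.

(** The pair (f, g) solves the linear system y' = (a + i b) y. Multiplied by exp (- (a + i b) x) it
    has derivative 0; [h] and [k] are the real and imaginary parts of that product, with the values
    1 and 0 at the origin. *)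
Lemma exp_series (x : R) : f x = expR (a * x) * cos (b * x) /\
  g x = expR (a * x) * sin (b * x).
Proof.
pose e (y : R) : R := expR (- a * y).
pose h (y : R) : R := e y * (cos (b * y) * f y + sin (b * y) * g y).
pose k (y : R) : R := e y * (cos (b * y) * g y - sin (b * y) * f y).
have dlin (c y : R) : is_derive y 1 (fun z : R => c * z) c.
  by apply: is_derive_eq; rewrite [_ *: _]mulr1.
have de (y : R) : is_derive y 1 e (e y * - a).
  exact: (is_derive1_comp (is_derive_expR (- a * y)) (dlin (- a) y)).
have dc (y : R) : is_derive y 1 (fun z : R => cos (b * z)) (- sin (b * y) * b).
  exact: (is_derive1_comp (is_derive_cos (b * y)) (dlin b y)).
have ds (y : R) : is_derive y 1 (fun z : R => sin (b * z)) (cos (b * y) * b).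
  exact: (is_derive1_comp (is_derive_sin (b * y)) (dlin b y)).
have dh (y : R) : is_derive y 1 h 0.
  apply: (is_derive_eq (is_deriveM (de y) (is_deriveD
    (is_deriveM (dc y) (df y)) (is_deriveM (ds y) (dg y))))).
  change (e y * (cos (b * y) * (a * f y - b * g y) + f y * (- sin (b * y) * b) +
    (sin (b * y) * (a * g y + b * f y) + g y * (cos (b * y) * b))) +
    (cos (b * y) * f y + sin (b * y) * g y) * (e y * - a) = 0); ring.
have dk (y : R) : is_derive y 1 k 0.
  apply: (is_derive_eq (is_deriveM (de y) (is_deriveB
    (is_deriveM (dc y) (dg y)) (is_deriveM (ds y) (df y))))).
  change (e y * (cos (b * y) * (a * g y + b * f y) + g y * (- sin (b * y) * b) -
    (sin (b * y) * (a * f y - b * g y) + f y * (cos (b * y) * b))) +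
    (cos (b * y) * g y - sin (b * y) * f y) * (e y * - a) = 0); ring.
have hx : h x = 1.
  rewrite (is_derive_0_is_cst x 0 dh) /h /e f0 g0 !mulr0 expR0 cos0.
  by rewrite addr0 !mul1r.
have kx : k x = 0.
  rewrite (is_derive_0_is_cst x 0 dk) /k /e f0 g0 !mulr0 expR0 sin0.
  by rewrite mul0r subr0 mulr0.
have E : expR (a * x) * e x = 1.
  by rewrite /e mulNr expRN mulfV// gt_eqF// expR_gt0.
have cs := cos2Dsin2 (b * x).
have -> : f x = (expR (a * x) * e x) * (cos (b * x) ^+ 2 + sin (b * x) ^+ 2) * f x.
  by rewrite E cs !mul1r.
have -> : g x = (expR (a * x) * e x) * (cos (b * x) ^+ 2 + sin (b * x) ^+ 2) * g x.
  by rewrite E cs !mul1r.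
split.
  transitivity (expR (a * x) * (cos (b * x) * h x - sin (b * x) * k x)).
    by rewrite /h /k; ring.
  by rewrite hx kx mulr0 subr0 mulr1.
transitivity (expR (a * x) * (sin (b * x) * h x + cos (b * x) * k x)).
  by rewrite /h /k; ring.
by rewrite hx kx mulr0 addr0 mulr1.
Qed.

End cpow_series.
End exponential_series.

(** * Characteristic functions and Laplace transforms of compound Poisson laws *)

Section compound_poisson_transforms.
Context {R : realType}.

Lemma ae_eq_Rintegral d (T : measurableType d) (m : {finite_measure set T -> \bar R})
    (f g : T -> R) : measurable_fun setT f -> measurable_fun setT g ->
  {ae m, forall x, f x = g x} -> \int[m]_x f x = \int[m]_x g x.
Proof.
move=> mf mg fg; congr fine; apply: ae_eq_integral => //.
- exact/measurable_EFinP.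
- exact/measurable_EFinP.
- by apply: filterS fg => x -> _.
Qed.

Lemma finite_measureE d (T : measurableType d) (m : {finite_measure set T -> \bar R})
  (B : set T) (r : R) : measurable B -> fine (m B) = r -> m B = r%:E.
Proof. by move=> mB <-; rewrite fineK// fin_num_measure. Qed.

Lemma limn_pseries (c : nat -> R) (x : R) (l : R) :
  series (fun n => c n * x ^+ n) @ \oo --> l -> limn (pseries c x) = l.
Proof. by move=> h; apply: cvg_lim. Qed.

Lemma compound_poisson_series t (mu : giry R R) (f : R -> R) (c : nat -> R) :
  0 <= t -> measurable_fun setT f -> (forall x, `|f x| <= 1) ->
  (forall n, \int[convpow mu n]_x f x = c n) ->
  \int[compound_poisson t mu]_x f x =
  expR (- t) * limn (pseries (fun n => c n / n`!%:R) t).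
Proof.
move=> t0 mf f1 fc; have H := compound_poisson_integral (mu := mu) t0 mf f1.
rewrite (@limn_pseries _ t (expR t * \int[compound_poisson t mu]_x f x)).
  by rewrite mulrA -expRD addNr expR0 mul1r.
rewrite (_ : series _ = fun N => expR t *
  series (fun n => expR (- t) * (t ^+ n / n`!%:R) * \int[convpow mu n]_x f x) N).
  by apply: cvgMr; exact: H.
apply/funext => N; rewrite /series/= mulr_sumr; apply: eq_bigr => n _.
by rewrite fc 2!mulrA -expRD subrr expR0 mul1r mulrC [_ / _]mulrC; ring.
Qed.

Section char.
Variables (mu : probability R R) (u : R).
Let a := \int[mu]_x cos (u * x).
Let b := \int[mu]_x sin (u * x).

Lemma convpow_char n : \int[convpow mu n]_x cos (u * x) = (cpow a b n).1 /\
  \int[convpow mu n]_x sin (u * x) = (cpow a b n).2.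
Proof.
have mc := @measurable_cosM R u; have ms := @measurable_sinM R u.
elim: n => [|n [ihc ihs]] /=.
  by rewrite !Rintegral_giry_ret// mulr0 cos0 sin0.
split.
  rewrite conv_integral//; last by move=> x; exact: normr_cos_le1.
  rewrite -mulNr [a * _]mulrC [- b * _]mulrC mulrN -mulNr.
  rewrite -(Rintegral_lin2 mu _ _ mc ms (fun x => normr_cos_le1 (u * x))
    (fun x => normr_sin_le1 (u * x))).
  apply: eq_Rintegral => x _; rewrite -ihc -ihs.
  rewrite mulNr mulrC -mulNr [- _ * _]mulrC mulrN -mulNr.
  rewrite -(Rintegral_lin2 (convpow mu n) _ _ mc ms (fun x => normr_cos_le1 (u * x))
    (fun x => normr_sin_le1 (u * x))).
  by apply: eq_Rintegral => y _; rewrite mulrDr cosD mulNr.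
rewrite conv_integral//; last by move=> x; exact: normr_sin_le1.
rewrite [a * _]mulrC [b * _]mulrC.
rewrite -(Rintegral_lin2 mu _ _ mc ms (fun x => normr_cos_le1 (u * x))
  (fun x => normr_sin_le1 (u * x))).
apply: eq_Rintegral => x _; rewrite -ihc -ihs addrC mulrC [_ * cos _]mulrC.
rewrite -(Rintegral_lin2 (convpow mu n) _ _ mc ms (fun x => normr_cos_le1 (u * x))
  (fun x => normr_sin_le1 (u * x))).
by apply: eq_Rintegral => y _; rewrite mulrDr sinD.
Qed.

Lemma compound_poisson_char t : 0 <= t ->
  \int[compound_poisson t mu]_x cos (u * x) = expR (t * (a - 1)) * cos (t * b) /\
  \int[compound_poisson t mu]_x sin (u * x) = expR (t * (a - 1)) * sin (t * b).
Proof.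
move=> t0.
have [Ec Es] := exp_series a b t.
have eE : expR (t * (a - 1)) = expR (- t) * expR (a * t).
  by rewrite -expRD; congr expR; ring.
split.
  rewrite (compound_poisson_series t0 _ _ (fun n => (convpow_char n).1)).
  - by rewrite Ec eE mulrA [b * t]mulrC.
  - exact: measurable_cosM.
  - by move=> x; exact: normr_cos_le1.
rewrite (compound_poisson_series t0 _ _ (fun n => (convpow_char n).2)).
- by rewrite Es eE mulrA [b * t]mulrC.
- exact: measurable_sinM.
- by move=> x; exact: normr_sin_le1.
Qed.

End char.

Section laplace.
Variable mu : probability R R.
Hypothesis mu_ge0 : mu (~` `[0, +oo[%classic) = 0%E.

(** The Laplace kernel, made constant on the negative half-line so that for [l >= 0] it is bounded
    by 1 everywhere. It is meant for measures that live on [0, +oo[, where nothing changes. *)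
Definition exp_neg (l x : R) : R := expR (- l * Num.max x 0).

Lemma measurable_exp_neg l : measurable_fun setT (exp_neg l).
Proof.
apply: measurableT_comp => //; apply: measurable_funM => //.
exact: measurable_maxr.
Qed.

Lemma exp_neg_itv01 l x : 0 <= l -> 0 <= exp_neg l x <= 1.
Proof.
move=> l0; rewrite /exp_neg expR_ge0/= -expR0 ler_expR mulNr oppr_le0 mulr_ge0//.
by rewrite le_max lexx orbT.
Qed.

Lemma exp_negD l x y : 0 <= x -> 0 <= y -> exp_neg l (x + y) = exp_neg l x * exp_neg l y.
Proof.
move=> x0 y0; rewrite /exp_neg -expRD -mulrDr; congr expR; congr (_ * _).
by rewrite !max_l// addr_ge0.
Qed.

Lemma ae_ge0 (m : {measure set R -> \bar R}) : m (~` `[0, +oo[%classic) = 0%E ->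
  {ae m, forall x, 0 <= x}.
Proof.
move=> m0; exists (~` `[0, +oo[%classic); split => //; first exact: measurableC.
by move=> x /= x0; rewrite in_itv/= andbT.
Qed.

Lemma convpow_ge0 n : convpow mu n (~` `[0, +oo[%classic) = 0%E.
Proof.
have mC : measurable (~` `[0, +oo[%classic : set R) by exact: measurableC.
elim: n => [|n ih].
  by rewrite /= /giry_ret/= diracE memNset//= in_itv/= lexx.
change (conv mu (convpow mu n) (~` `[0, +oo[%classic) = 0%E).
apply: finite_measureE => //.
rewrite -Rintegral_indic// conv_integral//; last first.
  by move=> x; rewrite indicE normr_nat; case: (_ \in _); rewrite ?ler01.
rewrite -[RHS](_ : \int[mu]_x 0 = 0); last by rewrite Rintegral_cst// mul0r.
apply: ae_eq_Rintegral => //.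
  apply: measurable_Rintegral_shift => // x.
  by rewrite indicE normr_nat; case: (_ \in _); rewrite ?ler01.
apply: filterS (ae_ge0 mu_ge0) => x x0.
rewrite -[RHS](_ : \int[convpow mu n]_x 0 = 0); last by rewrite Rintegral_cst// mul0r.
apply: ae_eq_Rintegral => //.
  by apply: measurableT_comp => //; exact: measurable_funD.
apply: filterS (ae_ge0 ih) => y y0.
by rewrite indicE memNset//=; apply; rewrite in_itv/= andbT addr_ge0.
Qed.

Lemma convpow_laplace l n : 0 <= l ->
  \int[convpow mu n]_x exp_neg l x = (\int[mu]_x exp_neg l x) ^+ n.
Proof.
move=> l0; have ml := measurable_exp_neg l.
have l1 x := itv01_norm (fun x => exp_neg_itv01 x l0) x.
elim: n => [|n ih] /=.
  by rewrite Rintegral_giry_ret// /exp_neg maxxx mulr0 expR0 expr0.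
rewrite conv_integral// exprS -ih -RintegralZr//; last exact: bounded_integrable l1.
apply: ae_eq_Rintegral => //.
- exact: measurable_Rintegral_shift.
- exact: measurable_funM.
apply: filterS (ae_ge0 mu_ge0) => x x0.
rewrite -RintegralZl//; last exact: bounded_integrable l1.
apply: ae_eq_Rintegral => //.
- by apply: measurableT_comp => //; exact: measurable_funD.
- exact: measurable_funM.
by apply: filterS (ae_ge0 (convpow_ge0 n)) => y y0; exact: exp_negD.
Qed.

Lemma compound_poisson_ge0 t : 0 <= t ->
  compound_poisson t mu (~` `[0, +oo[%classic) = 0%E.
Proof.
move=> t0; have mC : measurable (~` `[0, +oo[%classic : set R) by exact: measurableC.
apply: finite_measureE => //.
have := compound_poisson_measure (mu := mu) t0 mC.
rewrite (_ : series _ = cst 0); last first.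
  apply/funext => N; rewrite /series/= big1// => i _.
  by rewrite convpow_ge0/= mulr0.
by move=> /(cvg_lim (@Rhausdorff R)) <-; rewrite lim_cst.
Qed.

Lemma compound_poisson_laplace t l : 0 <= t -> 0 <= l ->
  \int[compound_poisson t mu]_x exp_neg l x =
  expR (t * (\int[mu]_x exp_neg l x - 1)).
Proof.
move=> t0 l0; set L := \int[mu]_x exp_neg l x.
rewrite (compound_poisson_series (c := fun n => L ^+ n) t0); first last.
- by move=> n; exact: convpow_laplace.
- by apply: itv01_norm => x; exact: exp_neg_itv01.
- exact: measurable_exp_neg.
have [+ _] := exp_series L 0 t; rewrite mul0r cos0 mulr1.
have E n : cpow L 0 n = (L ^+ n, 0).
  by elim: n => [|n ih] //=; rewrite ih/= !mul0r mulr0 subr0 addr0 exprS.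
under eq_fun do rewrite E/=.
by move=> ->; rewrite -expRD; congr expR; ring.
Qed.

End laplace.

(** The absence of jumps already has probability exp (- t). This bound makes the compound Poisson
    process continuous in probability. *)
Lemma compound_poisson_set0 (mu : probability R R) t : 0 <= t ->
  expR (- t) <= fine (compound_poisson t mu [set 0]).
Proof.
move=> t0; have := compound_poisson_measure (mu := mu) t0 (measurable_set1 (0 : R)).
move=> H; rewrite -(cvg_lim (@Rhausdorff R) H); apply: limr_ge; first by apply/cvg_ex; eexists; exact: H.
near=> N; rewrite /series/=.
have -> : N = N.-1.+1 by rewrite prednK//; near: N; exists 1%N.
rewrite big_nat_recl// expr0 fact0 divr1.
have -> : fine (convpow mu 0 [set 0]) = 1 by rewrite /= /dirac indicE mem_set.
rewrite !mulr1.
rewrite lerDl sumr_ge0// => i _.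
rewrite !mulr_ge0 ?expR_ge0 ?exprn_ge0//.
by have /andP[] := subprobability_fine_itv (conv mu (convpow mu i)) (measurable_set1 (0 : R)).
Unshelve. all: by end_near.
Qed.

End compound_poisson_transforms.

(** * Laws of Levy processes and mixtures *)

Section characteristic_functions.
Context {R : realType}.

Lemma cvg_cos T (F : set_system T) {FF : Filter F} (f : T -> R) (a : R) :
  f x @[x --> F] --> a -> cos (f x) @[x --> F] --> cos a.
Proof. by apply: (continuous_cvg _ (@continuous_cos R a)). Qed.

Lemma cvg_sin T (F : set_system T) {FF : Filter F} (f : T -> R) (a : R) :
  f x @[x --> F] --> a -> sin (f x) @[x --> F] --> sin a.
Proof. by apply: (continuous_cvg _ (@continuous_sin R a)). Qed.

Lemma cvg_expR T (F : set_system T) {FF : Filter F} (f : T -> R) (a : R) :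
  f x @[x --> F] --> a -> expR (f x) @[x --> F] --> expR a.
Proof. by apply: (continuous_cvg _ (@continuous_expR R a)). Qed.

Lemma derivative_le1_lipschitz (f df : R -> R) :
  (forall x : R, is_derive x 1 f (df x)) -> (forall x, `|df x| <= 1) ->
  forall x y, `|f x - f y| <= `|x - y|.
Proof.
move=> fdf df1.
suff H (x y : R) : x <= y -> `|f y - f x| <= `|y - x|.
  move=> x y; have [xy|/ltW yx] := leP x y; last exact: H.
  by rewrite distrC [leRHS]distrC; exact: H.
move=> xy; have cf : {within `[x, y], continuous f}.
  apply: continuous_subspaceT => z; apply: differentiable_continuous.
  by apply/derivable1_diffP; have [] := fdf z.
have [c _ ->] := MVT_segment xy (fun z _ => fdf z) cf.
by rewrite normrM ler_piMl.
Qed.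

Lemma cos_lipschitz (x y : R) : `|cos x - cos y| <= `|x - y|.
Proof.
apply: (@derivative_le1_lipschitz _ (fun x => - sin x)) => z.
by rewrite normrN normr_sin_le1.
Qed.

Lemma sin_lipschitz (x y : R) : `|sin x - sin y| <= `|x - y|.
Proof. by apply: (@derivative_le1_lipschitz _ cos) => z; exact: normr_cos_le1. Qed.

Lemma continuous_char_cos (m : {finite_measure set R -> \bar R}) :
  continuous (fun u : R => \int[m]_x cos (u * x)).
Proof.
move=> u; apply/(@cvg_nbhsP R R^o) => v vu.
apply: (@Rintegral_bounded_cvg _ _ _ _ _ _ 1).
- by move=> n; exact: measurable_cosM.
- by move=> n x; exact: normr_cos_le1.
- by move=> x; apply: cvg_cos; exact: cvgMl.
Qed.

Lemma continuous_char_sin (m : {finite_measure set R -> \bar R}) :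
  continuous (fun u : R => \int[m]_x sin (u * x)).
Proof.
move=> u; apply/(@cvg_nbhsP R R^o) => v vu.
apply: (@Rintegral_bounded_cvg _ _ _ _ _ _ 1).
- by move=> n; exact: measurable_sinM.
- by move=> n x; exact: normr_sin_le1.
- by move=> x; apply: cvg_sin; exact: cvgMl.
Qed.

Lemma conv_char (m1 m2 : giry R R) (u : R) :
  \int[conv m1 m2]_x cos (u * x) =
    (\int[m1]_x cos (u * x)) * (\int[m2]_x cos (u * x)) -
    (\int[m1]_x sin (u * x)) * (\int[m2]_x sin (u * x)) /\
  \int[conv m1 m2]_x sin (u * x) =
    (\int[m1]_x sin (u * x)) * (\int[m2]_x cos (u * x)) +
    (\int[m1]_x cos (u * x)) * (\int[m2]_x sin (u * x)).
Proof.
have mc := @measurable_cosM R u; have ms := @measurable_sinM R u.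
have c1 x : `|cos (u * x)| <= 1 := normr_cos_le1 _.
have s1 x : `|sin (u * x)| <= 1 := normr_sin_le1 _.
split; rewrite conv_integral//.
  rewrite mulrC [X in _ - X]mulrC -mulNr -(Rintegral_lin2 m1 _ _ mc ms c1 s1).
  apply: eq_Rintegral => x _; rewrite mulNr mulrC [X in _ - X]mulrC -mulNr.
  rewrite -(Rintegral_lin2 m2 _ _ mc ms c1 s1).
  by apply: eq_Rintegral => y _; rewrite mulrDr cosD mulNr.
rewrite mulrC [X in _ + X]mulrC -(Rintegral_lin2 m1 _ _ ms mc s1 c1).
apply: eq_Rintegral => x _; rewrite mulrC [X in _ + X]mulrC.
rewrite -(Rintegral_lin2 m2 _ _ mc ms c1 s1).
by apply: eq_Rintegral => y _; rewrite mulrDr sinD.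
Qed.

End characteristic_functions.

(* A continuous convolution semigroup with values in the unit disc is determined
   by its value at time 1: divided by the expected exponential it is, at dyadic
   times, a continuous function of u which is a square root of 1. *)
Section char_semigroup.
Context {R : realType}.
Variables (C S : {nonneg R} -> R -> R) (al be : R -> R).
Hypotheses
  (CD : forall s t u, C (s%:num + t%:num)%:nng u = C s u * C t u - S s u * S t u)
  (SD : forall s t u, S (s%:num + t%:num)%:nng u = S s u * C t u + C s u * S t u)
  (cC : forall t, continuous (C t)) (cS : forall t, continuous (S t))
  (C_0 : forall t, C t 0 = 1) (S_0 : forall t, S t 0 = 0)
  (tC : forall t u (e : R), 0 < e -> exists2 d : R, 0 < d & forall s : {nonneg R},
    `|s%:num - t%:num| < d -> `|C s u - C t u| < e /\ `|S s u - S t u| < e)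
  (cal : continuous al) (cbe : continuous be) (al0 : al 0 = 0) (be0 : be 0 = 0)
  (C1 : forall u, C 1%:nng u = expR (al u) * cos (be u))
  (S1 : forall u, S 1%:nng u = expR (al u) * sin (be u)).

(** Real and imaginary parts of the quotient of C + i S by exp (t (al + i be)); they inherit the
    semigroup law. *)
Let r1 (t : {nonneg R}) u := expR (- (t%:num * al u)) *
  (C t u * cos (t%:num * be u) + S t u * sin (t%:num * be u)).
Let r2 (t : {nonneg R}) u := expR (- (t%:num * al u)) *
  (S t u * cos (t%:num * be u) - C t u * sin (t%:num * be u)).

Let r1D s t u : r1 (s%:num + t%:num)%:nng u = r1 s u * r1 t u - r2 s u * r2 t u.
Proof.
by rewrite /r1 /r2 CD SD /= !mulrDl opprD expRD cosD sinD; ring.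
Qed.

Let r2D s t u : r2 (s%:num + t%:num)%:nng u = r2 s u * r1 t u + r1 s u * r2 t u.
Proof.
by rewrite /r1 /r2 CD SD /= !mulrDl opprD expRD cosD sinD; ring.
Qed.

Let dy k : {nonneg R} := ((2^-1 : R) ^+ k)%:nng.

Let dyD k : dy k = ((dy k.+1)%:num + (dy k.+1)%:num)%:nng.
Proof.
by apply: val_inj; rewrite /= exprS -mulrDl (_ : 2^-1 + 2^-1 = 1) ?mul1r//; field.
Qed.

Let r1_continuous t : continuous (r1 t).
Proof.
move=> u; rewrite /r1; apply: cvgM.
  apply: cvg_expR.
  by apply: cvgN; apply: cvgMr; exact: cal.
apply: cvgD; apply: cvgM; [exact: cC| |exact: cS|].
  by apply: cvg_cos; apply: cvgMr; exact: cbe.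
by apply: cvg_sin; apply: cvgMr; exact: cbe.
Qed.

Let r1_0 t : r1 t 0 = 1.
Proof. by rewrite /r1 al0 be0 C_0 S_0 !mulr0 oppr0 expR0 cos0 mul0r addr0 !mulr1. Qed.

Let r_dy k u : r1 (dy k) u = 1 /\ r2 (dy k) u = 0.
Proof.
elim: k u => [|k ih] u.
  have -> : dy 0 = 1%:nng by apply: val_inj.
  rewrite /r1 /r2/= C1 S1 !mul1r; split; last first.
    by rewrite -!mulrA [cos _ * sin _]mulrC subrr mulr0.
  rewrite -!mulrA -mulrDr mulrA -expRD addNr expR0 mul1r -!expr2.
  exact: cos2Dsin2.
(* The square of r1 + i r2 at half the time is 1. Its imaginary part 2 r1 r2 vanishes, and r1 = 0
   would make the square nonpositive, so r2 = 0 and r1 is 1 or -1. *)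
have sq v : r2 (dy k.+1) v = 0 /\ (r1 (dy k.+1) v = 1 \/ r1 (dy k.+1) v = -1).
  have [] := ih v; rewrite dyD r1D r2D; move: (r1 _ _) (r2 _ _) => x y xy1.
  rewrite [y * x]mulrC => /eqP; rewrite -mulr2n mulrn_eq0/= mulf_eq0.
  case/orP => /eqP z; last first.
    split => //; have : x ^+ 2 = 1 by rewrite expr2 -xy1 z mulr0 subr0.
    by move/eqP; rewrite sqrf_eq1 => /orP[/eqP ->|/eqP ->]; [left|right].
  have : 0 <= y * y by rewrite -expr2 sqr_ge0.
  by move=> yy; exfalso; move: xy1 yy; rewrite z mul0r; lra.
have [r20 [//|rN1]] := sq u.
(* [r1] is continuous in [u], never 0, and equal to 1 at [u = 0]; the intermediate value theorem
   excludes -1. *)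
have iv (a b : R) : a <= b -> r1 (dy k.+1) a * r1 (dy k.+1) b = -1 -> False.
  move=> ab pN1.
  have [||c _ c0] := @IVT R (r1 (dy k.+1)) a b 0 ab.
  - exact/continuous_subspaceT/r1_continuous.
  - have [_] := sq a; have [_] := sq b; move: pN1.
    move: (r1 _ a) (r1 _ b) => p q pq [] hq [] hp; move: pq;
      rewrite ge_min le_max hp hq ?mulr1 ?mulrNN ?lerN10 ?ler01 ?orbT//; lra.
  by have [_] := sq c; rewrite c0; lra.
have [u0|/ltW u0] := leP 0 u.
  by case: (iv 0 u u0); rewrite r1_0 rN1 mul1r.
by case: (iv u 0 u0); rewrite r1_0 rN1 mulr1.
Qed.

Let dyM k (j : nat) : {nonneg R} := (j%:R * (dy k)%:num)%:nng.

Let r_dyM k j u : r1 (dyM k j) u = 1 /\ r2 (dyM k j) u = 0.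
Proof.
have [a1 a2] := r_dy k u.
elim: j => [|j [ih1 ih2]].
  (* The value at time 0 is forced by the semigroup law: adding time 0 to [dy k], where the quotient
     is 1, changes nothing. *)
  have e : dy k = ((dyM k 0)%:num + (dy k)%:num)%:nng.
    by apply: val_inj; rewrite /= mul0r add0r.
  have h1 := r1D (dyM k 0) (dy k) u; have h2 := r2D (dyM k 0) (dy k) u.
  move: h1 h2; rewrite -e a1 a2 !mulr1 !mulr0 addr0 subr0.
  by move=> <- <-.
have -> : dyM k j.+1 = ((dyM k j)%:num + (dy k)%:num)%:nng :> {nonneg R}.
  by apply: val_inj; rewrite /= -addn1 natrD mulrDl mul1r.
rewrite r1D r2D ih1 ih2 a1 a2.
by rewrite !mul0r !mulr1 mulr0 subr0 addr0.
Qed.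

Let E1 (t u : R) := expR (t * al u) * cos (t * be u).
Let E2 (t u : R) := expR (t * al u) * sin (t * be u).

Let CS_dyM k j u : C (dyM k j) u = E1 (dyM k j)%:num u /\
  S (dyM k j) u = E2 (dyM k j)%:num u.
Proof.
have [] := r_dyM k j u; move: (dyM k j) => t; rewrite /r1 /r2 /E1 /E2.
set a := t%:num * al u; set b := t%:num * be u => x1 x2.
have e1 : expR a * expR (- a) = 1 by rewrite -expRD subrr expR0.
have cs := cos2Dsin2 b.
split.
  rewrite -[LHS]mul1r -e1 -[LHS]mulr1 -cs.
  transitivity (expR a * (cos b * (expR (- a) * (C t u * cos b + S t u * sin b)) -
    sin b * (expR (- a) * (S t u * cos b - C t u * sin b)))); first by ring.
  by rewrite x1 x2 mulr0 subr0 mulr1.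
rewrite -[LHS]mul1r -e1 -[LHS]mulr1 -cs.
transitivity (expR a * (sin b * (expR (- a) * (C t u * cos b + S t u * sin b)) +
  cos b * (expR (- a) * (S t u * cos b - C t u * sin b)))); first by ring.
by rewrite x1 x2 mulr0 addr0 mulr1.
Qed.

Let E_cvg t u (e : R) : 0 < e -> exists2 d : R, 0 < d & forall s : R,
  `|s - t| < d -> `|E1 s u - E1 t u| < e /\ `|E2 s u - E2 t u| < e.
Proof.
move=> e0.
have c1 : {for t, continuous (E1 ^~ u)}.
  apply: cvgM.
    apply: cvg_expR.
    by apply: cvgMl; exact: cvg_id.
  by apply: cvg_cos; apply: cvgMl; exact: cvg_id.
have c2 : {for t, continuous (E2 ^~ u)}.
  apply: cvgM.
    apply: cvg_expR.
    by apply: cvgMl; exact: cvg_id.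
  by apply: cvg_sin; apply: cvgMl; exact: cvg_id.
move/cvgrPdist_lt : c1 => /(_ e e0)/nbhs_ballP[d1 /= d10 h1].
move/cvgrPdist_lt : c2 => /(_ e e0)/nbhs_ballP[d2 /= d20 h2].
exists (Num.min d1 d2); first by rewrite lt_min d10.
move=> s; rewrite lt_min distrC => /andP[s1 s2].
by rewrite distrC [X in _ /\ X < _]distrC; split; [exact: h1|exact: h2].
Qed.

Lemma char_semigroup t u : C t u = expR (t%:num * al u) * cos (t%:num * be u) /\
  S t u = expR (t%:num * al u) * sin (t%:num * be u).
Proof.
rewrite -/(E1 t%:num u) -/(E2 t%:num u).
suff H e : 0 < e -> `|C t u - E1 t%:num u| <= e /\ `|S t u - E2 t%:num u| <= e.
  split; apply/eqP; rewrite -subr_eq0 -normr_le0; apply/ler_addgt0Pl => e e0;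
    by rewrite addr0; have [] := H e e0.
move=> e0; have e20 : 0 < e / 2 by rewrite divr_gt0.
have [d1 d10 h1] := tC t u e20; have [d2 d20 h2] := E_cvg t%:num u e20.
have d0 : 0 < Num.min d1 d2 by rewrite lt_min d10.
have [k kd] : exists k, (2^-1 : R) ^+ k < Num.min d1 d2.
  have : (fun k => (2^-1 : R) ^+ k) @ \oo --> 0.
    by apply: cvg_expr; rewrite ger0_norm ?invr_ge0// invf_lt1// ltr1n.
  move/cvgrPdist_lt => /(_ _ d0)[k _ /(_ k (leqnn k))].
  by rewrite /= sub0r normrN ger0_norm ?exprn_ge0 ?invr_ge0//; exists k.
(* [dyM k j] is the last multiple of 2^-k up to [t]; both sides are continuous in time, so agreement
   at such times is enough. *)
pose j := Num.trunc (t%:num / (2^-1 : R) ^+ k).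
have p0 : 0 < (2^-1 : R) ^+ k by rewrite exprn_gt0// invr_gt0.
have st : `|(dyM k j)%:num - t%:num| < Num.min d1 d2.
  apply: le_lt_trans kd; rewrite distrC /=.
  have tk : 0 <= t%:num / (2^-1 : R) ^+ k by rewrite divr_ge0// ltW.
  rewrite ger0_norm ?subr_ge0 -?ler_pdivlMr//; last first.
    by rewrite /j; have /andP[] := truncn_itv tk.
  rewrite lerBlDr -[X in X + _]mul1r -mulrDl -ler_pdivrMr// ltW// addrC.
  by rewrite natr1 /j truncnS_gt.
move: (st); rewrite lt_min => /andP[s1 s2].
have [a1 a2] := h1 _ s1; have [b1 b2] := h2 _ s2; have [c1 c2] := CS_dyM k j u.
split.
  rewrite (_ : _ - _ = (E1 (dyM k j)%:num u - E1 t%:num u) -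
    (C (dyM k j) u - C t u)); last by rewrite c1; ring.
  by rewrite (le_trans (ler_normB _ _))// [leRHS](splitr e) lerD ?ltW.
rewrite (_ : _ - _ = (E2 (dyM k j)%:num u - E2 t%:num u) -
  (S (dyM k j) u - S t u)); last by rewrite c2; ring.
by rewrite (le_trans (ler_normB _ _))// [leRHS](splitr e) lerD ?ltW.
Qed.

End char_semigroup.

(** * Increments and marginals of Levy laws, and the family LISPP *)

Section levy_laws.
Context {R : realType}.

Lemma Rintegral_prob_cst d (T : measurableType d) (P : probability T R) (c : R) :
  \int[P]_x c = c.
Proof. by rewrite Rintegral_cst// [X in fine X](@probability_setT _ _ _ P) mulr1. Qed.

Lemma ae_measure_eq d (T : measurableType d) (m : {finite_measure set T -> \bar R})
    (A B : set T) : measurable A -> measurable B ->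
  {ae m, forall x, A x <-> B x} -> m A = m B.
Proof.
move=> mA mB AB; rewrite -[LHS]fineK ?fin_num_measure// -[RHS]fineK ?fin_num_measure//; congr EFin.
rewrite -Rintegral_indic// -[RHS]Rintegral_indic//.
apply: ae_eq_Rintegral => //.
apply: filterS AB => x ABx; rewrite !indicE; congr (_ %:R); congr nat_of_bool.
by apply/idP/idP; rewrite !inE; apply ABx.
Qed.

Fixpoint tsum (s : nat -> {nonneg R}) n : {nonneg R} :=
  if n is k.+1 then ((tsum s k)%:num + (s k)%:num)%:nng else 0%:nng.

(** Under a Levy law such an event factorises into marginals at the times [s i]. [B0] records the
    initial position, without which the increments would not determine the path on the grid. *)
Definition increments_rect (s : nat -> {nonneg R}) (n : nat) (B0 : set R)
    (B : nat -> set R) : set (path_space R) :=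
  [set w | B0 (w 0%:nng) /\
    forall i, (i < n)%N -> B i (w (tsum s i.+1) - w (tsum s i))].

Lemma measurable_increment (s t : {nonneg R}) :
  measurable_fun setT (fun w : path_space R => w t - w s).
Proof. by apply: measurable_funB; exact: measurable_coord. Qed.

Lemma measurable_increments_rect s n B0 B : measurable B0 ->
  (forall i, measurable (B i)) -> measurable (increments_rect s n B0 B).
Proof.
move=> mB0 mB.
rewrite (_ : increments_rect s n B0 B = Defs.coord 0%:nng @^-1` B0 `&`
    \bigcap_i [set w | (i < n)%N -> B i (w (tsum s i.+1) - w (tsum s i))]).
  apply: measurableI.
    by rewrite -[X in measurable X]setTI; exact: measurable_coord.
  apply: bigcapT_measurable => i; case: (ltnP i n) => ni.
    rewrite (_ : [set w | _] = (fun w : path_space R =>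
        w (tsum s i.+1) - w (tsum s i)) @^-1` B i).
      by rewrite -[X in measurable X]setTI; exact: measurable_increment.
    by apply/seteqP; split => w /=; [apply|].
  by rewrite (_ : [set w | _] = setT)//; apply/seteqP; split => w //.
by apply/seteqP; split => w [h1 h2]; split => // i; [move=> _; exact: h2|exact: h2].
Qed.

Section process.
Context {d} {Omega : measurableType d} (P : probability Omega R).
Variable X : {nonneg R} -> {RV P >-> R}.

Lemma sample_path_measurable_rect s n B0 B : measurable B0 ->
  (forall i, measurable (B i)) ->
  measurable (sample_path X @^-1` increments_rect s n B0 B).
Proof.
move=> mB0 mB; rewrite -[X in measurable X]setTI.
by apply: measurable_sample_path => //; exact: measurable_increments_rect.
Qed.

Hypothesis LX : levy_process X.

Let X0 : {ae P, forall w, X 0%:nng w = 0}. Proof. by case: LX. Qed.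

Let preimX (t : {nonneg R}) (B : set R) : measurable B -> measurable (X t @^-1` B).
Proof. by move=> mB; rewrite -[X in measurable X]setTI; exact: measurable_funP. Qed.

Let preimI (s t : {nonneg R}) (B : set R) : measurable B ->
  measurable (increment X s t @^-1` B).
Proof.
move=> mB; rewrite -[X in measurable X]setTI.
by apply: (measurable_funB (measurable_funP (X t)) (measurable_funP (X s))).
Qed.

Lemma levy_process_increment (s : nat -> {nonneg R}) i B : measurable B ->
  P (increment X (tsum s i) (tsum s i.+1) @^-1` B) = P (X (s i) @^-1` B).
Proof.
move=> mB; have [_ stat _ _] := LX.
rewrite (stat (tsum s i) 0%:nng (s i) B mB).
have -> : (0%:nng%:num + (s i)%:num)%:nng = s i by apply: val_inj; rewrite /= add0r.
apply: ae_measure_eq; [exact: preimI|exact: preimX|].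
by apply: filterS X0 => w w0; rewrite /= /increment w0 subr0.
Qed.

Lemma levy_process_rect s n B0 B : measurable B0 -> (forall i, measurable (B i)) ->
  P (sample_path X @^-1` increments_rect s n B0 B) =
  (\d_(0%R : R) B0 * \prod_(i < n) P (X (s i) @^-1` B i))%E.
Proof.
move=> mB0 mB; have [_ _ ind _] := LX.
have mon i : (tsum s i)%:num <= (tsum s i.+1)%:num by rewrite /= lerDl.
have := ind n (tsum s) mon (fun i => B i) (fun i => mB i).
under eq_bigr do rewrite levy_process_increment//.
move=> <-; rewrite diracE; case: (boolP (0 \in B0)) => [/set_mem B00|B0N].
  rewrite mul1e; apply: ae_measure_eq; first exact: sample_path_measurable_rect.
    by apply: fin_bigcap_measurable => // i _; exact: preimI.
  apply: filterS X0 => w w0; split => [[_ h] i _|h]; first exact: h.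
  split; first by rewrite /sample_path w0.
  by move=> i ni; exact: (h (Ordinal ni) I).
rewrite mul0e; rewrite -[RHS](measure0 P); apply: ae_measure_eq => //.
  exact: sample_path_measurable_rect.
apply: filterS X0 => w w0; split => // -[].
by rewrite /sample_path w0 => /mem_set; rewrite (negbTE B0N).
Qed.

End process.

Lemma marginalE (t : {nonneg R}) (g : levy_law R) (B : set R) :
  marginal t g B = levy_law_val g (Defs.coord t @^-1` B).
Proof. by []. Qed.

(** Computed on any process that realises [g]. Through this formula the marginals determine a Levy
    law, and products of marginals enter the law of a mixture. *)
Lemma levy_law_rect (g : levy_law R) s n B0 B : measurable B0 ->
  (forall i, measurable (B i)) ->
  levy_law_val g (increments_rect s n B0 B) =
  (\d_(0%R : R) B0 * \prod_(i < n) marginal (s i) g (B i))%E.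
Proof.
move=> mB0 mB; have [d [Omega [P [X [LX lawX]]]]] := levy_lawP g.
rewrite -lawX; last exact: measurable_increments_rect.
rewrite [LHS](levy_process_rect LX)//; congr (_ * _)%E; apply: eq_bigr => i _.
rewrite marginalE -lawX//.
by rewrite -[X in measurable X]setTI; exact: measurable_coord.
Qed.

Lemma levy_law_marginal (g : levy_law R) s B : measurable B ->
  levy_law_val g [set w : path_space R | B (w (tsum s 1) - w (tsum s 0))] =
  marginal (s 0%N) g B.
Proof.
move=> mB; have := levy_law_rect g s 1 measurableT (fun=> mB).
rewrite big_ord1 diracT mul1e => <-; congr (levy_law_val g _).
apply/seteqP; split => w /=; first by move=> Bw; split => // -[].
by case=> _ h; exact: (h 0%N isT).
Qed.

Lemma levy_law_conv (g : levy_law R) (s t : {nonneg R}) B : measurable B ->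
  marginal (s%:num + t%:num)%:nng g B = conv (marginal s g) (marginal t g) B.
Proof.
move=> mB.
pose st (i : nat) := if i is 0%N then s else t.
pose f (w : path_space R) : R * R :=
  (w (tsum st 1) - w (tsum st 0), w (tsum st 2) - w (tsum st 1)).
have mf : measurable_fun setT f.
  by apply/measurable_fun_pairP; split; exact: measurable_increment.
pose ff : {mfun path_space R >-> (R * R)%type} :=
  HB.pack f (isMeasurableFun.Build _ _ _ _ f mf).
have madd : measurable_fun setT (fun p : R * R => p.1 + p.2).
  by apply: measurable_funD; [exact: measurable_fst|exact: measurable_snd].
have mBa : measurable ((fun p : R * R => p.1 + p.2) @^-1` B).
  by rewrite -[X in measurable X]setTI; exact: madd.
rewrite [RHS](product_measure_unique (m' := pushforward (levy_law_val g) ff) _ mBa).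
  rewrite -(levy_law_marginal g (fun=> (s%:num + t%:num)%:nng) mB).
  rewrite /pushforward; congr (levy_law_val g _); apply/seteqP.
  have -> : tsum (fun=> (s%:num + t%:num)%:nng) 1 = tsum st 2.
    by apply: val_inj; rewrite /= !add0r.
  have e w : (ff w).1 + (ff w).2 = w (tsum st 2) - w (tsum st 0).
    change ((w (tsum st 1) - w (tsum st 0)) + (w (tsum st 2) - w (tsum st 1)) =
      w (tsum st 2) - w (tsum st 0)); ring.
  split => w Bw; first by change (B ((ff w).1 + (ff w).2)); rewrite e.
  by change (B ((ff w).1 + (ff w).2)) in Bw; rewrite e in Bw.
move=> A1 A2 mA1 mA2.
have := levy_law_rect g st 2 measurableT (B := fun i => if i is 0%N then A1 else A2).
rewrite diracT mul1e big_ord_recl big_ord1/= => <- //; last by case.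
rewrite /pushforward; congr (levy_law_val g _); apply/seteqP; split => w /=.
  by case=> h1 h2; split => // -[|[|]].
by case=> _ h; split; [exact: (h 0%N isT)|exact: (h 1%N isT)].
Qed.

Section law_integral.
Context {d} {Omega : measurableType d} (P : probability Omega R).
Variables (X : {nonneg R} -> {RV P >-> R}) (g : levy_law R).
Hypothesis lawX : law X ≡μ levy_law_val g.

Lemma law_marginal t B : measurable B -> marginal t g B = P (X t @^-1` B).
Proof.
move=> mB; rewrite marginalE -lawX//.
by rewrite -[X in measurable X]setTI; exact: measurable_coord.
Qed.

Lemma law_marginal_integral t (f : R -> R) : measurable_fun setT f ->
  (forall x, `|f x| <= 1) -> \int[marginal t g]_x f x = \int[P]_w f (X t w).
Proof.
move=> mf f1; congr fine.
rewrite (eq_measure_integral (distribution P (X t))); last first.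
  by move=> B mB _; exact: law_marginal.
rewrite integral_distribution//; first exact/measurable_EFinP.
by apply: (bounded_integrable P (C := 1)) => //; exact: measurableT_comp.
Qed.

End law_integral.

Lemma marginal_lipschitz_cvg (g : levy_law R) (f : R -> R) (u : R) :
  measurable_fun setT f -> (forall x, `|f x| <= 1) ->
  (forall x y, `|f x - f y| <= `|u| * `|x - y|) ->
  forall (t : {nonneg R}) (e : R), 0 < e -> exists2 dl : R, 0 < dl &
    forall s : {nonneg R}, `|s%:num - t%:num| < dl ->
      `|\int[marginal s g]_x f x - \int[marginal t g]_x f x| < e.
Proof.
move=> mf f1 fu t e e0; have [d [Omega [P [X [LX lawX]]]]] := levy_lawP g.
have [_ _ _ cX] := LX.
(* Where the increment is at most [ep] the difference is at most e / 2 by the Lipschitz bound;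
   elsewhere it is at most 2, on an event of probability below e / 8. *)
pose ep := e / (2 * (`|u| + 1)).
have u1 : 0 < `|u| + 1 by rewrite ltr_wpDl.
have ep0 : 0 < ep by rewrite divr_gt0// mulr_gt0.
have e80 : 0 < e / 8 by rewrite divr_gt0.
have [dl dl0 hdl] := cX t ep (e / 8) ep0 e80.
exists dl => // s /hdl; set A := [set w | _] => PA.
rewrite !(law_marginal_integral lawX)//.
have mX t' : measurable_fun setT (fun w => f (X t' w)) by exact: measurableT_comp.
have mA : measurable A.
  rewrite (_ : A = (fun w => `|X s w - X t w|) @^-1` `]ep, +oo[); last first.
    by apply/seteqP; split => w /=; rewrite in_itv/= andbT.
  rewrite -[X in measurable X]setTI.
  have : measurable_fun setT (fun w => `|X s w - X t w|); last exact.
  by apply: measurableT_comp => //; exact: measurable_funB.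
have i1 t' : P.-integrable setT (EFin \o (fun w => f (X t' w))).
  by apply: (bounded_integrable P (C := 1)).
rewrite -RintegralB//.
have bd w : `|f (X s w) - f (X t w)| <= `|u| * ep * 1 + 2 * \1_A w.
  have [Aw|nAw] := pselect (A w).
    rewrite indicE mem_set// mulr1 (le_trans (ler_normB _ _))//.
    apply: (le_trans (lerD (f1 _) (f1 _))).
    rewrite (_ : (true%:R : R) = 1)// mulr1.
    by have : 0 <= `|u| * ep by [rewrite mulr_ge0// ltW]; lra.
  rewrite indicE memNset// mulr0 addr0 mulr1 (le_trans (fu _ _))// ler_wpM2l//.
  by move/negP: nAw; rewrite /A/= -leNgt.
have mdiff : measurable_fun setT (fun w => f (X s w) - f (X t w)).
  exact: measurable_funB.
have c1 w : `|(cst 1 : Omega -> R) w| <= 1 by rewrite normr1.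
have a1 w : `|(\1_A w : R)| <= 1.
  by rewrite indicE normr_nat; case: (_ \in _); rewrite ?ler01.
apply: (@le_lt_trans _ _ (\int[P]_w (`|u| * ep * 1 + 2 * \1_A w))).
  apply: (le_trans (le_normr_Rintegral _ _)) => //.
    apply: (bounded_integrable P (C := 2)) => // w.
    by rewrite (le_trans (ler_normB _ _))// (le_trans (lerD (f1 _) (f1 _))).
  apply: le_Rintegral => //.
    apply: (bounded_integrable P (C := 2)); first exact: measurableT_comp.
    move=> w; rewrite normr_id.
    by rewrite (le_trans (ler_normB _ _))// (le_trans (lerD (f1 _) (f1 _))).
  apply: (bounded_integrable P (C := `|u| * ep + 2)).
    by apply: measurable_funD => //; exact: measurable_funM.
  move=> w; apply: (le_trans (ler_normD _ _)); rewrite lerD//.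
    by rewrite mulr1 ger0_norm// mulr_ge0// ltW.
  by rewrite normrM ger0_norm// -[leRHS]mulr1 ler_wpM2l.
rewrite (Rintegral_lin2 P (`|u| * ep) 2 (measurable_cst (1 : R))
  (measurable_indic mA) c1 a1) Rintegral_indic//.
rewrite [X in _ * X + _](Rintegral_prob_cst P 1) mulr1.
have PA8 : fine (P A) < e / 8 by rewrite -lte_fin fineK// fin_num_measure.
have ue : `|u| * ep <= e / 2.
  rewrite /ep invfM mulrCA ler_pM2l// mulrCA ler_piMr// ler_pdivrMr// mul1r.
  by rewrite lerDl.
lra.
Qed.

(** Independent increments turn the characteristic functions of the marginals into a semigroup,
    continuity in probability makes it continuous in time, and [char_semigroup] identifies it from
    its value at time 1. *)
Lemma marginal_char_semigroup (g : levy_law R) (mu : probability R R) :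
  (forall u, \int[marginal 1%:nng g]_x cos (u * x) =
     expR (\int[mu]_x cos (u * x) - 1) * cos (\int[mu]_x sin (u * x))) ->
  (forall u, \int[marginal 1%:nng g]_x sin (u * x) =
     expR (\int[mu]_x cos (u * x) - 1) * sin (\int[mu]_x sin (u * x))) ->
  forall t B, measurable B -> marginal t g B = compound_poisson t%:num mu B.
Proof.
move=> E1 E2 t.
have cos0x (m : probability R R) : \int[m]_x cos (0 * x) = 1.
  under eq_Rintegral do rewrite mul0r cos0.
  by rewrite Rintegral_prob_cst.
have sin0x (m : probability R R) : \int[m]_x sin (0 * x) = 0.
  under eq_Rintegral do rewrite mul0r sin0.
  by rewrite Rintegral_cst// mul0r.
have convg s t' (f : R -> R) : \int[marginal (s%:num + t'%:num)%:nng g]_x f x =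
    \int[conv (marginal s g) (marginal t' g)]_x f x.
  congr fine; apply: eq_measure_integral => B mB _; exact: levy_law_conv.
have lipc (u x y : R) : `|cos (u * x) - cos (u * y)| <= `|u| * `|x - y|.
  by rewrite (le_trans (cos_lipschitz _ _))// -mulrBr normrM.
have lips (u x y : R) : `|sin (u * x) - sin (u * y)| <= `|u| * `|x - y|.
  by rewrite (le_trans (sin_lipschitz _ _))// -mulrBr normrM.
have cs u : \int[marginal t g]_x cos (u * x) =
      expR (t%:num * (\int[mu]_x cos (u * x) - 1)) *
      cos (t%:num * \int[mu]_x sin (u * x)) /\
    \int[marginal t g]_x sin (u * x) =
      expR (t%:num * (\int[mu]_x cos (u * x) - 1)) *
      sin (t%:num * \int[mu]_x sin (u * x)).
  apply: (@char_semigroup R (fun s v => \int[marginal s g]_x cos (v * x))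
    (fun s v => \int[marginal s g]_x sin (v * x))
    (fun v => \int[mu]_x cos (v * x) - 1) (fun v => \int[mu]_x sin (v * x))).
  - by move=> s t' v; rewrite convg; have [] := conv_char (marginal s g) (marginal t' g) v.
  - by move=> s t' v; rewrite convg; have [] := conv_char (marginal s g) (marginal t' g) v.
  - by move=> s; exact: continuous_char_cos.
  - by move=> s; exact: continuous_char_sin.
  - by move=> s; exact: cos0x.
  - by move=> s; exact: sin0x.
  - move=> s v e e0.
    have [d1 d10 h1] := marginal_lipschitz_cvg g (measurable_cosM v)
      (fun x => normr_cos_le1 (v * x)) (lipc v) s e0.
    have [d2 d20 h2] := marginal_lipschitz_cvg g (measurable_sinM v)
      (fun x => normr_sin_le1 (v * x)) (lips v) s e0.
    exists (Num.min d1 d2); first by rewrite lt_min d10.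
    by move=> s'; rewrite lt_min => /andP[? ?]; split; [exact: h1|exact: h2].
  - move=> v; apply: cvgB; last exact: cvg_cst.
    exact: continuous_char_cos.
  - exact: continuous_char_sin.
  - by rewrite cos0x subrr.
  - exact: sin0x.
  - exact: E1.
  - exact: E2.
apply: eq_from_fourier => u; have [c s] := cs u;
  have [c' s'] := compound_poisson_char mu u (ge0 t).
  by rewrite c c'.
by rewrite s s'.
Qed.

(** The process in the definition of [LISPP] enters only through its law, so it can be traded for
    the marginal of [g] at time 1; the complex identity is split into real and imaginary parts. *)
Lemma LISPP_charP (B : set (pprobability R R)) (g : levy_law R) :
  LISPP B g <-> exists2 mu, B mu & forall u : R,
    \int[marginal 1%:nng g]_x cos (u * x) =
      expR (\int[mu]_x cos (u * x) - 1) * cos (\int[mu]_x sin (u * x)) /\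
    \int[marginal 1%:nng g]_x sin (u * x) =
      expR (\int[mu]_x cos (u * x) - 1) * sin (\int[mu]_x sin (u * x)).
Proof.
have key d (Omega : measurableType d) (P : probability Omega R)
    (X : {nonneg R} -> {RV P >-> R}) (mu : pprobability R R) (u : R) :
  law X ≡μ levy_law_val g ->
  (cintegral P (fun w => cexp (0 +i* (u * X 1%:nng w))%C) =
   cexp (cintegral mu (fun x => cexp (0 +i* (u * x))%C - 1))) <->
  (\int[marginal 1%:nng g]_x cos (u * x) =
      expR (\int[mu]_x cos (u * x) - 1) * cos (\int[mu]_x sin (u * x)) /\
    \int[marginal 1%:nng g]_x sin (u * x) =
      expR (\int[mu]_x cos (u * x) - 1) * sin (\int[mu]_x sin (u * x))).
  move=> lawX.
  rewrite (law_marginal_integral lawX _ (measurable_cosM u)); last first.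
    by move=> x; exact: normr_cos_le1.
  rewrite (law_marginal_integral lawX _ (measurable_sinM u)); last first.
    by move=> x; exact: normr_sin_le1.
  have c1 x : `|cos (u * x)| <= 1 := normr_cos_le1 _.
  have one1 (x : R) : `|(cst 1 : R -> R) x| <= 1 by rewrite normr1.
  rewrite /cintegral /cexp/=.
  have -> : \int[P]_x (expR 0 * cos (u * X 1%:nng x)) = \int[P]_x cos (u * X 1%:nng x).
    by apply: eq_Rintegral => x _; rewrite expR0 mul1r.
  have -> : \int[P]_x (expR 0 * sin (u * X 1%:nng x)) = \int[P]_x sin (u * X 1%:nng x).
    by apply: eq_Rintegral => x _; rewrite expR0 mul1r.
  have -> : \int[mu]_x (expR 0 * cos (u * x) - 1) = \int[mu]_x cos (u * x) - 1.
    transitivity (\int[mu]_x (1 * cos (u * x) + (-1) * (cst 1 x))).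
      by apply: eq_Rintegral => x _; rewrite expR0 mulr1.
    rewrite (Rintegral_lin2 mu 1 (-1) (measurable_cosM u) (measurable_cst (1 : R)) c1 one1).
    by rewrite [X in _ + _ * X](Rintegral_prob_cst mu 1) mulr1 mul1r.
  have -> : \int[mu]_x (expR 0 * sin (u * x) - 0) = \int[mu]_x sin (u * x).
    by apply: eq_Rintegral => x _; rewrite expR0 mul1r subr0.
  split=> [[-> ->]//|[-> ->]//].
split.
  move=> [d [Omega [P [X [LX lawX [mu Bmu E]]]]]]; exists mu => // u.
  by apply/(key _ _ _ _ _ _ lawX); exact: E.
move=> [mu Bmu E]; have [d [Omega [P [X [LX lawX]]]]] := levy_lawP g.
exists d, Omega, P, X; split => //; exists mu => // u.
by apply/(key _ _ _ _ _ _ lawX); exact: E.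
Qed.

Lemma LISPP_compound_poissonP (B : set (pprobability R R)) (g : levy_law R) :
  LISPP B g <-> exists2 mu, B mu & forall A, measurable A ->
    marginal 1%:nng g A = compound_poisson 1 mu A.
Proof.
split=> [/LISPP_charP[mu Bmu E]|[mu Bmu E]].
  exists mu => // A mA.
  by apply: marginal_char_semigroup => // u; have [] := E u.
apply/LISPP_charP; exists mu => // u.
have [c s] := compound_poisson_char mu u (@ler01 R).
rewrite !mul1r in c s; rewrite -c -s; split; congr fine;
  apply: eq_measure_integral => A mA _; exact: E.
Qed.

Lemma LISPP_marginal (B : set (pprobability R R)) (g : levy_law R) :
  LISPP B g -> exists2 mu, B mu & forall t A, measurable A ->
    marginal t g A = compound_poisson t%:num mu A.
Proof.
move=> /LISPP_charP[mu Bmu E]; exists mu => // t A mA.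
by apply: marginal_char_semigroup => // u; have [] := E u.
Qed.

End levy_laws.

(** * Dynkin classes on the path space *)

Section path_dynkin.
Context {R : realType}.
Local Notation path := (path_space R).

Definition finite_cylinder : set (set path) :=
  [set D | exists n (t : nat -> {nonneg R}) (B : nat -> set R),
    (forall i, measurable (B i)) /\
    D = [set w : path | forall i, (i < n)%N -> B i (w (t i))]].

Lemma measurable_finite_cylinder D : finite_cylinder D -> measurable D.
Proof.
move=> [n [t [B [mB ->]]]].
rewrite (_ : [set w | _] = \bigcap_i [set w : path | (i < n)%N -> B i (w (t i))]).
  apply: bigcapT_measurable => i; case: (ltnP i n) => ni.
    rewrite (_ : [set w | _] = Defs.coord (t i) @^-1` B i).
      by rewrite -[X in measurable X]setTI; exact: measurable_coord.
    by apply/seteqP; split => w /=; [apply|].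
  by rewrite (_ : [set w | _] = setT)//; apply/seteqP; split => w //.
by apply/seteqP; split => w h i; [move=> _; exact: h|exact: h].
Qed.

Lemma finite_cylinder_setI : setI_closed finite_cylinder.
Proof.
move=> _ _ [n1 [t1 [B1 [mB1 ->]]]] [n2 [t2 [B2 [mB2 ->]]]].
exists (n1 + n2)%N, (fun i => if (i < n1)%N then t1 i else t2 (i - n1)%N),
  (fun i => if (i < n1)%N then B1 i else B2 (i - n1)%N); split.
  by move=> i; case: ifP.
apply/seteqP; split => w /=.
  move=> [h1 h2] i ni; case: ifPn => [/h1//|]; rewrite -leqNgt => n1i.
  by apply: h2; rewrite ltn_subLR.
move=> h; split => i ni.
  by have := h i; rewrite ni; apply; rewrite ltn_addr.
by have := h (n1 + i)%N; rewrite ltn_add2l ni ltnNge leq_addr/= addKn; exact.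
Qed.

Lemma measurable_path_finite_cylinder :
  (measurable : set (set path)) = <<s finite_cylinder >>.
Proof.
apply/seteqP; split.
  apply: smallest_sub; first exact: smallest_sigma_algebra.
  move=> _ [t _ [B mB <-]]; apply: sub_gen_smallest.
  exists 1%N, (fun=> t), (fun=> B); split => //.
  rewrite setTI; apply/seteqP; split => w /=; first by move=> Bw i _.
  by move=> /(_ 0%N isT).
by apply: smallest_sub; [exact: sigma_algebra_measurable|exact: measurable_finite_cylinder].
Qed.

Lemma tsum_cover (l : seq {nonneg R}) : exists (s : nat -> {nonneg R}) N,
  forall t : {nonneg R}, t \in l -> exists2 k, (k <= N)%N & tsum s k = t.
Proof.
pose le_nng (x y : {nonneg R}) := x%:num <= y%:num.
pose sl := sort le_nng l.
have tot : total le_nng by move=> x y; exact: le_total.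
have tr : transitive le_nng by move=> x y z; exact: le_trans.
have ss : sorted le_nng sl by exact: sort_sorted.
pose z0 : {nonneg R} := NngNum (lexx (0 : R)).
pose a i : {nonneg R} := nth z0 (z0 :: sl) i.
(* Past the end of the sorted list [nth] falls back to 0 and a difference may be negative, hence the
   absolute value. The leading [z0] makes the grid start at time 0. *)
pose s i : {nonneg R} := NngNum (normr_ge0 ((a i.+1)%:num - (a i)%:num)).
exists s, (size sl); have aS i : (i < size sl)%N -> (a i)%:num <= (a i.+1)%:num.
  case: i => [|i] isl; first by rewrite /a/=.
  rewrite /a/=; apply: (sorted_leq_nth tr _ z0 ss) => //.
  - by move=> x; exact: lexx.
  - by rewrite inE; exact: ltnW.
have sa k : (k <= size sl)%N -> tsum s k = a k.
  elim: k => [|k ih] ksl; apply: val_inj => //=.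
  rewrite ih; last exact: ltnW.
  by rewrite ger0_norm ?subr_ge0 ?aS// addrC subrK.
move=> t; rewrite -(mem_sort le_nng) -/sl => tsl.
exists (index t sl).+1; first by rewrite index_mem.
by rewrite sa ?index_mem// /a/= nth_index.
Qed.

Section fixed_times.
Variables (s : nat -> {nonneg R}) (N : nat).

Let G : set (set path) := [set D | exists B0 (B : nat -> set R),
  [/\ measurable B0, forall i, measurable (B i) & D = increments_rect s N B0 B]].

Let GT : measurableType _ := g_sigma_algebraType G.

Let G_setI : setI_closed G.
Proof.
move=> _ _ [A0 [A [mA0 mA ->]]] [B0 [B [mB0 mB ->]]].
exists (A0 `&` B0), (fun i => A i `&` B i); split.
- exact: measurableI.
- by move=> i; exact: measurableI.
apply/seteqP; split => w /=.
  by move=> [[a0 a] [b0 b]]; split => // i iN; split; [exact: a|exact: b].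
by move=> [[a0 b0] ab]; split; split => // i /ab[].
Qed.

Let measurable_tsum k : (k <= N)%N ->
  measurable_fun [set: GT] (fun w : GT => (w : path) (tsum s k)).
Proof.
elim: k => [_|k ih kN].
  move=> _ B mB; rewrite setTI; apply: sub_gen_smallest.
  exists B, (fun=> setT); split => //.
  by apply/seteqP; split => w /=; [split|case].
rewrite (_ : (fun w : GT => _) = (fun w : GT => (w : path) (tsum s k) +
    ((w : path) (tsum s k.+1) - (w : path) (tsum s k)))); last first.
  by apply/funext => w; rewrite addrC subrK.
apply: measurable_funD; first by apply: ih; exact: ltnW.
move=> _ B mB; rewrite setTI; apply: sub_gen_smallest.
exists setT, (fun i => if i == k then B else setT); split => //.
  by move=> i; case: ifP.
apply/seteqP; split => w /=.
  by move=> Bw; split => // i _; case: eqP => // ->.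
by case=> _ /(_ k kN); rewrite eqxx.
Qed.

(** Intersections of increment rectangles stay rectangles only over a common grid. The Dynkin
    argument is therefore run first on a fixed grid, where it reaches every event that depends on
    the path at finitely many grid times. *)
Lemma dynkin_increments (Q : set (set path)) :
  (forall D, measurable D -> Q D -> Q (~` D)) ->
  (forall F : (set path)^nat, (forall n, measurable (F n)) -> trivIset setT F ->
    (forall n, Q (F n)) -> Q (\bigcup_n F n)) ->
  (forall B0 B, measurable B0 -> (forall i, measurable (B i)) ->
    Q (increments_rect s N B0 B)) ->
  forall n (t : nat -> {nonneg R}) (B : nat -> set R),
    (forall i, measurable (B i)) ->
    (forall i, (i < n)%N -> exists2 k, (k <= N)%N & tsum s k = t i) ->
    Q [set w : path | forall i, (i < n)%N -> B i (w (t i))].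
Proof.
move=> QC QU QR n t B mB tk.
have sub D : <<s G >> D -> measurable D.
  apply: smallest_sub; first exact: sigma_algebra_measurable.
  by move=> _ [B0 [B' [mB0 mB' ->]]]; exact: measurable_increments_rect.
have H : forall D, <<s G >> D -> Q D.
  apply: (@dynkin_induction _ GT G Q) => //.
  - have -> : [set: GT] = increments_rect s N setT (fun=> setT).
      by apply/seteqP; split => w.
    exact: QR.
  - by move=> _ [B0 [B' [mB0 mB' ->]]]; exact: QR.
  - by move=> D mD; apply: QC; exact: sub.
  - by move=> F mF; apply: QU => k; apply: sub; exact: mF.
apply: H.
have : @measurable _ GT [set w : GT | forall i, (i < n)%N -> B i ((w : path) (t i))].
  rewrite (_ : [set w | _] = \bigcap_i [set w : GT | (i < n)%N -> B i ((w : path) (t i))]).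
    apply: bigcapT_measurable => i; case: (ltnP i n) => ni.
      rewrite (_ : [set w | _] = (fun w : GT => (w : path) (t i)) @^-1` B i).
        have [k kN <-] := tk i ni.
        by rewrite -[X in measurable X]setTI; exact: measurable_tsum.
      by apply/seteqP; split => w /=; [apply|].
    by rewrite (_ : [set w | _] = setT)//; apply/seteqP; split => w //.
  by apply/seteqP; split => w h i; [move=> _; exact: h|exact: h].
by [].
Qed.

End fixed_times.

(** The second Dynkin argument: any finite set of times fits into a grid by [tsum_cover], so [Q]
    holds on finite cylinders, a generating class stable under intersection. *)
Lemma path_dynkin (Q : set (set path)) :
  (forall D, measurable D -> Q D -> Q (~` D)) ->
  (forall F : (set path)^nat, (forall n, measurable (F n)) -> trivIset setT F ->
    (forall n, Q (F n)) -> Q (\bigcup_n F n)) ->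
  (forall s n B0 B, measurable B0 -> (forall i, measurable (B i)) ->
    Q (increments_rect s n B0 B)) ->
  forall D, measurable D -> Q D.
Proof.
move=> QC QU QR.
have QG : finite_cylinder `<=` Q.
  move=> _ [n [t [B [mB ->]]]].
  have [s [N sN]] := tsum_cover [seq t i | i <- iota 0 n].
  apply: (dynkin_increments QC QU (QR s N)) => // i ni.
  by apply: sN; apply/mapP; exists i => //; rewrite mem_iota.
rewrite measurable_path_finite_cylinder.
apply: (dynkin_induction measurable_path_finite_cylinder finite_cylinder_setI) => //.
apply: QG; exists 0%N, (fun=> 0%:nng), (fun=> setT); split => //.
by apply/seteqP; split.
Qed.

End path_dynkin.

(** * Mixtures of Levy laws and a criterion for goodness *)

Section levy_space.
Context {R : realType}.

Lemma measurable_marginal (t : {nonneg R}) :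
  measurable_fun [set: levy_space R] (marginal t : levy_space R -> pprobability R R).
Proof.
move=> _ B mB; apply: sub_gen_smallest; exists t => //.
by exists B => //; rewrite setTI.
Qed.

Lemma measurable_marginal_eval (t : {nonneg R}) (B : set R) : measurable B ->
  measurable_fun [set: levy_space R] (fun g : levy_space R => marginal t g B).
Proof. exact: (measurable_kernel (kprobability (measurable_marginal t)) B). Qed.

(** The sigma-algebra only makes one-time marginals measurable. On increment rectangles a Levy law
    is a product of marginals, and the Dynkin argument carries measurability to all path events,
    which gives the integrals in [mixture_of_levy] their meaning. *)
Lemma measurable_levy_eval (D : set (path_space R)) : measurable D ->
  measurable_fun [set: levy_space R] (fun g : levy_space R => levy_law_val g D).
Proof.
apply: (path_dynkin (Q := fun D => measurable_fun [set: levy_space R]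
  (fun g : levy_space R => levy_law_val g D))).
- move=> D' mD' mf.
  rewrite (_ : (fun g => _) = (fun g : levy_space R => 1 - levy_law_val g D')%E).
    exact: emeasurable_funB.
  by apply/funext => g; rewrite probability_setC.
- move=> F mF tF mFn.
  rewrite (_ : (fun g => _) = (fun g : levy_space R =>
      \sum_(0 <= i <oo) levy_law_val g (F i))%E).
    by apply: ge0_emeasurable_sum => //.
  apply/funext => g; rewrite measure_semi_bigcup//.
  exact: bigcupT_measurable.
- move=> s n B0 B mB0 mB.
  rewrite (_ : (fun g => _) = (fun g : levy_space R =>
      \d_(0%R : R) B0 * \prod_(i < n) marginal (s i) g (B i))%E); last first.
    by apply/funext => g; rewrite levy_law_rect.
  apply: emeasurable_funM => //; elim: n => [|n ih].
    rewrite (_ : (fun g => _) = cst 1%E)//.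
    by apply/funext => g; rewrite big_ord0.
  under eq_fun do rewrite big_ord_recr/=.
  by apply: emeasurable_funM => //; exact: measurable_marginal_eval.
Qed.

Lemma prode_fine (g : levy_law R) (s : nat -> {nonneg R}) (B : nat -> set R) n :
  (forall i, measurable (B i)) ->
  (\prod_(i < n) marginal (s i) g (B i))%E =
  (\prod_(0 <= i < n) fine (marginal (s i) g (B i)))%:E.
Proof.
move=> mB; rewrite big_mkord; elim: n => [|n ih]; first by rewrite !big_ord0.
by rewrite !big_ord_recr/= ih EFinM fineK// fin_num_measure.
Qed.

Section mixtures.
Context {d1 d2} {O1 : measurableType d1} {O2 : measurableType d2}.
Variables (P1 : probability O1 R) (P2 : probability O2 R).
Variables (S : {nonneg R} -> {RV P1 >-> R}) (T : {nonneg R} -> {RV P2 >-> R}).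
Variables Theta1 Theta2 : probability (levy_space R) R.
Hypotheses (mS : mixture_of_levy S Theta1) (mT : mixture_of_levy T Theta2).

Let int_rect (Theta : probability (levy_space R) R) s n B0 B : measurable B0 ->
  (forall i, measurable (B i)) ->
  (\int[Theta]_g levy_law_val g (increments_rect s n B0 B))%E =
  (\d_(0%R : R) B0 * (\int[Theta]_g
    \prod_(0 <= i < n) fine (marginal (s i) g (B i)))%:E)%E.
Proof.
move=> mB0 mB.
have mp : measurable_fun [set: levy_space R]
    (fun g : levy_space R => \prod_(0 <= i < n) fine (marginal (s i) g (B i))).
  apply: measurable_prod => i _; apply: (measurableT_comp (f := fine)) => //.
  exact: measurable_marginal_eval.
have p1 g : `|\prod_(0 <= i < n) fine (marginal (s i) g (B i))| <= 1.
  apply: (big_ind (fun x => `|x| <= 1)) => [|x y x1 y1|i _].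
  - by rewrite normr1.
  - by rewrite normrM mulr_ile1.
  - have /andP[f0 f1] := subprobability_fine_itv (marginal (s i) g) (mB i).
    by rewrite ger0_norm.
rewrite (EFin_Rintegral Theta mp p1) -ge0_integralZl//.
- apply: eq_integral => g _; rewrite levy_law_rect// prode_fine//.
- exact/measurable_EFinP.
- by move=> g _; rewrite lee_fin prodr_ge0// => i _; exact: fine_ge0.
Qed.

Lemma eq_law_mixture :
  (forall (s : nat -> {nonneg R}) n (B : nat -> set R),
    (forall i, measurable (B i)) ->
    \int[Theta1]_g \prod_(0 <= i < n) fine (marginal (s i) g (B i)) =
    \int[Theta2]_g \prod_(0 <= i < n) fine (marginal (s i) g (B i))) ->
  law S ≡μ law T.
Proof.
move=> H; apply: (path_dynkin (Q := fun D => law S D = law T D)).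
- by move=> D mD SD; rewrite !probability_setC// SD.
- move=> F mF tF SF; rewrite !measure_semi_bigcup//; last 2 first.
  + exact: bigcupT_measurable.
  + exact: bigcupT_measurable.
  by apply: eq_eseriesr => i _; exact: SF.
- move=> s n B0 B mB0 mB; have mr := measurable_increments_rect s n mB0 mB.
  by rewrite mS// mT// !int_rect// H.
Qed.

Lemma mixture_marginal t B : measurable B ->
  fine (distribution P1 (S t) B) = \int[Theta1]_g fine (marginal t g B).
Proof.
move=> mB.
have mD : measurable (Defs.coord t @^-1` B : set (path_space R)).
  by rewrite -[X in measurable X]setTI; exact: measurable_coord.
rewrite /Rintegral; congr fine; transitivity (law S (Defs.coord t @^-1` B)) => //.
rewrite mS//; apply: eq_integral => g _; rewrite fineK// fin_num_measure//.
Qed.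

End mixtures.

(** By [eq_multi_kernel], the probabilities in an increment rectangle may be replaced by integrals
    of test functions. The tests need to separate measures on [K] only, where all marginals of laws
    in [L] live. *)
Lemma good_criterion (L : set (levy_space R)) (J : Type) (j0 : J) (K : set R)
    (test : J -> R -> R) :
  measurable L -> measurable K ->
  (forall g, L g -> forall t, marginal t g (~` K) = 0%E) ->
  (forall j, measurable_fun setT (test j)) ->
  (forall j x, 0 <= test j x <= 1) ->
  (forall m1 m2 : subprobability R R, m1 (~` K) = 0%E -> m2 (~` K) = 0%E ->
    (forall j, \int[m1]_x test j x = \int[m2]_x test j x) ->
    forall B, measurable B -> m1 B = m2 B) ->
  (forall Theta1 Theta2 : probability (levy_space R) R,
    Theta1 L = 1%E -> Theta2 L = 1%E ->
    (forall t B, measurable B -> \int[Theta1]_g fine (marginal t g B) =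
      \int[Theta2]_g fine (marginal t g B)) ->
    forall (s : nat -> {nonneg R}) n (j : nat -> J),
      \int[Theta1]_g \prod_(0 <= i < n) \int[marginal (s i) g]_x test (j i) x =
      \int[Theta2]_g \prod_(0 <= i < n) \int[marginal (s i) g]_x test (j i) x) ->
  good L.
Proof.
move=> mL mK LK mtest test01 det H; split=> // d1 d2 O1 O2 P1 P2 S T Theta1 Theta2.
move=> mS mT T1 T2 ST; apply: (eq_law_mixture mS mT) => s n B mB.
have aeL (Theta : probability (levy_space R) R) : Theta L = 1%E ->
    forall i, {ae Theta, forall g, marginal (s i) g (~` K) = 0%E}.
  move=> TL i; exists (~` L); split.
  - exact: measurableC.
  - by rewrite probability_setC// TL subee.
  - by move=> g /=; apply: contra_not => Lg; exact: LK.
apply: (eq_multi_kernel j0 (Theta1 := Theta1) (Theta2 := Theta2)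
  (k1 := fun i g => marginal (s i) g : subprobability R R)
  (k2 := fun i g => marginal (s i) g : subprobability R R)
  _ _ mK (aeL _ T1) (aeL _ T2) mtest test01 det) => //.
- by move=> i B' mB'; exact: measurable_marginal_eval.
- by move=> i B' mB'; exact: measurable_marginal_eval.
- exact: iota_uniq.
- move=> j; apply: H => // t B' mB'.
  by rewrite -(mixture_marginal mS t mB') -(mixture_marginal mT t mB') ST.
Qed.

End levy_space.

(** * Independent uniform variables from binary digits *)

Section laplace_uniqueness.
Context {R : realType}.

Lemma exp_negX (n : nat) (x : R) : exp_neg 1 x ^+ n = exp_neg n%:R x.
Proof. by rewrite /exp_neg -expRM_natl mulrA mulrN mulr1. Qed.

(** Integer parameters suffice because exp (- n x) is the n-th power of exp (- x): the values are
    the moments of a bounded function, inverted on [0, +oo[ by - ln. *)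
Lemma eq_from_laplace (m1 m2 : {finite_measure set R -> \bar R}) :
  m1 (~` `[0, +oo[%classic) = 0%E -> m2 (~` `[0, +oo[%classic) = 0%E ->
  (forall n : nat, \int[m1]_x exp_neg n%:R x = \int[m2]_x exp_neg n%:R x) ->
  forall B, measurable B -> m1 B = m2 B.
Proof.
move=> m10 m20 H; apply: (eq_from_transform (h := exp_neg 1) (g := fun y => - ln y)
  (K := `[0, +oo[%classic) (C := 1)) => //.
- exact: measurable_exp_neg.
- by apply: measurableT_comp => //; exact: measurable_ln.
- by apply: itv01_norm => x; exact: exp_neg_itv01.
- move=> x /=; rewrite in_itv/= andbT => x0.
  by rewrite /exp_neg expRK mulN1r opprK max_l.
- move=> n; have := H n.
  by under eq_Rintegral do rewrite -exp_negX;
     under [X in _ = X -> _]eq_Rintegral do rewrite -exp_negX.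
Qed.

Lemma Rintegral_dirac_giry (x : R) f : measurable_fun setT f ->
  \int[giry_ret x : subprobability R R]_y f y = f x.
Proof. exact: Rintegral_giry_ret. Qed.

Lemma Rintegral_scale d (T : measurableType d) (m : {finite_measure set T -> \bar R})
    (c : R) (f : T -> R) (C : R) : measurable_fun setT f -> (forall x, `|f x| <= C) ->
  \int[m]_x (c * f x) = c * \int[m]_x f x.
Proof.
move=> mf fC; have := Rintegral_lin2 m c 0 mf mf fC fC; rewrite mul0r addr0 => <-.
by apply: eq_Rintegral => x _; rewrite mul0r addr0.
Qed.

Lemma prod_itv01 (I : Type) (s : seq I) (f : I -> R) :
  (forall i, 0 <= f i <= 1) -> 0 <= \prod_(i <- s) f i <= 1.
Proof.
move=> f01; elim: s => [|i s /andP[p0 p1]]; first by rewrite big_nil ler01 lexx.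
have /andP[f0 f1] := f01 i.
by rewrite big_cons mulr_ge0//= mulr_ile1.
Qed.

(* Knowing [W] against the Laplace transforms of [X] means knowing the measure
   [B |-> E [W; X in B]]. *)
Lemma laplace_extend d (T : measurableType d) (P : probability T R) (X W : T -> R)
    (c : R) (m : subprobability R R) :
  measurable_fun setT X -> (forall x, 0 <= X x) ->
  measurable_fun setT W -> (forall x, 0 <= W x <= 1) -> 0 <= c <= 1 ->
  m (~` `[0, +oo[%classic) = 0%E ->
  (forall n : nat, \int[P]_x (W x * exp_neg n%:R (X x)) =
    c * \int[m]_y exp_neg n%:R y) ->
  forall f : R -> R, measurable_fun setT f -> (forall x, 0 <= f x <= 1) ->
  \int[P]_x (W x * f (X x)) = c * \int[m]_y f y.
Proof.
move=> mX X0 mW W01 c01 m0 H f mf f01.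
have mk B : measurable B ->
    measurable_fun setT (fun x => (giry_ret (X x) : subprobability R R) B).
  move=> mB; apply: (measurableT_comp (measurable_giry_ev (R := R) mB)).
  by apply: measurableT_comp => //; exact: measurable_giry_ret.
have [m1 [m1B m1f]] := weighted_kernel mk mW W01 P.
have [m2 [m2B m2f]] := weighted_kernel
  (fun B mB => @measurable_cst _ _ _ _ setT (m B))
  (@measurable_cst _ _ _ _ setT c) (fun=> c01) P.
have E1 (g : R -> R) : measurable_fun setT g -> (forall x, 0 <= g x <= 1) ->
    \int[m1]_y g y = \int[P]_x (W x * g (X x)).
  move=> mg g01; rewrite m1f//; apply: eq_Rintegral => x _.
  by rewrite Rintegral_dirac_giry.
have E2 (g : R -> R) : measurable_fun setT g -> (forall x, 0 <= g x <= 1) ->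
    \int[m2]_y g y = c * \int[m]_y g y.
  by move=> mg g01; rewrite (m2f _ mg g01); exact: (Rintegral_prob_cst P (c * \int[m]_y g y)).
have mC : measurable (~` `[0, +oo[%classic : set R) by exact: measurableC.
rewrite -E1// -E2//.
have m12 : forall B, measurable B -> m1 B = m2 B.
  apply: eq_from_laplace.
  - apply: (etrans (m1B _ mC)); rewrite -[RHS](@integral0 _ _ _ P setT); apply: eq_integral => x _.
    by rewrite /giry_ret/= diracE memNset ?mule0//= in_itv/= X0.
  - apply: (etrans (m2B _ mC)); rewrite -[RHS](@integral0 _ _ _ P setT); apply: eq_integral => x _.
    by rewrite m0 mule0.
  - move=> n; rewrite E1 ?E2//; try exact: measurable_exp_neg.
    + by move=> x; exact: exp_neg_itv01.
    + by move=> x; exact: exp_neg_itv01.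
by rewrite /Rintegral (eq_measure_integral m2)// => A mA _; exact: m12.
Qed.

End laplace_uniqueness.

(** * The uniform law on [0, 1] and the splitting of its digits *)

Section unit_uniform.
Context {R : realType}.

Definition of_borel (x : measurableTypeR R) : R := x.

Lemma measurable_of_borel : measurable_fun setT of_borel.
Proof. by move=> _ B mB; rewrite setTI. Qed.

HB.instance Definition _ := isMeasurableFun.Build _ _ (measurableTypeR R) R
  of_borel measurable_of_borel.

Definition unif : probability R R := distribution (uniform_prob (@ltr01 R)) of_borel.

Lemma unifE B : measurable B -> unif B = lebesgue_measure (B `&` `[0, 1]%classic).
Proof.
move=> mB; rewrite -[LHS]/(uniform_prob (@ltr01 R) B) /uniform_prob integral_uniform_pdf.
rewrite (eq_integral (cst 1%E)) => [|x]; last first.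
  by rewrite inE/= in_itv/= => -[_ x01]; rewrite /uniform_pdf x01 subr0 invr1.
by rewrite integral_cst ?mul1e//; exact: measurableI.
Qed.

Lemma unif_itv (a b : R) : 0 <= a -> a <= b -> b <= 1 ->
  unif `]a, b]%classic = (b - a)%:E.
Proof.
move=> a0 ab b1; rewrite unifE//.
rewrite (_ : _ `&` _ = `]a, b]%classic).
  by rewrite lebesgue_measure_itv/= lte_fin; case: ltgtP ab => // ->; rewrite subrr.
apply/seteqP; split => x /=; rewrite !in_itv/=; first by case.
move=> /andP[ax xb]; split; first by rewrite ax.
by rewrite (ltW (le_lt_trans a0 ax))/= (le_trans xb).
Qed.

Lemma unif_ray (c : R) : unif `]c, +oo[%classic =
  (if c < 0 then 1 else if c < 1 then 1 - c else 0)%:E.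
Proof.
have [c0|c0] := ltP c 0.
  rewrite unifE// (_ : _ `&` _ = `[0, 1]%classic).
    by rewrite lebesgue_measure_itv/= lte_fin ltr01 oppr0 adde0.
  apply/seteqP; split => x /=; rewrite !in_itv/=; first by case.
  by move=> x01; split => //; rewrite andbT (lt_le_trans c0)//; case/andP: x01.
rewrite unifE// (_ : _ `&` _ = `]c, 1]%classic).
  by rewrite lebesgue_measure_itv/= lte_fin; case: ifP.
apply/seteqP; split => x /=; rewrite !in_itv/= ?andbT.
  by move=> [-> /andP[]].
by move=> /andP[cx x1]; split => //; rewrite x1 (ltW (le_lt_trans c0 cx)).
Qed.

Lemma unif_set1 (x : R) : unif [set x] = 0%E.
Proof.
rewrite unifE//; apply/eqP; rewrite -measure_le0.
rewrite (le_trans (le_measure _ _ _ (@subIsetl _ _ _)))//=.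
- by rewrite inE; exact: measurableI.
- by rewrite inE.
- by rewrite lebesgue_measure_set1.
Qed.

Lemma unif_ae : {ae unif, forall x : R, 0 <= x < 1}.
Proof.
exists (~` `[0, 1[%classic); split => //; first exact: measurableC.
  rewrite (_ : ~` _ = (~` `[0, 1]%classic) `|` [set 1]).
    apply/eqP; rewrite -measure_le0 (le_trans (measureU2 _ _ _))//.
    - exact: measurableC.
    - have mC : measurable (~` `[0, 1]%classic : set R) by exact: measurableC.
      rewrite [X in (_ + X)%E]unif_set1 adde0 [X in (X <= _)%E]unifE//.
      by rewrite setICl measure0.
  apply/seteqP; split => x /=; rewrite !in_itv/=.
    move=> H; have [->|x1] := eqVneq x 1; [by right|left].
    by apply: contra_not H => /andP[-> /=]; rewrite le_eqVlt (negbTE x1).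
  by move=> [H|->]; [apply: contra_not H => /andP[-> /ltW]|rewrite ltxx andbF].
Qed.

Let low (x : R) := x / 2.
Let high (x : R) := (1 + x) / 2.
Let mlow : measurable_fun setT low. Proof. exact: measurable_funM. Qed.
Let mhigh : measurable_fun setT high.
Proof. by apply: measurable_funM => //; exact: measurable_funD. Qed.

Let half : {nonneg R} := (2^-1)%:nng.

Lemma unif_halves B : measurable B ->
  unif B = measure_add (mscale half (giry_map mlow (unif : giry R R)))
    (mscale half (giry_map mhigh (unif : giry R R))) B.
Proof.
move: B; apply: measure_eq_rays.
  by rewrite -[X in (X < _)%E]/(unif setT) probability_setT ltry.
move=> c; rewrite [RHS](measure_addE (mscale half (giry_map mlow unif))
  (mscale half (giry_map mhigh unif)) _) /mscale.
transitivity (half%:num%:E * unif (low @^-1` `]c, +oo[%classic) +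
  half%:num%:E * unif (high @^-1` `]c, +oo[%classic))%E; last by [].
rewrite (_ : low @^-1` _ = `]2 * c, +oo[%classic); last first.
  apply/seteqP; split => x /=; rewrite !in_itv/= !andbT /low; lra.
rewrite (_ : high @^-1` _ = `]2 * c - 1, +oo[%classic); last first.
  apply/seteqP; split => x /=; rewrite !in_itv/= !andbT /high; lra.
have E (a b x y : \bar R) : a = x -> b = y ->
  (half%:num%:E * a + half%:num%:E * b = half%:num%:E * x + half%:num%:E * y)%E.
  by move=> -> ->.
apply: (etrans (unif_ray _)); apply: esym; apply: (etrans (E _ _ _ _ (unif_ray _) (unif_ray _))).
rewrite -!EFinM -EFinD; congr (_%:E) => /=.
by repeat case: ltP => ?; lra.
Qed.

(** Conditioning on the first binary digit; the Laplace transforms of the digit variables are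
    computed from this self-similarity. *)
Lemma unif_split (f : R -> R) : measurable_fun setT f -> (forall x, `|f x| <= 1) ->
  \int[unif]_x f x =
  2^-1 * \int[unif]_x f (x / 2) + 2^-1 * \int[unif]_x f ((1 + x) / 2).
Proof.
move=> mf f1.
have W (g : R -> R) : measurable_fun setT g -> (forall x, 0 <= g x <= 1) ->
    \int[unif]_x g x =
    2^-1 * \int[unif]_x g (x / 2) + 2^-1 * \int[unif]_x g ((1 + x) / 2).
  move=> mg g01; have g0 x : (0 <= (g x)%:E)%E by rewrite lee_fin; case/andP: (g01 x).
  have mEg : measurable_fun setT (EFin \o g) by exact/measurable_EFinP.
  apply: EFin_inj; rewrite (EFin_Rintegral unif (C := 1))//; last exact: itv01_norm.
  rewrite (eq_measure_integral _ (fun A mA _ => unif_halves mA)).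
  rewrite ge0_integral_measure_add// !ge0_integral_mscale//.
  have El : (\int[unif]_x g (x / 2))%:E = (\int[unif]_x (g (x / 2))%:E)%E :=
    EFin_Rintegral unif (measurableT_comp mg mlow) (fun x => itv01_norm g01 (low x)).
  have Eh : (\int[unif]_x g ((1 + x) / 2))%:E = (\int[unif]_x (g ((1 + x) / 2))%:E)%E :=
    EFin_Rintegral unif (measurableT_comp mg mhigh) (fun x => itv01_norm g01 (high x)).
  rewrite EFinD !EFinM El Eh.
  by congr (_ * _ + _ * _)%E; rewrite -[LHS]/(giry_int (giry_map _ _) (EFin \o g))
    giry_int_map.
have mr (h : R -> R) : measurable_fun setT h -> measurable_fun setT (f \o h).
  exact: measurableT_comp.
have El : \int[unif]_x f (x / 2) = 2 * \int[unif]_x (2^-1 * f (x / 2) + 2^-1 * 1) +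
  (-1) * \int[unif]_x 1 := Rintegral_recenter unif (mr _ mlow) (fun=> f1 _).
have Eh : \int[unif]_x f ((1 + x) / 2) =
  2 * \int[unif]_x (2^-1 * f ((1 + x) / 2) + 2^-1 * 1) + (-1) * \int[unif]_x 1 :=
  Rintegral_recenter unif (mr _ mhigh) (fun=> f1 _).
rewrite El Eh Rintegral_recenter// (W _ (measurable_recenter mf) (recenter_itv01 f1)).
rewrite Rintegral_prob_cst /comp; set a := \int[_]_x _; set b := \int[_]_x _; lra.
Qed.

(* Binary digits: [bit] is the first one, [dbl] shifts them. *)
Let bit (x : R) : R := (1 <= 2 * x)%R%:R.
Let dbl (x : R) : R := 2 * x - bit x.

Let mbit : measurable_fun setT bit.
Proof.
rewrite (_ : bit = fun x => if 1 <= 2 * x then 1 else 0); last first.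
  by apply/funext => x; rewrite /bit; case: ifP.
by apply: measurable_fun_if => //; apply: measurable_fun_ler.
Qed.
Let mdbl : measurable_fun setT dbl.
Proof. exact: measurable_funB. Qed.

Let bit_low (x : R) : 0 <= x < 1 -> bit (x / 2) = 0 /\ dbl (x / 2) = x.
Proof.
move=> x01; rewrite /dbl /bit (_ : (1 <= _) = false); last by apply/negP; lra.
by split => //; rewrite subr0; field.
Qed.
Let bit_high (x : R) : 0 <= x < 1 -> bit ((1 + x) / 2) = 1 /\ dbl ((1 + x) / 2) = x.
Proof.
move=> x01; rewrite /dbl /bit (_ : (1 <= _) = true); last by lra.
by split => //=; rewrite mulr1n; field.
Qed.

(** The two components change places at each digit, so the first gathers the binary digits at odd
    positions and the second those at even positions. *)
Fixpoint digits n (x : R) : R * R :=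
  if n is k.+1 then ((bit x + (digits k (dbl x)).2) / 2, (digits k (dbl x)).1)
  else (0, 0).

Let mdigits n : measurable_fun setT (fun x => (digits n x).1) /\
  measurable_fun setT (fun x => (digits n x).2).
Proof.
elim: n => [|n [ih1 ih2]] /=; first by split; exact: measurable_cst.
split; last exact: (measurableT_comp ih1 mdbl).
apply: measurable_funM => //; apply: measurable_funD; first exact: mbit.
exact: (measurableT_comp ih2 mdbl).
Qed.

Let bit01 x : 0 <= bit x <= 1.
Proof. by rewrite /bit ler0n lern1 leq_b1. Qed.

Let digits01 n x : 0 <= (digits n x).1 <= 1 /\ 0 <= (digits n x).2 <= 1.
Proof.
elim: n x => [|n ih] x /=; first by rewrite lexx ler01.
have [h1 h2] := ih (dbl x); have := bit01 x; split => //; lra.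
Qed.

Let digits_le n x : (digits n x).1 <= (digits n.+1 x).1 /\
  (digits n x).2 <= (digits n.+1 x).2.
Proof.
elim: n x => [|n ih] x.
  by have [/andP[h1 _] /andP[h2 _]] := digits01 1 x.
have [h1 h2] := ih (dbl x); split; last exact: h1.
by rewrite -[_.1]/((bit x + (digits n (dbl x)).2) / 2)
  -[X in _ <= X]/((bit x + (digits n.+1 (dbl x)).2) / 2); lra.
Qed.

Definition odd_digits (x : R) : R := limn (fun n => (digits n x).1).
Definition even_digits (x : R) : R := limn (fun n => (digits n x).2).

Let digits_cvg x : (fun n => (digits n x).1) @ \oo --> odd_digits x /\
  (fun n => (digits n x).2) @ \oo --> even_digits x.
Proof.
split; apply: nondecreasing_is_cvgn.
- by apply/nondecreasing_seqP => n; have [] := digits_le n x.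
- by exists 1 => _ [n _ <-]; have [/andP[]] := digits01 n x.
- by apply/nondecreasing_seqP => n; have [] := digits_le n x.
- by exists 1 => _ [n _ <-]; have [_ /andP[]] := digits01 n x.
Qed.

Lemma measurable_odd_digits : measurable_fun setT odd_digits.
Proof.
apply: (measurable_fun_cvg (h := fun n x => (digits n x).1)) => [n|x _].
  by have [] := mdigits n.
by have [] := digits_cvg x.
Qed.

Lemma measurable_even_digits : measurable_fun setT even_digits.
Proof.
apply: (measurable_fun_cvg (h := fun n x => (digits n x).2)) => [n|x _].
  by have [] := mdigits n.
by have [] := digits_cvg x.
Qed.

Lemma digits_ge0 x : 0 <= odd_digits x /\ 0 <= even_digits x.
Proof.
have [c1 c2] := digits_cvg x.
split; [rewrite -(cvg_lim _ c1)|rewrite -(cvg_lim _ c2)] => //;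
  apply: limr_ge; try (apply: cvgP; eassumption);
  by apply: nearW => n; have [/andP[? _] /andP[? _]] := digits01 n x.
Qed.

Let exp_neg_cvg (a : R) (u : nat -> R) (l : R) :
  (forall n, 0 <= u n) -> 0 <= l -> u @ \oo --> l ->
  (fun n => exp_neg a (u n)) @ \oo --> exp_neg a l.
Proof.
move=> u0 l0 ul; rewrite /exp_neg max_l//.
rewrite (_ : (fun n => _) = fun n => expR (- a * u n)); last first.
  by apply/funext => n; rewrite max_l.
by apply: cvg_expR; apply: cvgM => //; exact: cvg_cst.
Qed.

Let psi (a : R) := \int[unif]_x exp_neg a x.

Let exp_neg_low (a x : R) : exp_neg a (x / 2) = exp_neg (a / 2) x.
Proof.
rewrite /exp_neg; congr expR.
have -> : Num.max (x / 2) 0 = Num.max x 0 / 2 by rewrite maxr_pMl// mul0r.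
by ring.
Qed.

Let exp_neg_high (a x : R) : 0 <= x ->
  exp_neg a ((1 + x) / 2) = expR (- (a / 2)) * exp_neg (a / 2) x.
Proof.
move=> x0; rewrite /exp_neg !max_l//; last lra.
by rewrite -expRD; congr expR; field.
Qed.

Let w (a : R) := 2^-1 * (1 + expR (- (a / 2))).

Let exp_neg1 (a : R) : 0 <= a -> forall x, `|exp_neg a x| <= 1.
Proof. by move=> a0; apply: itv01_norm => x; exact: exp_neg_itv01. Qed.

Let psi_rec a : 0 <= a -> psi a = w a * psi (a / 2).
Proof.
move=> a0; have a20 : 0 <= a / 2 by rewrite divr_ge0.
rewrite /psi unif_split; [|exact: measurable_exp_neg|exact: exp_neg1].
under eq_Rintegral do rewrite exp_neg_low.
rewrite (ae_eq_Rintegral (m := unif)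
  (f := fun x => exp_neg a ((1 + x) / 2))
  (g := fun x => expR (- (a / 2)) * exp_neg (a / 2) x)).
- rewrite (Rintegral_scale _ _ (C := 1)) /w; first by ring.
  + exact: measurable_exp_neg.
  + exact: exp_neg1.
- apply: (measurableT_comp (measurable_exp_neg a)).
  by apply: measurable_funM => //; exact: measurable_funD.
- by apply: measurable_funM => //; exact: measurable_exp_neg.
- by apply: filterS unif_ae => x /andP[x0 _]; rewrite exp_neg_high.
Qed.

Let phi n (a c : R) :=
  \int[unif]_x (exp_neg a (digits n x).1 * exp_neg c (digits n x).2).

Let mphi n a c : measurable_fun setT
  (fun x => exp_neg a (digits n x).1 * exp_neg c (digits n x).2).
Proof.
have [m1 m2] := mdigits n.
by apply: measurable_funM; [exact: (measurableT_comp (measurable_exp_neg a) m1)|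
  exact: (measurableT_comp (measurable_exp_neg c) m2)].
Qed.

Let exp_neg2_01 (a c x y : R) : 0 <= a -> 0 <= c -> 0 <= exp_neg a x * exp_neg c y <= 1.
Proof.
move=> a0 c0; have /andP[p0 p1] := exp_neg_itv01 x a0.
have /andP[q0 q1] := exp_neg_itv01 y c0.
by rewrite mulr_ge0//= mulr_ile1.
Qed.

(** The first digit contributes the factor [w a], as in [psi_rec], and the exchange of the
    components becomes an exchange of the parameters. *)
Let phi_rec n a c : 0 <= a -> 0 <= c -> phi n.+1 a c = w a * phi n c (a / 2).
Proof.
move=> a0 c0; have a20 : 0 <= a / 2 by rewrite divr_ge0.
have b1 k (a' c' : R) : 0 <= a' -> 0 <= c' ->
    forall x, `|exp_neg a' (digits k x).1 * exp_neg c' (digits k x).2| <= 1.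
  by move=> ? ?; apply: itv01_norm => x; exact: exp_neg2_01.
have mr (h : R -> R) : measurable_fun setT h -> measurable_fun setT
    (fun x => exp_neg a (digits n.+1 (h x)).1 * exp_neg c (digits n.+1 (h x)).2).
  exact: (measurableT_comp (mphi n.+1 a c)).
rewrite /phi unif_split; [|exact: mphi|exact: b1].
rewrite (ae_eq_Rintegral (m := unif) (f := fun x => _ (digits n.+1 (x / 2)).1 * _)
  (g := fun x => exp_neg c (digits n x).1 * exp_neg (a / 2) (digits n x).2)); first last.
- apply: filterS unif_ae => x x01 /=; have [-> ->] := bit_low x01.
  by rewrite add0r exp_neg_low mulrC.
- exact: mphi.
- exact: (mr _ mlow).
rewrite (ae_eq_Rintegral (m := unif) (f := fun x => _ (digits n.+1 ((1 + x) / 2)).1 * _)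
  (g := fun x => expR (- (a / 2)) *
    (exp_neg c (digits n x).1 * exp_neg (a / 2) (digits n x).2))); first last.
- apply: filterS unif_ae => x x01 /=; have [-> ->] := bit_high x01.
  rewrite exp_neg_high; last by have [_ /andP[]] := digits01 n x.
  by rewrite -mulrA [_ * exp_neg c _]mulrC.
- by apply: measurable_funM => //; exact: mphi.
- exact: (mr _ mhigh).
rewrite (Rintegral_scale _ _ (C := 1)) /w; first by ring.
- exact: mphi.
- exact: b1.
Qed.

(** Two digits restore the order of the parameters and halve both, just as [psi_rec] halves each of
    them. The corrections psi (a / 2^m) tend to 1, so independence follows in the limit without
    infinite products. *)
Let phi_eq m a c : 0 <= a -> 0 <= c ->
  phi m.*2 a c * (psi (a / 2 ^+ m) * psi (c / 2 ^+ m)) = psi a * psi c.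
Proof.
elim: m a c => [|m ih] a c a0 c0.
  rewrite expr0 !divr1 /phi [X in X * _](_ : _ = 1) ?mul1r//.
  under eq_Rintegral do rewrite /= /exp_neg maxxx !mulr0 expR0 mulr1.
  by rewrite Rintegral_prob_cst.
have a20 : 0 <= a / 2 by rewrite divr_ge0.
have c20 : 0 <= c / 2 by rewrite divr_ge0.
rewrite doubleS phi_rec// phi_rec// (psi_rec a0) (psi_rec c0).
have := ih (a / 2) (c / 2) a20 c20.
rewrite !exprS !invfM !(mulrA _ 2^-1) => H.
by rewrite [RHS]mulrACA -H -!mulrA.
Qed.

Let psi_half a : 0 <= a -> (fun m => psi (a / 2 ^+ m)) @ \oo --> (1 : R).
Proof.
move=> a0; rewrite -[X in _ --> X](Rintegral_prob_cst unif 1).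
apply: (Rintegral_bounded_cvg (m := unif) (C := 1)) => [n|n x|x].
- exact: measurable_exp_neg.
- by apply: exp_neg1; rewrite divr_ge0.
- rewrite /exp_neg -[X in _ --> X](@expR0 R); apply: cvg_expR.
  rewrite -[X in _ --> X](mul0r (Num.max x 0)); apply: cvgM; last exact: cvg_cst.
  rewrite -oppr0; apply: cvgN; rewrite -[X in _ --> X](mulr0 a).
  apply: cvgM; first exact: cvg_cst.
  rewrite (_ : (fun n => _) = (fun n => (2^-1 : R) ^+ n)); last first.
    by apply/funext => n; rewrite exprVn.
  by apply: cvg_expr; rewrite ger0_norm//; lra.
Qed.

Lemma digits_laplace a c : 0 <= a -> 0 <= c ->
  \int[unif]_x (exp_neg a (odd_digits x) * exp_neg c (even_digits x)) =
  (\int[unif]_x exp_neg a x) * (\int[unif]_x exp_neg c x).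
Proof.
move=> a0 c0.
have H1 : (fun m => phi m.*2 a c) @ \oo -->
    \int[unif]_x (exp_neg a (odd_digits x) * exp_neg c (even_digits x)).
  apply: (Rintegral_bounded_cvg (m := unif) (C := 1)
    (f_ := fun m x => exp_neg a (digits m.*2 x).1 * exp_neg c (digits m.*2 x).2)).
  - by move=> n; exact: mphi.
  - by move=> n; apply: itv01_norm => x; exact: exp_neg2_01.
  - move=> x; have [c1 c2] := digits_cvg x; have [d1 d2] := digits_ge0 x.
    have dbl_oo : (fun m => m.*2) @ \oo --> \oo.
      apply/cvgnyPge => k; exists k => // m /= km.
      by rewrite (leq_trans km)// -addnn leq_addr.
    apply: cvgM; apply: exp_neg_cvg => //.
    + by move=> n; have [/andP[]] := digits01 n.*2 x.
    + exact: (cvg_comp _ _ dbl_oo c1).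
    + by move=> n; have [_ /andP[]] := digits01 n.*2 x.
    + exact: (cvg_comp _ _ dbl_oo c2).
have H2 : (fun m => phi m.*2 a c * (psi (a / 2 ^+ m) * psi (c / 2 ^+ m))) @ \oo -->
    (\int[unif]_x (exp_neg a (odd_digits x) * exp_neg c (even_digits x))) * (1 * 1).
  by apply: cvgM => //; apply: cvgM; exact: psi_half.
move: H2; rewrite !mulr1 (_ : (fun m => _) = cst (psi a * psi c)); last first.
  by apply/funext => m; exact: phi_eq.
by move=> /(cvg_unique (@Rhausdorff R)); apply; exact: cvg_cst.
Qed.

Lemma unif_ge0 : unif (~` `[0, +oo[%classic) = 0%E.
Proof.
have [N [mN N0 sN]] := unif_ae; apply/eqP; rewrite -measure_le0.
rewrite -[X in (_ <= X)%E]N0; apply: le_measure; rewrite ?inE//; first exact: measurableC.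
by move=> x /= x0; apply: sN => /= /andP[x0' _]; apply: x0; rewrite in_itv/= x0'.
Qed.

(** The factorisation of Laplace transforms is extended to functions by [laplace_extend], one
    variable at a time with the other as a weight. *)
Lemma digits_indep (f g : R -> R) : measurable_fun setT f -> measurable_fun setT g ->
  (forall x, 0 <= f x <= 1) -> (forall x, 0 <= g x <= 1) ->
  \int[unif]_x (f (even_digits x) * g (odd_digits x)) =
  (\int[unif]_x f x) * (\int[unif]_x g x).
Proof.
move=> mf mg f01 g01.
have me := measurable_even_digits; have mo := measurable_odd_digits.
have e0 x : 0 <= even_digits x by have [] := digits_ge0 x.
have o0 x : 0 <= odd_digits x by have [] := digits_ge0 x.
apply: (laplace_extend (m := unif)) => //.
- exact: measurableT_comp.
- exact: Rintegral_itv01.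
- exact: unif_ge0.
move=> n; under eq_Rintegral do rewrite mulrC.
rewrite mulrC; apply: (laplace_extend (m := unif)) => //.
- exact: (measurableT_comp (measurable_exp_neg _)).
- by move=> x; exact: exp_neg_itv01.
- apply: Rintegral_itv01; first exact: measurable_exp_neg.
  by move=> x; exact: exp_neg_itv01.
- exact: unif_ge0.
- by move=> k; rewrite digits_laplace.
Qed.

Lemma unif_laplace_split a : 0 <= a -> \int[unif]_x exp_neg a x =
  2^-1 * (1 + expR (- (a / 2))) * \int[unif]_x exp_neg (a / 2) x.
Proof. exact: psi_rec. Qed.

Lemma even_digits_le1 x : even_digits x <= 1.
Proof.
have [_ c2] := digits_cvg x; rewrite -(cvg_lim _ c2)//; apply: limr_le; first exact: cvgP c2.
by apply: nearW => n; have [_ /andP[]] := digits01 n x.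
Qed.

(** The digits at even positions could all be 1, so the bound is only almost sure; independence from
    a constant shows that [even_digits] is uniform. *)
Lemma even_digits_lt1 : {ae unif, forall x : R, even_digits x < 1}.
Proof.
have m1 : measurable [set x : R | ~ (even_digits x < 1)].
  rewrite (_ : [set x | _] = even_digits @^-1` `[1, +oo[%classic).
    by rewrite -[X in measurable X]setTI; apply: measurable_even_digits.
  by apply/seteqP; split => x /=; rewrite in_itv/= andbT leNgt => /negP.
exists [set x | ~ (even_digits x < 1)]; split => //.
apply: finite_measureE => //; rewrite -Rintegral_indic//.
pose f (u : R) : R := (~~ (u < 1))%:R.
have mf : measurable_fun setT f.
  rewrite (_ : f = fun u => if u < 1 then 0 else 1); last first.
    by apply/funext => u; rewrite /f; case: ifP.
  by apply: measurable_fun_ifT => //; exact: measurable_fun_ltr.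
have f01 u : 0 <= f u <= 1 by rewrite /f ler0n lern1 leq_b1.
transitivity (\int[unif]_x (f (even_digits x) * cst 1 (odd_digits x))).
  apply: eq_Rintegral => x _; rewrite mulr1 indicE /f; congr (nat_of_bool _)%:R.
  by apply/idP/idP => [|/negP h]; rewrite inE/= // => /negP.
rewrite digits_indep//; last by move=> u; rewrite /= ler01 lexx.
rewrite (ae_eq_Rintegral (m := unif) (f := f) (g := cst 0))//.
  by rewrite [X in X * _](Rintegral_prob_cst unif) mul0r.
by apply: filterS unif_ae => u /andP[_ u1]; rewrite /f u1.
Qed.

Lemma odd_digits_le1 x : odd_digits x <= 1.
Proof.
have [c1 _] := digits_cvg x; rewrite -(cvg_lim _ c1)//; apply: limr_le; first exact: cvgP c1.
by apply: nearW => n; have [/andP[]] := digits01 n x.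
Qed.

Lemma le_Rintegral_unif (f g : R -> R) : (forall x, 0 <= f x <= 1) ->
  (forall x, 0 <= g x <= 1) -> measurable_fun setT f -> measurable_fun setT g ->
  (forall x, 0 <= x <= 1 -> f x <= g x) -> \int[unif]_x f x <= \int[unif]_x g x.
Proof.
move=> f01 g01 mf mg fg.
have mM : measurable_fun setT (fun x => Num.max (f x) (g x)) by exact: measurable_maxr.
have M01 x : 0 <= Num.max (f x) (g x) <= 1.
  have /andP[a b] := f01 x; have /andP[c d] := g01 x.
  by rewrite le_max a/= ge_max b d.
rewrite (ae_eq_Rintegral (m := unif) (f := g) (g := fun x => Num.max (f x) (g x)))//.
  apply: le_Rintegral => //.
  - exact: (bounded_integrable unif mf (itv01_norm f01)).
  - exact: (bounded_integrable unif mM (itv01_norm M01)).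
  - by move=> x _; rewrite le_max lexx.
by apply: filterS unif_ae => x /andP[x0 x1]; rewrite max_r// fg// x0 ltW.
Qed.

(** The even digits are spent on one variable; the odd digits are kept as a fresh uniform variable
    from which the next ones are drawn. *)
Definition uniforms (k : nat) (x : R) : R := even_digits (iter k odd_digits x).

Lemma measurable_uniforms k : measurable_fun setT (uniforms k).
Proof.
apply: measurableT_comp; first exact: measurable_even_digits.
elim: k => [|k ih]; first exact: measurable_id.
by apply: (measurableT_comp measurable_odd_digits).
Qed.

Lemma uniforms_iid (g : nat -> R -> R) n :
  (forall k, measurable_fun setT (g k)) -> (forall k x, 0 <= g k x <= 1) ->
  \int[unif]_x \prod_(0 <= k < n) g k (uniforms k x) =
  \prod_(0 <= k < n) \int[unif]_x g k x.
Proof.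
elim: n g => [|n ih] g mg g01.
  by under eq_Rintegral do rewrite big_nil; rewrite big_nil Rintegral_prob_cst.
rewrite big_nat_recl// -(ih (fun k => g k.+1))//.
rewrite -digits_indep//.
- by apply: eq_Rintegral => x _; rewrite big_nat_recl//; congr (_ * _);
    apply: eq_bigr => k _; rewrite /uniforms iterSr.
- by apply: measurable_prod => k _; exact: (measurableT_comp (mg k.+1)
    (measurable_uniforms k)).
- by move=> x; apply: prod_itv01 => k; exact: g01.
Qed.

End unit_uniform.

(** * Mixtures over a triangle of jump laws *)

Section probability_of_measure.
Context {R : realType} {d : measure_display} {T : measurableType d}.
Variables (m : {measure set T -> \bar R}) (m1 : m setT = 1%E).

Definition prob_of_measure_fun of m setT = 1%E : set T -> \bar R := m.
Let p := prob_of_measure_fun m1.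

HB.instance Definition _ := Measure.on p.
HB.instance Definition _ := Measure_isProbability.Build _ _ _ p m1.

Definition prob_of_measure : probability T R := p.

End probability_of_measure.

Section giry_maps.
Context {R : realType}.

Lemma Rintegral_giry_map d1 d2 (T1 : measurableType d1) (T2 : measurableType d2)
    (mu : giry T1 R) (h : T1 -> T2) (mh : measurable_fun setT h) (f : T2 -> R) :
  measurable_fun setT f -> (forall y, 0 <= f y <= 1) ->
  \int[giry_map mh mu]_y f y = \int[mu]_x f (h x).
Proof.
move=> mf f01; congr fine.
rewrite -[LHS]/(giry_int (giry_map mh mu) (EFin \o f)) giry_int_map//.
- exact/measurable_EFinP.
- by move=> y; rewrite lee_fin; case/andP: (f01 y).
Qed.

End giry_maps.

(** * Measurable solvability of linear systems *)

Section linear_systems.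
Context {R : realType}.

Lemma cluster_seq k (r : nat -> 'rV[R]_k) (M : R) :
  (forall m i, 0 <= r m ord0 i <= M) ->
  exists w : 'rV[R]_k, forall e, 0 < e -> forall N,
    exists2 m, (N <= m)%N & forall i, `|r m ord0 i - w ord0 i| < e.
Proof.
move=> rM.
have cK : compact [set v : 'rV[R]_k | forall i, `[0, M]%classic (v ord0 i)].
  by apply: (@rV_compact R k (fun=> `[0, M]%classic)) => i; exact: segment_compact.
have [|w [_ cw]] := cK (r @ \oo) _.
  by exists 0%N => // m _ i; rewrite /= in_itv/= rM.
exists w => e e0 N.
have [] := cw [set v | exists2 m, (N <= m)%N & v = r m] (ball w e).
- by exists N => // m /= Nm; exists m.
- exact: nbhsx_ballx.
move=> v [[m Nm ->] [_ wv]]; exists m => // i.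
by have := wv ord0 i; rewrite -ball_normE /= distrC.
Qed.

(* Compactness replaces the real unknowns by rational approximate solutions. *)
Lemma measurable_linear_system d (T : measurableType d) k
    (y : nat -> T -> R) (c : nat -> 'I_k -> R) :
  (forall n, measurable_fun setT (y n)) -> (forall n i, `|c n i| <= 1) ->
  (forall i, c 0%N i = 1) -> (forall g, y 0%N g = 1) ->
  measurable [set g | exists w : 'I_k -> R,
    (forall i, 0 <= w i) /\ forall n, \sum_(i < k) c n i * w i = y n g].
Proof.
move=> my c1 c0 y0.
pose S m (r : 'rV[rat]_k) := [set g | (forall i, 0 <= ratr (r ord0 i) :> R) /\
  forall n, `|\sum_(i < k) c n i * ratr (r ord0 i) - y n g| <= m.+1%:R^-1].
have mS m r : measurable (S m r).
  have [r0|nr] := pselect (forall i, 0 <= ratr (r ord0 i) :> R); last first.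
    by rewrite (_ : S m r = set0)//; apply/seteqP; split => // g [].
  rewrite (_ : S m r = \bigcap_n ((fun g => `|\sum_(i < k) c n i * ratr (r ord0 i) - y n g|)
      @^-1` `]-oo, m.+1%:R^-1]%classic)); last first.
    apply/seteqP; split => g /=.
      by move=> [_ H] n _ /=; rewrite in_itv/=; exact: H.
    by move=> H; split => // n; have := H n I; rewrite /= in_itv.
  apply: bigcapT_measurable => n; rewrite -[X in measurable X]setTI.
  have mf : measurable_fun setT (fun g => `|\sum_(i < k) c n i * ratr (r ord0 i) - y n g|).
    by apply: measurableT_comp => //; exact: measurable_funB.
  exact: mf.
pose U m := \bigcup_p (if unpickle p is Some r then S m r else set0).
suff -> : [set g | exists w : 'I_k -> R, (forall i, 0 <= w i) /\
    forall n, \sum_(i < k) c n i * w i = y n g] = \bigcap_m U m.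
  apply: bigcapT_measurable => m; apply: bigcupT_measurable => p.
  by case: unpickle => [r|]; [exact: mS|exact: measurable0].
have iv m : 0 < m.+1%:R^-1 :> R by rewrite invr_gt0.
apply/seteqP; split => g /=.
  move=> [w [w0 wE]] m _.
  pose e : R := m.+1%:R^-1 / k.+1%:R.
  have e0 : 0 < e by rewrite divr_gt0.
  (* Rationals slightly above [w i] preserve nonnegativity, and [e] is small enough for the errors
     of all [k] terms together. *)
  have /choice[q qE] : forall i, exists q : rat, ratr q \in `]w i, w i + e[.
    by move=> i; apply: rat_in_itvoo; rewrite ltrDl.
  exists (pickle (\row_i q i : 'rV[rat]_k)) => //; rewrite pickleK; split => [i|n].
    by have := qE i; rewrite mxE in_itv/= => /andP[/ltW + _]; apply: le_trans.
  rewrite -wE -sumrB (le_trans (ler_norm_sum _ _ _))//.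
  apply: (@le_trans _ _ (\sum_(i < k) e)).
    apply: ler_sum => i _; rewrite mxE -mulrBr normrM -[leRHS]mul1r.
    apply: ler_pM => //; have := qE i; rewrite in_itv/= => /andP[a b].
    by rewrite ger0_norm ?subr_ge0 ?(ltW a)// lerBlDl ltW.
  have -> : \sum_(i < k) e = e * k%:R by rewrite sumr_const card_ord mulr_natr.
  rewrite /e -mulrA ger_pMr//.
  by rewrite mulrC ler_pdivrMr// mul1r ler_nat.
move=> H.
have /choice[r rS] : forall m, exists r, S m r g.
  move=> m; have [p _] := H m I; case: unpickle => // r Sr; by exists r.
have [|w wr] := @cluster_seq k (fun m => map_mx ratr (r m)) 2.
  move=> m i; rewrite mxE; have [r0 rE] := rS m; rewrite r0/=.
  have := rE 0%N; rewrite y0; under eq_bigr do rewrite c0 mul1r.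
  move=> /ler_normlP[_ h].
  have le : ratr (r m ord0 i) <= \sum_(i < k) (ratr (r m ord0 i) : R).
    by rewrite (bigD1 i)//= lerDl sumr_ge0.
  have : m.+1%:R^-1 <= 1 :> R by rewrite invf_le1 ?ler1n.
  by move=> m1; apply: (le_trans le); have := le_trans h m1; rewrite lerBlDr.
exists (w ord0); split => [i|n].
  rewrite leNgt; apply/negP => wi.
  have [|m _ /(_ i)] := wr (- w ord0 i) _ 0%N; first by rewrite oppr_gt0.
  have [r0 _] := rS m; rewrite mxE ltr_norml => /andP[_].
  by have := r0 i; move=> ?; rewrite ltrBlDr addNr ltNge => /negP; apply.
apply/eqP; rewrite -subr_eq0 -normr_le0; apply/ler_addgt0Pl => e e0; rewrite addr0.
pose e' := e / 2 / k.+1%:R.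
have e'0 : 0 < e' by rewrite !divr_gt0.
have [N Ne] : exists N : nat, (N.+1%:R^-1 : R) < e / 2.
  exists (Num.bound (e / 2)^-1); rewrite -[ltRHS]invrK ltf_pV2 ?posrE ?invr_gt0 ?divr_gt0//.
  by rewrite (lt_trans (archi_boundP _))// ?ltr_nat// invr_ge0 divr_ge0// ltW.
have [m Nm wm] := wr e' e'0 N; have [_ rE] := rS m.
have -> : \sum_(i < k) c n i * w ord0 i - y n g =
    (\sum_(i < k) c n i * ratr (r m ord0 i) - y n g) -
    \sum_(i < k) c n i * (ratr (r m ord0 i) - w ord0 i).
  under [X in _ = _ - X]eq_bigr do rewrite mulrBr.
  by rewrite sumrB; ring.
rewrite (le_trans (ler_normB _ _))// [e]splitr lerD//.
  apply: le_trans (rE n) _; apply: le_trans (ltW Ne).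
  by rewrite lef_pV2 ?posrE// ler_nat.
rewrite (le_trans (ler_norm_sum _ _ _))//; apply: (@le_trans _ _ (\sum_(i < k) e')).
  apply: ler_sum => i _; rewrite normrM -[leRHS]mul1r; apply: ler_pM => //.
  by have := wm i; rewrite mxE => /ltW.
have -> : \sum_(i < k) e' = e' * k%:R by rewrite sumr_const card_ord mulr_natr.
rewrite /e' -mulrA ger_pMr ?divr_gt0//.
by rewrite mulrC ler_pdivrMr// mul1r ler_nat.
Qed.

End linear_systems.

(** * Compound Poisson families over a hull of finitely many jump laws *)

Section hull.
Context {R : realType} (k : nat) (nu : 'I_k -> pprobability R R).

Definition hull : set (pprobability R R) := [set mu | exists w : 'I_k -> R,
  [/\ forall i, 0 <= w i, \sum_(i < k) w i = 1 &
      forall U, measurable U -> mu U = (\sum_(i < k) (w i)%:E * nu i U)%E]].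

Section weights.
Variable w : 'I_k -> R.
Hypothesis w0 : forall i, 0 <= w i.

Let part (n : nat) : {measure set R -> \bar R} :=
  if insub n is Some i then mscale (NngNum (w0 i)) (nu i : probability R R) else mzero.

Definition hull_measure : {measure set R -> \bar R} := msum part k.

Lemma hull_measureE U : hull_measure U = (\sum_(i < k) (w i)%:E * nu i U)%E.
Proof.
by rewrite /hull_measure /= /msum; apply: eq_bigr => i _; rewrite /part valK.
Qed.

Lemma hull_measure_integral (f : R -> \bar R) : measurable_fun setT f ->
  (forall x, (0 <= f x)%E) ->
  (\int[hull_measure]_x f x = \sum_(i < k) (w i)%:E * \int[nu i]_x f x)%E.
Proof.
move=> mf f0; rewrite /hull_measure ge0_integral_measure_sum//.
by apply: eq_bigr => i _; rewrite /part valK ge0_integral_mscale.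
Qed.

End weights.

Lemma hull_integral (mu : pprobability R R) (w : 'I_k -> R) (f : R -> R) :
  (forall i, 0 <= w i) ->
  (forall U, measurable U -> mu U = (\sum_(i < k) (w i)%:E * nu i U)%E) ->
  measurable_fun setT f -> (forall x, 0 <= f x <= 1) ->
  \int[mu]_x f x = \sum_(i < k) w i * \int[nu i]_x f x.
Proof.
move=> w0 muE mf f01; apply: EFin_inj.
rewrite (EFin_Rintegral (mu : probability R R) mf (itv01_norm f01)).
rewrite (eq_measure_integral (hull_measure w0)) => [|A mA _]; last first.
  by apply: (etrans (muE A mA)); rewrite hull_measureE.
rewrite hull_measure_integral.
- rewrite -sumEFin; apply: eq_bigr => i _.
  by rewrite EFinM (EFin_Rintegral (nu i : probability R R) mf (itv01_norm f01)).
- exact/measurable_EFinP.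
- by move=> x; rewrite lee_fin; case/andP: (f01 x).
Qed.

Hypothesis nu_ge0 : forall i, nu i (~` `[0, +oo[%classic) = 0%E.

Definition laplace (i : 'I_k) (l : R) : R := \int[nu i]_x exp_neg l x.

Lemma laplace01 i l : 0 <= l -> 0 <= laplace i l <= 1.
Proof.
move=> l0; apply: (Rintegral_itv01 (nu i : probability R R)).
  exact: measurable_exp_neg.
by move=> x; exact: exp_neg_itv01.
Qed.

Lemma laplace_0 i : laplace i 0 = 1.
Proof.
rewrite /laplace -[RHS](Rintegral_prob_cst (nu i : probability R R) 1).
by apply: eq_Rintegral => x _; rewrite /exp_neg oppr0 mul0r expR0.
Qed.

Lemma hull_ge0 mu : hull mu -> mu (~` `[0, +oo[%classic) = 0%E.
Proof.
move=> [w [w0 w1 muE]]; rewrite muE; last exact: measurableC.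
by apply: big1 => i _; rewrite nu_ge0 mule0.
Qed.

Lemma LISPP_hull_laplace g : LISPP hull g -> exists w : 'I_k -> R,
  [/\ forall i, 0 <= w i, \sum_(i < k) w i = 1 &
    forall (t : {nonneg R}) l, 0 <= l -> \int[marginal t g]_x exp_neg l x =
      expR (t%:num * (\sum_(i < k) w i * laplace i l - 1))].
Proof.
move=> /LISPP_marginal[mu hmu gE]; have mu0 := hull_ge0 hmu.
have [w [w0 w1 muE]] := hmu; exists w; split => // t l l0.
rewrite /Rintegral (eq_measure_integral (compound_poisson t%:num mu)); last first.
  by move=> A mA _; exact: gE.
rewrite -[LHS]/(\int[compound_poisson t%:num mu]_x exp_neg l x).
rewrite (compound_poisson_laplace mu0)//; congr (expR (_ * (_ - 1))).
apply: hull_integral => //; first exact: measurable_exp_neg.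
by move=> x; exact: exp_neg_itv01.
Qed.

Lemma LISPP_hull_ge0 g : LISPP hull g -> forall t,
  marginal t g (~` `[0, +oo[%classic) = 0%E.
Proof.
move=> /LISPP_marginal[mu /hull_ge0 mu0 gE] t.
by rewrite gE; [exact: compound_poisson_ge0|exact: measurableC].
Qed.

(** Laplace transforms at integers already determine a marginal. So countably many values at time 1
    certify membership, as a measurable description of the family requires. *)
Lemma LISPP_hull_criterion (g : levy_law R) (w : 'I_k -> R) :
  marginal 1%:nng g (~` `[0, +oo[%classic) = 0%E ->
  (forall i, 0 <= w i) -> \sum_(i < k) w i = 1 ->
  (forall n : nat, \int[marginal 1%:nng g]_x exp_neg n%:R x =
    expR (\sum_(i < k) w i * laplace i n%:R - 1)) ->
  LISPP hull g.
Proof.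
move=> g0 w0 w1 gE.
have m1 : hull_measure w0 setT = 1%E.
  rewrite hull_measureE.
  under eq_bigr => i _ do rewrite (@probability_setT _ _ _ (nu i : probability R R)) mule1.
  by rewrite sumEFin w1.
pose mu : pprobability R R := prob_of_measure m1.
have muE U : measurable U -> mu U = (\sum_(i < k) (w i)%:E * nu i U)%E.
  by move=> mU; rewrite -hull_measureE.
have hmu : hull mu by exists w.
apply/LISPP_compound_poissonP; exists mu => // A mA.
apply: (eq_from_laplace (m1 := marginal 1%:nng g) (m2 := compound_poisson 1 mu)) => //.
- by apply: compound_poisson_ge0; [exact: hull_ge0|exact: ler01].
- move=> n; rewrite gE (compound_poisson_laplace (hull_ge0 hmu))// mul1r.
  congr (expR (_ - 1)); apply: esym; apply: hull_integral => //.
    exact: measurable_exp_neg.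
  by move=> x; exact: exp_neg_itv01.
Qed.

Lemma measurable_marginal_eq t B (c : \bar R) : measurable B ->
  measurable [set g : levy_space R | marginal t g B = c].
Proof.
move=> mB.
by have := measurable_marginal_eval t mB measurableT (emeasurable_set1 c); rewrite setTI.
Qed.

Lemma measurable_marginal_Rintegral t (f : R -> R) : measurable_fun setT f ->
  (forall x, 0 <= f x <= 1) ->
  measurable_fun setT (fun g : levy_space R => \int[marginal t g]_x f x).
Proof.
move=> mf f01.
apply: (@measurable_Rintegral_kernel R _ (levy_space R) _ R
  (fun g => marginal t g : subprobability R R)) => //.
by move=> B mB; exact: measurable_marginal_eval.
Qed.

Definition laplace1 (n : nat) (g : levy_space R) : R :=
  \int[marginal 1%:nng g]_x exp_neg n%:R x.

(** After a logarithm the weights enter linearly, so membership becomes the solvability of a system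
    with one equation for each integer parameter; the equation of parameter 0 says that the weights
    have sum 1. *)
Lemma measurable_LISPP_hull : measurable (LISPP hull).
Proof.
pose X := laplace1.
have mX n : measurable_fun setT (X n).
  apply: measurable_marginal_Rintegral; first exact: measurable_exp_neg.
  by move=> x; exact: exp_neg_itv01.
pose y n (g : levy_space R) : R := ln (X n g) + 1.
have my n : measurable_fun setT (y n).
  by apply: measurable_funD => //; apply: measurableT_comp => //; exact: measurable_ln.
pose c (n : nat) i : R := laplace i n%:R.
(* [ln] inverts [expR] only on positive numbers, so positivity of the transforms is a separate
   condition. *)
rewrite (_ : LISPP hull = [set g | marginal 1%:nng g (~` `[0, +oo[%classic) = 0%E] `&`
    \bigcap_n [set g | 0 < X n g] `&`
    [set g | exists w : 'I_k -> R, (forall i, 0 <= w i) /\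
      forall n, \sum_(i < k) c n i * w i = y n g]); last first.
  apply/seteqP; split => g /=.
    move=> Lg; have [w [w0 w1 wE]] := LISPP_hull_laplace Lg.
    have XE n : X n g = expR (\sum_(i < k) w i * laplace i n%:R - 1).
      by rewrite /X /laplace1 wE//= mul1r.
    split; [split|].
    - exact: LISPP_hull_ge0.
    - by move=> n _ /=; rewrite XE expR_gt0.
    - exists w; split => // n; rewrite /y XE expRK subrK.
      by apply: eq_bigr => i _; rewrite mulrC.
  move=> [[g0 X0] [w [w0 wE]]].
  apply: (LISPP_hull_criterion g0 w0).
    have := wE 0%N; rewrite /y (_ : X 0%N g = 1) ?ln1 ?add0r.
      by under eq_bigr do rewrite /c laplace_0 mul1r.
    rewrite /X /laplace1 -[RHS](Rintegral_prob_cst (marginal 1%:nng g : probability R R) 1).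
    by apply: eq_Rintegral => x _; rewrite /exp_neg oppr0 mul0r expR0.
  move=> n; rewrite -[LHS](lnK (X0 n I)) -/(X n g).
  have := wE n; rewrite /y => /(congr1 (fun z => z - 1)); rewrite addrK => <-.
  by congr (expR (_ - 1)); apply: eq_bigr => i _; rewrite mulrC.
apply: measurableI; first apply: measurableI.
- by apply: measurable_marginal_eq; exact: measurableC.
- apply: bigcapT_measurable => n.
  rewrite (_ : [set g | _] = X n @^-1` `]0, +oo[%classic).
    by rewrite -[X in measurable X]setTI; exact: mX.
  by apply/seteqP; split => g /=; rewrite in_itv/= andbT.
- apply: measurable_linear_system => //.
  + by move=> n i; have /andP[p q] := laplace01 i (ler0n R n); rewrite ger0_norm.
  + by move=> i; exact: laplace_0.
  + move=> g; rewrite /y (_ : X 0%N g = 1) ?ln1 ?add0r//.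
    rewrite /X /laplace1 -[RHS](Rintegral_prob_cst (marginal 1%:nng g : probability R R) 1).
    by apply: eq_Rintegral => x _; rewrite /exp_neg oppr0 mul0r expR0.
Qed.

End hull.

(** * Laplace transforms as power series and their zeros *)

Section power_series.
Context {R : realType}.

Lemma poly_roots_seq (F : fieldType) (p : {poly F}) : p != 0 ->
  exists rs : seq F, forall x, root p x -> x \in rs.
Proof.
have [n] := ubnP (size p); elim: n p => // n ih p sp p0.
have [[a ra]|nr] := pselect (exists a, root p a); last first.
  by exists [::] => x rx; exfalso; apply: nr; exists x.
have /factor_theorem[q pq] := ra.
have q0 : q != 0 by apply: contraNneq p0 => q0; rewrite pq q0 mul0r.
have [|rs H] := ih q _ q0.
  by move: sp; rewrite pq size_mul ?polyXsubC_eq0// size_XsubC addn2 /= ltnS.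
exists (a :: rs) => x; rewrite pq rootM root_XsubC inE => /orP[/H ->|->//].
by rewrite orbT.
Qed.

(* A power series in [s = N - l], with Cauchy bounds on the coefficients. *)
Definition analytic_at (h : R -> R) (N : R) (a : nat -> R) (C : R) :=
  (forall k, `|a k| * N ^+ k <= C) /\
  (forall s, `|s| < N -> (fun n => \sum_(0 <= k < n) a k * s ^+ k) @ \oo --> h (N - s)).

(** The first nonzero coefficient dominates the tail, which the Cauchy bounds make geometric. One
    side of the centre is enough: the purpose is to find a point where finitely many such functions
    are all nonzero. *)
Lemma analytic_isolated_zeros h N a C : 0 < N -> analytic_at h N a C ->
  (forall s, `|s| < N -> h (N - s) = 0) \/
  (exists2 dl, 0 < dl & forall s, 0 < s < dl -> h (N - s) != 0).
Proof.
move=> N0 [aC hE].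
have [a0|/existsNP[k0 ak0]] := pselect (forall k, a k = 0).
  left=> s sN; apply: (cvg_unique (@Rhausdorff R) (hE s sN)).
  rewrite (_ : (fun n => _) = cst 0); first exact: cvg_cst.
  by apply/funext => n; rewrite big1// => k _; rewrite a0 mul0r.
right; have ex : exists k, a k != 0 by exists k0; exact/eqP.
case: (ex_minnP ex) => k ak kmin.
have C0 : 0 <= C by apply: le_trans (aC 0%N); rewrite mulr_ge0// exprn_ge0// ltW.
have akp : 0 < `|a k| by rewrite normr_gt0.
have Nk j : 0 < N ^+ j by rewrite exprn_gt0.
(* The bound N / 2 gives the tail the ratio 1/2, hence a sum of at most twice its first term; the
   other bound keeps that below the leading term. [C + 1] avoids a zero denominator. *)
pose dl := Num.min (N / 2) (`|a k| * N ^+ k.+1 / (2 * (C + 1))).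
have C1 : 0 < C + 1 by rewrite ltr_wpDl.
exists dl; first by rewrite lt_min !divr_gt0 ?mulr_gt0.
move=> s /andP[s0]; rewrite lt_min => /andP[sN sa].
have sN' : `|s| < N by rewrite gtr0_norm//; lra.
apply/eqP => h0; have := hE s sN'; rewrite h0 => cv.
have q0 : 0 < s / N by rewrite divr_gt0.
have q2 : s / N <= 2^-1 by rewrite ler_pdivrMr// mulrC; move: (ltW sN); rewrite mulrC; lra.
have tail M : `|\sum_(0 <= j < k.+1 + M) a j * s ^+ j| >=
    `|a k| * s ^+ k - 2 * C * (s / N) ^+ k.+1.
  rewrite (big_cat_nat (leq0n k.+1) (leq_addr M k.+1))/= big_nat_recr//=.
  rewrite [X in X + _ + _](_ : _ = 0) ?add0r; last first.
    rewrite big_nat big1// => j /andP[_ jk].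
    have [->|/kmin] := eqVneq (a j) 0; first by rewrite mul0r.
    by rewrite leqNgt jk.
  have T : `|\sum_(k.+1 <= j < k.+1 + M) a j * s ^+ j| <= 2 * C * (s / N) ^+ k.+1.
    apply: (@le_trans _ _ (\sum_(k.+1 <= j < k.+1 + M) C * (s / N) ^+ j)).
      rewrite (le_trans (ler_norm_sum _ _ _))//; apply: ler_sum => j _.
      rewrite normrM (ger0_norm (exprn_ge0 _ (ltW s0))) expr_div_n mulrA.
      rewrite ler_pdivlMr// -mulrA [_ ^+ _ * _]mulrC mulrA ler_wpM2r ?exprn_ge0// ltW//.
    have G m : \sum_(k.+1 <= j < k.+1 + m) C * (s / N) ^+ j <=
        2 * C * (s / N) ^+ k.+1 * (1 - 2^-1 ^+ m).
      elim: m => [|m ihm]; first by rewrite addn0 big_geq// expr0 subrr mulr0.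
      rewrite addnS big_nat_recr ?leq_addr//=.
      have e1 : C * (s / N) ^+ (k.+1 + m) <= C * (s / N) ^+ k.+1 * 2^-1 ^+ m.
        rewrite exprD mulrA; apply: ler_wpM2l; first by rewrite mulr_ge0 ?exprn_ge0 ?(ltW q0).
        by rewrite lerXn2r ?nnegrE ?invr_ge0 ?(ltW q0).
      apply: le_trans (lerD ihm e1) _.
      rewrite le_eqVlt; apply/orP; left; apply/eqP; rewrite (exprS _ m) -!(mulrA 2).
      by move: (C * _) (2^-1 ^+ m) => Q P; field.
    apply: le_trans (G M) _; rewrite ger_pMr ?mulr_gt0 ?exprn_gt0//.
    move: C0; rewrite le_eqVlt => /orP[/eqP C0|//].
    by exfalso; have := aC k; rewrite -C0 leNgt mulr_gt0.
  have := lerB_normD (a k * s ^+ k) (\sum_(k.+1 <= j < k.+1 + M) a j * s ^+ j).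
  rewrite normrM (ger0_norm (exprn_ge0 _ (ltW s0))); apply: le_trans.
  by rewrite lerD2l lerN2.
have pos : 0 < `|a k| * s ^+ k - 2 * C * (s / N) ^+ k.+1.
  rewrite subr_gt0 expr_div_n mulrA ltr_pdivrMr// (exprS s).
  have H : 2 * C * s < `|a k| * N ^+ k.+1.
    apply: (@le_lt_trans _ _ (2 * (C + 1) * s)).
      by rewrite ler_pM2r// ler_pM2l// lerDl.
    by move: sa; rewrite ltr_pdivlMr ?mulr_gt0// mulrC.
  by rewrite mulrA [ltRHS]mulrAC ltr_pM2r ?exprn_gt0.
have cn : (fun n => `|\sum_(0 <= j < n) a j * s ^+ j|) @ \oo --> `|0 : R| by exact: cvg_norm.
have : `|a k| * s ^+ k - 2 * C * (s / N) ^+ k.+1 <= `|0 : R|.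
  rewrite -(cvg_lim (@Rhausdorff R) cn); apply: limr_ge; first exact: cvgP cn.
  exists k.+1 => // n /= kn; rewrite -(subnKC kn); exact: tail.
by rewrite normr0 leNgt pos.
Qed.

Lemma analytic_lin h1 h2 N a1 a2 C1 C2 (u v : R) :
  analytic_at h1 N a1 C1 -> analytic_at h2 N a2 C2 -> 0 <= N ->
  analytic_at (fun l => u * h1 l + v * h2 l) N (fun k => u * a1 k + v * a2 k)
    (`|u| * C1 + `|v| * C2).
Proof.
move=> [A1 E1] [A2 E2] N0; split => [k|s sN].
  apply: (@le_trans _ _ ((`|u| * `|a1 k| + `|v| * `|a2 k|) * N ^+ k)).
    by rewrite ler_wpM2r ?exprn_ge0// -!normrM ler_normD.
  by rewrite mulrDl -!mulrA; apply: lerD; rewrite ler_wpM2l.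
rewrite (_ : (fun n => _) = (fun n => u * (\sum_(0 <= k < n) a1 k * s ^+ k) +
    v * (\sum_(0 <= k < n) a2 k * s ^+ k))); last first.
  apply/funext => n; rewrite !big_distrr -big_split/=; apply: eq_bigr => k _.
  by rewrite mulrDl !mulrA.
by apply: cvgD; (apply: cvgM; first exact: cvg_cst); [exact: E1|exact: E2].
Qed.

(** Expansion of the first factor in exp (- (N - s) x) = exp (s x) exp (- N x). The centre is
    positive because at 0 the moments of [nu] may be infinite; (N x)^k / k! <= exp (N x) gives the
    Cauchy bound 1. *)
Lemma laplace_analytic (nu : probability R R) N : 0 < N ->
  analytic_at (fun l => \int[nu]_x exp_neg l x) N
    (fun k => \int[nu]_x (Num.max x 0 ^+ k / k`!%:R * exp_neg N x)) 1.
Proof.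
move=> N0; pose y (x : R) := Num.max x 0.
have y0 x : 0 <= y x by rewrite /y le_max lexx orbT.
have my : measurable_fun setT y by exact: measurable_maxr.
have mf k : measurable_fun setT (fun x => y x ^+ k / k`!%:R * exp_neg N x).
  apply: measurable_funM; last exact: measurable_exp_neg.
  by apply: measurable_funM => //; exact: measurable_funX.
have term (u : R) k : 0 <= u -> u ^+ k / k`!%:R <= expR u.
  move=> u0; have c := is_cvg_series_exp_coeff u.
  have ge n : series (exp_coeff u) n <= expR u.
    apply: nondecreasing_cvgn_le => //; apply/nondecreasing_seqP => m.
    by rewrite seriesS lerDr /exp_coeff/= divr_ge0// exprn_ge0.
  apply: le_trans (ge k.+1); rewrite seriesS /series/= lerDl.
  by apply: sumr_ge0 => j _; rewrite /exp_coeff/= divr_ge0// exprn_ge0.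
have b1 k x : 0 <= N ^+ k * (y x ^+ k / k`!%:R * exp_neg N x) <= 1.
  apply/andP; split.
    by rewrite !mulr_ge0 ?exprn_ge0 ?invr_ge0 ?expR_ge0// ltW.
  have := term (N * y x) k (mulr_ge0 (ltW N0) (y0 x)).
  have -> : N ^+ k * (y x ^+ k / k`!%:R * exp_neg N x) =
      (N * y x) ^+ k / k`!%:R * expR (- (N * y x)).
    by rewrite exprMn /exp_neg mulNr -/(y x); ring.
  by rewrite -(expRxMexpNx_1 (N * y x)) ler_pM2r ?expR_gt0.
have bf k x : `|y x ^+ k / k`!%:R * exp_neg N x| <= (N ^+ k)^-1.
  have /andP[p q] := b1 k x.
  rewrite ger0_norm ?mulr_ge0 ?exprn_ge0 ?invr_ge0 ?expR_ge0//.
  by rewrite -[leRHS]mul1r ler_pdivlMr ?exprn_gt0// mulrC.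
split => [k|s sN].
  have Nk : 0 < N ^+ k by rewrite exprn_gt0.
  rewrite -(ger0_norm (ltW Nk)) -normrM mulrC.
  rewrite -(Rintegral_scale nu (N ^+ k) (mf k) (bf k)).
  apply: normr_Rintegral_le1; first exact: measurable_funM.
  by apply: itv01_norm => x; exact: b1.
pose fn n x := \sum_(0 <= k < n) s ^+ k * (y x ^+ k / k`!%:R * exp_neg N x).
have mfn n : measurable_fun setT (fn n).
  by apply: measurable_sum => k; apply: measurable_funM.
have fnE n x : fn n x = series (exp_coeff (s * y x)) n * exp_neg N x.
  rewrite /fn /series/= big_distrl/=; apply: eq_bigr => k _.
  by rewrite /exp_coeff/= exprMn; ring.
have fn1 n x : `|fn n x| <= 1.
  rewrite fnE normrM (ger0_norm (expR_ge0 _)).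
  have : `|series (exp_coeff (s * y x)) n| <= expR (`|s| * y x).
    apply: (@le_trans _ _ (series (exp_coeff (`|s| * y x)) n)).
      rewrite /series/= (le_trans (ler_norm_sum _ _ _))//; apply: ler_sum => k _.
      rewrite /exp_coeff/= normrM normrX normrM (ger0_norm (y0 x)) (ger0_norm (_ : 0 <= _^-1))//.
    apply: nondecreasing_cvgn_le; last exact: is_cvg_series_exp_coeff.
    apply/nondecreasing_seqP => m.
    by rewrite seriesS lerDr /exp_coeff/= divr_ge0// exprn_ge0// mulr_ge0.
  rewrite -(ler_pM2r (expR_gt0 (- N * y x))) -expRD => /le_trans; apply.
  rewrite -[leRHS]expR0 ler_expR -mulrDl mulr_le0_ge0//.
  by rewrite subr_le0 ltW.
rewrite (_ : (fun n => _) = (fun n => \int[nu]_x fn n x)); last first.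
  apply/funext => n; rewrite /fn (@Rintegral_sum _ _ _ nu _ _ _ (fun k => `|s ^+ k| * (N ^+ k)^-1)).
  - by apply: eq_bigr => k _; rewrite (Rintegral_scale nu (s ^+ k) (mf k) (bf k)) mulrC.
  - by move=> k; apply: measurable_funM.
  - by move=> k x; rewrite normrM ler_wpM2l.
apply: (Rintegral_bounded_cvg (m := nu) (C := 1)) => // x.
have -> : exp_neg (N - s) x = expR (s * y x) * exp_neg N x.
  by rewrite /exp_neg -expRD; congr expR; rewrite -/(y x); ring.
rewrite (_ : fn ^~ x = fun n => series (exp_coeff (s * y x)) n * exp_neg N x); last first.
  by apply/funext => n; rewrite fnE.
by apply: cvgM; [exact: is_cvg_series_exp_coeff|exact: cvg_cst].
Qed.

End power_series.

Section cramer.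
Context {K : fieldType} (f0 f1 g0 g1 : K).
Hypothesis det0 : f0 * g1 - f1 * g0 != 0.

Lemma cramer2 (u v : K) :
  ((u * f0 + v * g0) * g1 - (u * f1 + v * g1) * g0) / (f0 * g1 - f1 * g0) = u /\
  (f0 * (u * f1 + v * g1) - f1 * (u * f0 + v * g0)) / (f0 * g1 - f1 * g0) = v.
Proof. by split; apply: (mulIf det0); rewrite divfK//; ring. Qed.

Lemma cramer2_0 (u v : K) : u * f0 + v * g0 = 0 -> u * f1 + v * g1 = 0 -> u = 0 /\ v = 0.
Proof.
move=> e0 e1; have [EU EV] := cramer2 u v; split.
  by rewrite -[LHS]EU e0 e1 !mul0r subrr mul0r.
by rewrite -[LHS]EV e0 e1 !mulr0 subrr mul0r.
Qed.

End cramer.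

Section equality_in_law.
Context {R : realType}.

Lemma eq_law_integral d1 d2 (T1 : measurableType d1) (T2 : measurableType d2)
    (m1 : probability T1 R) (m2 : probability T2 R) (Z1 : T1 -> R) (Z2 : T2 -> R)
    (C D : R) (Phi : R -> R) :
  measurable_fun setT Z1 -> measurable_fun setT Z2 ->
  (forall x, `|Z1 x| <= C) -> (forall x, `|Z2 x| <= C) ->
  (forall n, \int[m1]_x Z1 x ^+ n = \int[m2]_x Z2 x ^+ n) ->
  measurable_fun setT Phi -> (forall z, `|Phi z| <= D) ->
  \int[m1]_x Phi (Z1 x) = \int[m2]_x Phi (Z2 x).
Proof.
move=> mZ1 mZ2 Z1C Z2C ZE mP PD.
have lawE := eq_from_moments mZ1 mZ2 Z1C Z2C ZE.
have W (g : R -> R) : measurable_fun setT g -> (forall z, 0 <= g z <= 1) ->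
    \int[m1]_x g (Z1 x) = \int[m2]_x g (Z2 x).
  move=> mg g01.
  rewrite -(Rintegral_giry_map (m1 : giry T1 R) mZ1 mg g01).
  rewrite -(Rintegral_giry_map (m2 : giry T2 R) mZ2 mg g01).
  by congr fine; apply: eq_measure_integral => A mA _; exact: lawE.
have D0 : 0 <= D by rewrite (le_trans _ (PD 0)).
have D1 : 0 < 2 * (D + 1) by rewrite mulr_gt0// ltr_wpDl.
pose g z := (2 * (D + 1))^-1 * Phi z + 2^-1 * 1.
have mg : measurable_fun setT g.
  by apply: measurable_funD => //; apply: measurable_funM.
have g01 z : 0 <= g z <= 1.
  have /ler_normlP[h1 h2] := PD z.
  have : `|(2 * (D + 1))^-1 * Phi z| <= 2^-1.
    have Di : 0 <= (2 * (D + 1))^-1 by rewrite invr_ge0 ltW.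
    rewrite normrM (ger0_norm Di) mulrC ler_pdivrMr// mulrA mulVf ?pnatr_eq0// mul1r.
    by rewrite (le_trans (PD z))// lerDl.
  by rewrite ler_norml /g mulr1 => /andP[a b]; lra.
have S d (T : measurableType d) (m : probability T R) (Z : T -> R) :
    measurable_fun setT Z ->
    \int[m]_x Phi (Z x) = 2 * (D + 1) * \int[m]_x g (Z x) + (- (D + 1)) * \int[m]_x 1.
  move=> mZ; have mgZ : measurable_fun setT (g \o Z) by exact: measurableT_comp.
  have bg x : `|(g \o Z) x| <= 1 by exact: (itv01_norm g01 (Z x)).
  have b1 (x : T) : `|cst 1 x : R| <= 1 by rewrite normr1.
  rewrite -(Rintegral_lin2 m _ _ mgZ (measurable_cst (1 : R)) bg b1).
  by apply: eq_Rintegral => x _; rewrite /g /=; field; lra.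
by rewrite (S _ _ m1)// (S _ _ m2)// (W g)// !Rintegral_prob_cst.
Qed.

End equality_in_law.

(** * Recovering the joint law of the weights in a triangle *)

Section good_triangle.
Context {R : realType} (nu : 'I_3 -> pprobability R R).
Hypothesis nu_ge0 : forall i, nu i (~` `[0, +oo[%classic) = 0%E.

Let Lp := laplace nu.
Let o0 : 'I_3 := ord0.
Let o1 : 'I_3 := lift ord0 ord0.
Let o2 : 'I_3 := lift ord0 (lift ord0 ord0).
Let F l := Lp o0 l - Lp o2 l.
Let G l := Lp o1 l - Lp o2 l.
Let hullL : set (levy_space R) := LISPP (hull nu).

Let sum3 (w : 'I_3 -> R) : \sum_(i < 3) w i = w o0 + (w o1 + w o2).
Proof. by rewrite !big_ord_recl big_ord0 addr0. Qed.

Let FG1 l : 0 <= l -> `|F l| <= 1 /\ `|G l| <= 1.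
Proof.
move=> l0; have a := laplace01 nu o0 l0; have b := laplace01 nu o1 l0.
have c := laplace01 nu o2 l0.
by rewrite /F /G /Lp !ler_norml; split; lra.
Qed.

Let hull_weights g : hullL g -> exists u v : R, [/\ 0 <= u <= 1, 0 <= v <= 1 &
  forall (t : {nonneg R}) l, 0 <= l -> \int[marginal t g]_x exp_neg l x =
    expR (t%:num * (Lp o2 l - 1 + (u * F l + v * G l)))].
Proof.
move=> Lg; have [w [w0 w1 wE]] := LISPP_hull_laplace nu_ge0 Lg.
exists (w o0), (w o1); have := w0 o0; have := w0 o1; have := w0 o2; rewrite sum3 in w1.
move=> h2 h1 h0; split; [lra|lra|].
move=> t l l0; rewrite wE// sum3 /F /G /Lp; congr (expR (_ * _)).
have -> : w o2 = 1 - (w o0 + w o1) by rewrite -w1; ring.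
ring.
Qed.

Let X l (g : levy_space R) := \int[marginal (NngNum ler01 : {nonneg R}) g]_x exp_neg l x.
Let mX l : 0 <= l -> measurable_fun setT (X l).
Proof.
move=> l0; apply: measurable_marginal_Rintegral; first exact: measurable_exp_neg.
by move=> x; exact: exp_neg_itv01.
Qed.
Let X01 l g : 0 <= l -> 0 <= X l g <= 1.
Proof.
move=> l0; apply: (Rintegral_itv01 (marginal _ g : probability R R)).
  exact: measurable_exp_neg.
by move=> x; exact: exp_neg_itv01.
Qed.

(** Outside the family, a null set, the logarithms of transforms are uncontrolled; clamping bounds
    the integrands everywhere and changes nothing on the family. *)
Let clamp (C x : R) : R := Num.max (- C) (Num.min C x).
Let clampE C x : `|x| <= C -> clamp C x = x.
Proof. by rewrite ler_norml => /andP[h1 h2]; rewrite /clamp min_r// max_r. Qed.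
Let clamp_le C x : 0 <= C -> `|clamp C x| <= C.
Proof.
move=> C0; rewrite ler_norml /clamp le_max lexx/= ge_max ge_min lexx/= andbT.
by rewrite ge0_cp// oppr_le0.
Qed.
Let mclamp C : measurable_fun setT (clamp C).
Proof.
by apply: measurable_maxr => //; apply: measurable_minr.
Qed.

Section two_mixtures.
Variables Theta1 Theta2 : probability (levy_space R) R.
Hypotheses (T1 : Theta1 hullL = 1%E) (T2 : Theta2 hullL = 1%E).
Hypothesis TE : forall t B, measurable B ->
  \int[Theta1]_g fine (marginal t g B) = \int[Theta2]_g fine (marginal t g B).

Let mhullL : measurable hullL. Proof. exact: measurable_LISPP_hull. Qed.

Let aeL (Theta : probability (levy_space R) R) : Theta hullL = 1%E ->
  {ae Theta, forall g, hullL g}.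
Proof.
move=> TL; exists (~` hullL); split => //; first exact: measurableC.
by rewrite probability_setC// TL subee.
Qed.

Let eq_marginal_integral t (f : R -> R) : measurable_fun setT f ->
  (forall x, 0 <= f x <= 1) ->
  \int[Theta1]_g \int[marginal t g]_x f x = \int[Theta2]_g \int[marginal t g]_x f x.
Proof.
move=> mf f01.
have K (Theta : probability (levy_space R) R) := weighted_kernel
  (k := fun g : levy_space R => marginal t g : subprobability R R)
  (fun B mB => measurable_marginal_eval t mB)
  (@measurable_cst _ _ (levy_space R) R setT 1) (fun=> (introT andP (conj ler01 (lexx 1)))) Theta.
have [m1 [m1B m1f]] := K Theta1; have [m2 [m2B m2f]] := K Theta2.
have mE B : measurable B -> m1 B = m2 B.
  move=> mB; rewrite m1B// m2B//.
  have E (Theta : probability (levy_space R) R) :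
      (\int[Theta]_g ((cst 1 g)%:E * marginal t g B) =
       (\int[Theta]_g fine (marginal t g B))%:E)%E.
    rewrite (@EFin_Rintegral _ _ _ Theta _ 1).
    - apply: eq_integral => g _.
      by rewrite mul1e fineK// (fin_num_measure (marginal t g : probability R R)).
    - by apply: measurableT_comp => //; exact: measurable_marginal_eval.
    - apply: itv01_norm => g.
      exact: (subprobability_fine_itv (marginal t g : subprobability R R)).
  by rewrite !E TE.
have E1 : \int[m1]_y f y = \int[Theta1]_g \int[marginal t g]_y f y.
  by rewrite m1f//; apply: eq_Rintegral => g _; rewrite /= mul1r.
have E2 : \int[m2]_y f y = \int[Theta2]_g \int[marginal t g]_y f y.
  by rewrite m2f//; apply: eq_Rintegral => g _; rewrite /= mul1r.
by rewrite -E1 -E2; congr fine; apply: eq_measure_integral => A mA _; exact: mE.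
Qed.

(** On the family the transform at time n is the n-th power of the one at time 1. Marginals at
    integer times thus give all moments of [X l], a variable in [0, 1], hence its law. *)
Let eq_moments_X l n : 0 <= l ->
  \int[Theta1]_g X l g ^+ n = \int[Theta2]_g X l g ^+ n.
Proof.
move=> l0; pose t : {nonneg R} := NngNum (ler0n R n).
have E (Theta : probability (levy_space R) R) : Theta hullL = 1%E ->
    \int[Theta]_g X l g ^+ n = \int[Theta]_g \int[marginal t g]_x exp_neg l x.
  move=> TL; apply: ae_eq_Rintegral.
  - by apply: measurable_funX; exact: mX.
  - apply: measurable_marginal_Rintegral; first exact: measurable_exp_neg.
    by move=> x; exact: exp_neg_itv01.
  - apply: filterS (aeL TL) => g Lg; have [u [v [_ _ wE]]] := hull_weights Lg.
    by rewrite /X !wE//= mul1r -expRM_natl.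
rewrite !E//; apply: eq_marginal_integral; first exact: measurable_exp_neg.
by move=> x; exact: exp_neg_itv01.
Qed.

Let eq_law_X l (Phi : R -> R) D : 0 <= l -> measurable_fun setT Phi ->
  (forall z, `|Phi z| <= D) ->
  \int[Theta1]_g Phi (X l g) = \int[Theta2]_g Phi (X l g).
Proof.
move=> l0 mP PD; apply: (eq_law_integral (C := 1) (D := D)) => //.
- exact: mX.
- exact: mX.
- by apply: itv01_norm => g; exact: X01.
- by apply: itv01_norm => g; exact: X01.
- by move=> n; exact: eq_moments_X.
Qed.

Variables (s : nat -> {nonneg R}) (n : nat) (j : nat -> nat).

Let al := \sum_(0 <= i < n) (s i)%:num * F (j i)%:R.
Let be := \sum_(0 <= i < n) (s i)%:num * G (j i)%:R.
Let ga := \sum_(0 <= i < n) (s i)%:num * (Lp o2 (j i)%:R - 1).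

Let integrand (g : levy_space R) :=
  \prod_(0 <= i < n) \int[marginal (s i) g]_x exp_neg (j i)%:R x.

Let mintegrand : measurable_fun setT integrand.
Proof.
apply: measurable_prod => i _; apply: measurable_marginal_Rintegral.
  exact: measurable_exp_neg.
by move=> x; exact: exp_neg_itv01.
Qed.

Let integrand01 g : 0 <= integrand g <= 1.
Proof.
apply: prod_itv01 => i; apply: (Rintegral_itv01 (marginal (s i) g : probability R R)).
  exact: measurable_exp_neg.
by move=> x; exact: exp_neg_itv01.
Qed.

Let integrandE g u v :
  (forall (t : {nonneg R}) l, 0 <= l -> \int[marginal t g]_x exp_neg l x =
    expR (t%:num * (Lp o2 l - 1 + (u * F l + v * G l)))) ->
  integrand g = expR (ga + (al * u + be * v)).
Proof.
move=> wE; rewrite /integrand; under eq_bigr do rewrite wE//.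
rewrite -expR_sum; congr expR; rewrite /ga /al /be !big_distrl/= -!big_split/=.
by apply: eq_bigr => i _; ring.
Qed.

(* In the dependent case the law of a single [X l] determines everything. *)
Let eq_dependent l0 (c : R -> R) : 0 <= l0 ->
  (forall l, 0 <= l -> F l = c l * F l0 /\ G l = c l * G l0) ->
  \int[Theta1]_g integrand g = \int[Theta2]_g integrand g.
Proof.
move=> l00 cE; pose ka := \sum_(0 <= i < n) (s i)%:num * c (j i)%:R.
have alE : al = ka * F l0.
  by rewrite /al /ka big_distrl/=; apply: eq_bigr => i _; rewrite (cE _ (ler0n _ _)).1 mulrA.
have beE : be = ka * G l0.
  by rewrite /be /ka big_distrl/=; apply: eq_bigr => i _; rewrite (cE _ (ler0n _ _)).2 mulrA.
pose Phi (x : R) := clamp 1 (expR (ga + ka * (ln x + 1 - Lp o2 l0))).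
have mP : measurable_fun setT Phi.
  apply: measurableT_comp; first exact: mclamp.
  apply: measurableT_comp => //; apply: measurable_funD => //; apply: measurable_funM => //.
  apply: measurable_funB => //; apply: measurable_funD => //; exact: measurable_ln.
have E (Theta : probability (levy_space R) R) : Theta hullL = 1%E ->
    \int[Theta]_g integrand g = \int[Theta]_g Phi (X l0 g).
  move=> TL; apply: ae_eq_Rintegral => //.
    by apply: measurableT_comp => //; exact: mX.
  apply: filterS (aeL TL) => g Lg; have [u [v [_ _ wE]]] := hull_weights Lg.
  have := integrand01 g; rewrite (integrandE wE) => /andP[i0 i1].
  rewrite /Phi /X wE// expRK /= mul1r (_ : ka * _ = al * u + be * v).
    by rewrite clampE// ger0_norm.
  by rewrite alE beE; ring.
by rewrite !E//; apply: (eq_law_X (D := 1)) => // z; exact: clamp_le.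
Qed.

Section independent.
Variables l0 l1 : R.
Hypotheses (l0_ge0 : 0 <= l0) (l1_ge0 : 0 <= l1).
Let det := F l0 * G l1 - F l1 * G l0.
Hypothesis det0 : det != 0.

Let Nl l (g : levy_space R) := ln (X l g) + 1 - Lp o2 l.
Let mNl l : 0 <= l -> measurable_fun setT (Nl l).
Proof.
move=> l_ge0; apply: measurable_funB => //; apply: measurable_funD => //.
by apply: (measurableT_comp (@measurable_ln R)); exact: mX.
Qed.

Let clamp01 (x : R) : R := Num.max 0 (Num.min 1 x).
Let clamp01_itv x : 0 <= clamp01 x <= 1.
Proof. by rewrite /clamp01 le_max lexx/= ge_max ler01/= ge_min lexx. Qed.
Let clamp01E x : 0 <= x <= 1 -> clamp01 x = x.
Proof. by move=> /andP[h1 h2]; rewrite /clamp01 min_r// max_r. Qed.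
Let mclamp01 : measurable_fun setT clamp01.
Proof. by apply: measurable_maxr => //; apply: measurable_minr. Qed.

(** The weights, recovered by Cramer's rule from the Laplace exponents at two parameters; this makes
    them measurable functions of the Levy law. *)
Let U g := clamp01 ((Nl l0 g * G l1 - Nl l1 g * G l0) / det).
Let V g := clamp01 ((F l0 * Nl l1 g - F l1 * Nl l0 g) / det).

Let mU : measurable_fun setT U.
Proof.
apply: measurableT_comp => //; apply: measurable_funM => //.
by apply: measurable_funB; apply: measurable_funM => //; exact: mNl.
Qed.
Let mV : measurable_fun setT V.
Proof.
apply: measurableT_comp => //; apply: measurable_funM => //.
by apply: measurable_funB; apply: measurable_funM => //; exact: mNl.
Qed.

Let U01 g : 0 <= U g <= 1. Proof. exact: clamp01_itv. Qed.
Let V01 g : 0 <= V g <= 1. Proof. exact: clamp01_itv. Qed.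

Let UVE g u v : 0 <= u <= 1 -> 0 <= v <= 1 ->
  (forall (t : {nonneg R}) l, 0 <= l -> \int[marginal t g]_x exp_neg l x =
    expR (t%:num * (Lp o2 l - 1 + (u * F l + v * G l)))) ->
  [/\ U g = u, V g = v & forall l, 0 <= l -> Nl l g = u * F l + v * G l].
Proof.
move=> u01 v01 wE.
have NE l : 0 <= l -> Nl l g = u * F l + v * G l.
  by move=> l_ge0; rewrite /Nl /X wE// expRK /= mul1r; ring.
have [EU EV] := cramer2 det0 u v.
by split => //; rewrite /U /V !NE//; [rewrite EU|rewrite EV]; exact: clamp01E.
Qed.

Section moments.
Variable k : nat.

Let mom (Theta : probability (levy_space R) R) (i : nat) : R :=
  \int[Theta]_g (U g ^+ (k - i) * V g ^+ i).
Let q i := mom Theta1 i - mom Theta2 i.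

Let mUV i : measurable_fun setT (fun g => U g ^+ (k - i) * V g ^+ i).
Proof. by apply: measurable_funM; exact: measurable_funX. Qed.

Let UV1 i g : `|U g ^+ (k - i) * V g ^+ i| <= 1.
Proof.
have /andP[a b] := U01 g; have /andP[c d] := V01 g.
by rewrite ger0_norm ?mulr_ge0 ?exprn_ge0// mulr_ile1 ?exprn_ge0// exprn_ile1.
Qed.

Let expand (Theta : probability (levy_space R) R) (a b : R) :
  \int[Theta]_g (a * U g + b * V g) ^+ k =
  \sum_(i < k.+1) (a ^+ (k - i) * b ^+ i *+ 'C(k, i)) * mom Theta i.
Proof.
transitivity (\int[Theta]_g \sum_(i < k.+1) (a ^+ (k - i) * b ^+ i *+ 'C(k, i)) *
    (U g ^+ (k - i) * V g ^+ i)).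
  apply: eq_Rintegral => g _; rewrite exprDn; apply: eq_bigr => i _.
  by rewrite !exprMn mulrACA mulrnAl.
rewrite (@Rintegral_sum _ _ _ Theta _ _ _ (fun i : 'I_k.+1 => `|a ^+ (k - i) * b ^+ i *+ 'C(k, i)|)).
- by apply: eq_bigr => i _; rewrite (Rintegral_scale Theta _ (mUV i) (UV1 i)).
- by move=> i; apply: measurable_funM => //; exact: mUV.
- by move=> i g; rewrite normrM ler_piMr//; exact: UV1.
Qed.

Let Q (a b : R) := \sum_(i < k.+1) (a ^+ (k - i) * b ^+ i *+ 'C(k, i)) * q i.

Let QE a b : \int[Theta1]_g (a * U g + b * V g) ^+ k -
  \int[Theta2]_g (a * U g + b * V g) ^+ k = Q a b.
Proof. by rewrite !expand -sumrB; apply: eq_bigr => i _; rewrite -mulrBr. Qed.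

Let Q_FG l : 0 <= l -> Q (F l) (G l) = 0.
Proof.
move=> l_ge0; rewrite -QE.
pose Phi (x : R) := clamp 2 (ln x + 1 - Lp o2 l) ^+ k.
have mP : measurable_fun setT Phi.
  apply: measurable_funX; apply: measurableT_comp; first exact: mclamp.
  apply: measurable_funB => //; apply: measurable_funD => //; exact: measurable_ln.
have E (Theta : probability (levy_space R) R) : Theta hullL = 1%E ->
    \int[Theta]_g (F l * U g + G l * V g) ^+ k = \int[Theta]_g Phi (X l g).
  move=> TL; apply: ae_eq_Rintegral => //.
  - by apply: measurable_funX; apply: measurable_funD; apply: measurable_funM.
  - by apply: measurableT_comp => //; exact: mX.
  - apply: filterS (aeL TL) => g Lg; have [u [v [u01 v01 wE]]] := hull_weights Lg.
    have [-> -> NE] := UVE u01 v01 wE.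
    rewrite /Phi -/(Nl l g) NE// clampE; first by rewrite [F l * u]mulrC [G l * v]mulrC.
    have [f1 g1] := FG1 l_ge0; have /andP[a b] := u01; have /andP[c d] := v01.
    rewrite (le_trans (ler_normD _ _))// (_ : 2 = 1 + 1)// lerD//.
      by rewrite normrM mulr_ile1// ger0_norm.
    by rewrite normrM mulr_ile1// ger0_norm.
rewrite !E// (eq_law_X (D := 2 ^+ k)) ?subrr// => z.
by rewrite normrX lerXn2r ?nnegrE//; exact: clamp_le.
Qed.

Let analyticF : exists N a C b D,
  [/\ l0 < N /\ l1 < N, analytic_at F N a C & analytic_at G N b D].
Proof.
have N0 : 0 < l0 + l1 + 1 by rewrite ltr_wpDl// addr_ge0.
exists (l0 + l1 + 1).
have A i := laplace_analytic (nu i : probability R R) N0.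
have AF := analytic_lin 1 (-1) (A o0) (A o2) (ltW N0).
have AG := analytic_lin 1 (-1) (A o1) (A o2) (ltW N0).
have eF : (fun l => 1 * \int[nu o0]_x exp_neg l x + (-1) * \int[nu o2]_x exp_neg l x) = F.
  by apply/funext => l; rewrite mul1r mulN1r.
have eG : (fun l => 1 * \int[nu o1]_x exp_neg l x + (-1) * \int[nu o2]_x exp_neg l x) = G.
  by apply/funext => l; rewrite mul1r mulN1r.
rewrite eF in AF; rewrite eG in AG.
do 4 eexists; split; [|exact: AF|exact: AG].
by split; move: l0_ge0 l1_ge0; lra.
Qed.

Let not_proportional (N a b : R) : l0 < N -> l1 < N ->
  (forall s, `|s| < N -> a * F (N - s) + b * G (N - s) = 0) -> a = 0 /\ b = 0.
Proof.
move=> h0 h1 H.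
have pos l : 0 <= l -> l < N -> a * F l + b * G l = 0.
  (* The parameter 0 is the excluded edge [s = N] of the disc, but [F] and [G] vanish there. *)
  rewrite le_eqVlt => /orP[/eqP <- _|lpos lN].
    by rewrite /F /G /Lp !laplace_0 subrr !mulr0 addr0.
  have := H (N - l); rewrite subKr; apply.
  by rewrite ger0_norm ?subr_ge0 ?ltW// ltrBlDr ltrDl.
have e0 := pos _ l0_ge0 h0; have e1 := pos _ l1_ge0 h1.
exact: (cramer2_0 det0 e0 e1).
Qed.

(** [Q (F l) (G l)] is F^k p (G / F), so every ratio G / F is a root of [p]. For each of the
    finitely many roots r, the function G - r F has no zero just below [N], as [F] and [G] are not
    proportional; at a common such point where [F] is also nonzero the ratio is not a root. *)
Let q_eq0 (i : nat) : (i < k.+1)%N -> q i = 0.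
Proof.
pose p : {poly R} := \poly_(i < k.+1) (q i *+ 'C(k, i)).
have [p0|p0] := eqVneq p 0.
  move=> ik; have := congr1 (fun r : {poly R} => r`_i) p0.
  rewrite coef_poly ik coef0 => /eqP; rewrite mulrn_eq0 => /orP[|/eqP//].
  by rewrite -leqn0 leqNgt bin_gt0 -ltnS ik.
exfalso; have [rs rsP] := poly_roots_seq p0.
have [N [a [C [b [D [[h0 h1] AF AG]]]]]] := analyticF.
have N0 : 0 < N by exact: le_lt_trans h0.
have sep (al' be' : R) : (al', be') != (0, 0) -> exists2 dl, 0 < dl &
    forall s, 0 < s < dl -> al' * F (N - s) + be' * G (N - s) != 0.
  move=> ab; have [Z|//] := analytic_isolated_zeros N0 (analytic_lin al' be' AF AG (ltW N0)).
  by have [a0 b0] := not_proportional h0 h1 Z; rewrite a0 b0 eqxx in ab.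
have [|d0 d00 dF] := sep 1 0.
  by rewrite xpair_eqE oner_eq0.
have [d1 d10 dG] : exists2 dl, 0 < dl & forall s, 0 < s < dl ->
    forall r, r \in rs -> - r * F (N - s) + 1 * G (N - s) != 0.
  elim: rs {rsP} => [|r rs [d1 d10 H]]; first by exists 1.
  have [|d2 d20 H2] := sep (- r) 1; first by rewrite xpair_eqE oner_eq0 andbF.
  exists (Num.min d1 d2); first by rewrite lt_min d10.
  move=> s' /andP[s0]; rewrite lt_min => /andP[s1 s2] r'.
  rewrite inE => /orP[/eqP ->|]; first by apply: H2; rewrite s0.
  by apply: H; rewrite s0.
pose e := Num.min (Num.min d0 d1) N / 2.
have e0 : 0 < e by rewrite divr_gt0// !lt_min d00 d10.
have : e < Num.min (Num.min d0 d1) N.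
  by rewrite /e ltr_pdivrMr// ltr_pMr ?ltr1n// !lt_min d00 d10.
rewrite !lt_min => /andP[/andP[ed0 ed1] eN].
have Fe : F (N - e) != 0 by have := dF e; rewrite e0 ed0 mul1r mul0r addr0; apply.
have Ne : 0 <= N - e by rewrite subr_ge0 ltW.
have : root p (G (N - e) / F (N - e)).
  apply/rootP; rewrite horner_poly; apply: (mulIf (expf_neq0 k Fe)); rewrite mul0r.
  rewrite -[RHS](Q_FG Ne) /Q big_distrl/=; apply: eq_bigr => i' _.
  have ik : (i' <= k)%N by rewrite -ltnS.
  have Y0 := expf_neq0 i' Fe.
  have -> : F (N - e) ^+ k = F (N - e) ^+ (k - i') * F (N - e) ^+ i' by rewrite -exprD subnK.
  rewrite expr_div_n -(mulr_natr (q i')) -(mulr_natr (_ * _)).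
  move: Y0; move: (F (N - e) ^+ i') (F (N - e) ^+ (k - i')) (G (N - e) ^+ i') => Y A B Y0.
  by field.
move=> /rsP rin; have := dG e; rewrite e0 ed1 => /(_ isT _ rin).
by rewrite mul1r mulNr divfK// addNr eqxx.
Qed.

(** Equal mixed moments give equal moments of every linear combination; the one with coefficients
    [al] and [be] is the random part of the logarithm of [integrand]. *)
Lemma eq_moments_UV a b : \int[Theta1]_g (a * U g + b * V g) ^+ k =
  \int[Theta2]_g (a * U g + b * V g) ^+ k.
Proof.
apply/eqP; rewrite -subr_eq0 QE; apply/eqP; rewrite /Q big1// => i _.
by rewrite q_eq0 ?mulr0.
Qed.

End moments.

Lemma eq_laplace_independent : \int[Theta1]_g integrand g = \int[Theta2]_g integrand g.
Proof.
pose Z g := al * U g + be * V g.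
have mZ : measurable_fun setT Z by apply: measurable_funD; apply: measurable_funM.
have ZC g : `|Z g| <= `|al| + `|be|.
  rewrite (le_trans (ler_normD _ _))// !normrM lerD// ler_piMr//.
    by rewrite ger0_norm; case/andP: (U01 g).
  by rewrite ger0_norm; case/andP: (V01 g).
pose Phi (z : R) := clamp 1 (expR (ga + z)).
have mP : measurable_fun setT Phi.
  apply: measurableT_comp; first exact: mclamp.
  by apply: measurableT_comp => //; exact: measurable_funD.
have E (Theta : probability (levy_space R) R) : Theta hullL = 1%E ->
    \int[Theta]_g integrand g = \int[Theta]_g Phi (Z g).
  move=> TL; apply: ae_eq_Rintegral => //; first exact: measurableT_comp.
  apply: filterS (aeL TL) => g Lg; have [u [v [u01 v01 wE]]] := hull_weights Lg.
  have [Ug Vg _] := UVE u01 v01 wE.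
  have := integrand01 g; rewrite (integrandE wE) => /andP[i0 i1].
  by rewrite /Phi /Z Ug Vg clampE// ger0_norm.
rewrite !E//; apply: (eq_law_integral (C := `|al| + `|be|) (D := 1)) => //.
- by move=> k; exact: eq_moments_UV.
- by move=> z; exact: clamp_le.
Qed.

End independent.

Lemma eq_laplace_mixtures : \int[Theta1]_g integrand g = \int[Theta2]_g integrand g.
Proof.
have [[l0 [l1 [h0 h1 d0]]]|nd] := pselect (exists l0 l1,
    [/\ 0 <= l0, 0 <= l1 & F l0 * G l1 - F l1 * G l0 != 0]).
  exact: (eq_laplace_independent h0 h1 d0).
have D l l' : 0 <= l -> 0 <= l' -> F l * G l' = F l' * G l.
  move=> hl hl'; apply/eqP; rewrite -subr_eq0; apply/negPn/negP => d.
  by apply: nd; exists l, l'.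
(* All determinants vanish, so a parameter where [F] or [G] is nonzero serves as reference, and both
   functions are a common multiple of their values there. *)
have [[l0 [h0 f0]]|nf] := pselect (exists l, 0 <= l /\ F l != 0).
  apply: (eq_dependent (l0 := l0) (c := fun l => F l / F l0)) => // l hl.
  have e := divfK f0 (F l); split; first exact: esym e.
  by apply: (mulfI f0); rewrite mulrCA mulrA e; exact: D.
have F0 l : 0 <= l -> F l = 0.
  by move=> hl; apply/eqP/negPn/negP => f; apply: nf; exists l.
have [[l0 [h0 g0]]|ng] := pselect (exists l, 0 <= l /\ G l != 0).
  apply: (eq_dependent (l0 := l0) (c := fun l => G l / G l0)) => // l hl.
  by rewrite divfK// !F0// mulr0.
apply: (eq_dependent (l0 := 0) (c := fun=> 0)) => // l hl.
rewrite F0// !mul0r; split => //.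
by apply/eqP/negPn/negP => g; apply: ng; exists l.
Qed.

End two_mixtures.

Lemma good_hull3 : good (LISPP (hull nu)).
Proof.
apply: (good_criterion (K := `[0, +oo[%classic) (test := fun j => exp_neg j%:R) 0%N).
- exact: measurable_LISPP_hull.
- exact: measurable_itv.
- by move=> g Lg t; exact: LISPP_hull_ge0 Lg t.
- by move=> j; exact: measurable_exp_neg.
- by move=> j x; exact: exp_neg_itv01.
- by move=> m1 m2 h1 h2 E; apply: eq_from_laplace.
- by move=> Theta1 Theta2 T1 T2 TE s n j; exact: eq_laplace_mixtures.
Qed.

End good_triangle.

(** * Convex hulls as hulls of a fixed family of vertices *)

Section convex_hulls.
Context {R : realType}.

Lemma convex_hullE k (nu : 'I_k -> pprobability R R) (V : set (pprobability R R)) :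
  (forall mu, V mu <-> exists i, nu i = mu) -> convex_hull V = hull nu.
Proof.
move=> VE; apply/seteqP; split => mu.
  move=> [n [w [nu' [w0 w1 nuV muE]]]].
  have /choice[c cE] : forall i, exists j, nu j = nu' i by move=> i; exact/VE.
  exists (fun j => \sum_(i < n | c i == j) w i); split.
  - by move=> j; exact: sumr_ge0.
  - by rewrite -w1 (partition_big c xpredT).
  - move=> U mU; rewrite muE// (partition_big c xpredT)//=; apply: eq_bigr => j _.
    have fU : nu j U \is a fin_num by rewrite (fin_num_measure (nu j : probability R R)).
    rewrite -(fineK fU) -EFinM big_distrl/= -sumEFin; apply: eq_bigr => i /eqP ij.
    by rewrite -cE ij EFinM fineK.
move=> [w [w0 w1 muE]]; exists k, w, nu; split => //.
by move=> i; apply/VE; exists i.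
Qed.

Theorem good_convex_hull3 (nu1 nu2 nu3 : pprobability R R) :
  supported_in `[0, +oo[ nu1 -> supported_in `[0, +oo[ nu2 -> supported_in `[0, +oo[ nu3 ->
  good (LISPP (convex_hull [set nu1; nu2; nu3])).
Proof.
move=> s1 s2 s3.
have ge0 (nu : pprobability R R) : supported_in `[0, +oo[ nu -> nu (~` `[0, +oo[%classic) = 0%E.
  move=> [A [mA A0 sA]]; apply/eqP; rewrite -measure_le0 -[leRHS]A0.
  by apply: le_measure; rewrite ?inE//; exact: measurableC.
pose nu (i : 'I_3) := if val i is 0%N then nu1 else if val i is 1%N then nu2 else nu3.
rewrite (@convex_hullE 3 nu).
  by apply: good_hull3 => -[[|[|[|//]]] i3] /=; exact: ge0.
move=> mu; split => /=.
  move=> [[->|->]|->].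
  - by exists (@Ordinal 3 0 isT).
  - by exists (@Ordinal 3 1 isT).
  - by exists (@Ordinal 3 2 isT).
by move=> [[[|[|[|//]]] i3] <-]; [left; left|left; right|right].
Qed.

(** The laws on {0, 1, 2, 3} are the hull of four point masses. So the failure of goodness concerns
    the laws of the mixtures and not the measurability of the family. *)
Theorem measurable_LISPP_0123 :
  measurable (LISPP (supported_in [set (0 : R); 1; 2; 3])).
Proof.
pose nu (i : 'I_4) : pprobability R R := \d_((val i)%:R : R).
have nuE (i : 'I_4) U : nu i U = ((val i)%:R \in U)%:R%:E :> \bar R by exact: diracE.
rewrite (_ : supported_in _ = hull nu).
  apply: measurable_LISPP_hull => i.
  by rewrite nuE memNset//= in_itv/= ler0n.
have mS : measurable [set (0 : R); 1; 2; 3] by do 3 (apply: measurableU => //).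
apply/seteqP; split => mu.
  move=> [A [mA A0 sA]].
  have mu0 : mu (~` [set (0 : R); 1; 2; 3]) = 0%E.
    apply/eqP; rewrite -measure_le0 -[leRHS]A0.
    by apply: le_measure; rewrite ?inE//; exact: measurableC.
  have sum4 (f : 'I_4 -> \bar R) : (\sum_(i < 4) f i)%E =
     (f (@Ordinal 4 0 isT) + (f (@Ordinal 4 1 isT) + (f (@Ordinal 4 2 isT) + f (@Ordinal 4 3 isT))))%E.
    rewrite !big_ord_recl big_ord0 adde0.
    by congr (f _ + (f _ + (f _ + f _)))%E; apply: val_inj.
  have muE U : measurable U -> mu U = (\sum_(i < 4) mu [set (val i)%:R] * nu i U)%E.
    move=> mU; rewrite -(measure_null_setI mU mS mu0) sum4 !nuE /=.
    have P (x : R) (W : set R) : measurable W -> ~ W x ->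
        mu (U `&` (x |` W)) = (mu [set x] * (x \in U)%:R%:E + mu (U `&` W))%E.
      move=> mW Wx; rewrite setIUr measureU//.
      - congr (_ + _)%E; have [xU|xU] := boolP (x \in U).
          by rewrite mule1 setIidr// => _ ->; exact: set_mem.
        rewrite mule0 (_ : _ `&` _ = set0) ?measure0//.
        by apply/seteqP; split => // y [Uy /= yx]; move: xU; rewrite -yx mem_set.
      - exact: measurableI.
      - exact: measurableI.
      - by apply/seteqP; split => // y [[_ /= ->] [_ ?]].
    rewrite (_ : [set (0 : R); 1; 2; 3] = 0 |` (1 |` (2 |` (3 |` set0)))); last first.
      apply/seteqP; split => y /=.
        by move=> [[[->|->]|->]|->]; [left|right;left|right;right;left|right;right;right;left].
      by move=> [->|[->|[->|[->|//]]]]; [left;left;left|left;left;right|left;right|right].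
    have m3 : measurable (3 |` set0 : set R) by apply: measurableU.
    have m2 : measurable (2 |` (3 |` set0) : set R) by apply: measurableU.
    have m1 : measurable (1 |` (2 |` (3 |` set0)) : set R) by apply: measurableU.
    have neq (m n : nat) : m != n -> (m%:R : R) <> n%:R.
      by move=> mn /eqP; rewrite eqr_nat (negbTE mn).
    have n2 : ~ (3 |` set0 : set R) 2 by move=> [|//] /=; exact: (neq 2%N 3%N).
    have n1 : ~ (2 |` (3 |` set0) : set R) 1.
      by move=> [|[|//]] /=; [exact: (neq 1%N 2%N)|exact: (neq 1%N 3%N)].
    have n0 : ~ (1 |` (2 |` (3 |` set0)) : set R) 0.
      by move=> [|[|[|//]]] /=; [exact: (neq 0%N 1%N)|exact: (neq 0%N 2%N)|exact: (neq 0%N 3%N)].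
    have n3 : ~ (set0 : set R) 3 by [].
    rewrite (P _ _ m1 n0) (P _ _ m2 n1) (P _ _ m3 n2) (P _ _ measurable0 n3).
    by rewrite setI0 measure0 adde0.
  have fin (x : R) : mu [set x] \is a fin_num by rewrite (fin_num_measure (mu : probability R R)).
  exists (fun i => fine (mu [set (val i)%:R])); split.
  - by move=> i; rewrite fine_ge0.
  - apply: EFin_inj; rewrite -sumEFin -(@probability_setT _ _ _ (mu : probability R R)).
    rewrite [RHS](muE setT)//; apply: eq_bigr => i _.
    by rewrite nuE mem_set// mule1 fineK.
  - by move=> U mU; rewrite muE//; apply: eq_bigr => i _; rewrite fineK.
move=> [w [w0 w1 muE]]; exists (~` [set (0 : R); 1; 2; 3]); split => //.
  exact: measurableC.
rewrite muE; last exact: measurableC.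
apply: big1 => i _; rewrite nuE memNset ?mule0//=; apply.
case: i => -[|[|[|[|//]]]] i4 /=; [left;left;left|left;left;right|left;right|right] => //.
Qed.

End convex_hulls.

(** * Rationally independent jumps *)

Section atomic_measures.
Context {R : realType}.

Lemma cvgn_near_cst (u : nat -> R) l N : (forall n, (N <= n)%N -> u n = l) ->
  u @ \oo --> l.
Proof. by move=> H; apply: cvg_near_cst; exists N => // n /= Nn; exact: H. Qed.

Lemma measurable_countable (K : set R) : countable K -> measurable K.
Proof. by apply: countable_measurable => x; exact: measurable_set1. Qed.

Lemma countable_enum (K : set R) : countable K ->
  exists e : nat -> R, forall x, K x -> exists n, e n = x.
Proof.
move=> /countable_injP[f fi].
exists (fun n => xget 0 [set a | K a /\ f a = n]) => x Kx; exists (f x).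
case: xgetP => [y _ [Ky fyx]|/(_ x)[]//].
by apply: fi => //; rewrite inE.
Qed.

Lemma eq_measure_atoms (m1 m2 : {measure set R -> \bar R}) (K : set R) :
  countable K -> m1 (~` K) = 0%E -> m2 (~` K) = 0%E ->
  (forall x, K x -> m1 [set x] = m2 [set x]) ->
  forall B, measurable B -> m1 B = m2 B.
Proof.
move=> cK m1K m2K H B mB; have mK := measurable_countable cK.
rewrite -(measure_null_setI mB mK m1K) -(measure_null_setI mB mK m2K).
have [e eK] := countable_enum cK.
pose F n := (B `&` K) `&` [set e n].
have mF n : measurable (F n).
  by apply: measurableI; [exact: measurableI|exact: measurable_set1].
(* The enumeration may repeat points; [seqDU] keeps each at its first occurrence. *)
have -> : B `&` K = \bigcup_n seqDU F n.
  rewrite -seqDU_bigcup_eq; apply/seteqP; split => x.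
    by move=> BKx; have [n en] := eK x BKx.2; exists n => //; split.
  by move=> [n _ []].
have mS n : measurable (seqDU F n).
  by rewrite /seqDU; apply: measurableD => //; exact: bigsetU_measurable.
rewrite !measure_bigcup//=; try exact: trivIset_seqDU.
apply: eq_eseriesr => n _.
have [[Sx Kx]|nS] := pselect (seqDU F n (e n) /\ K (e n)); last first.
  rewrite (_ : seqDU F n = set0) ?measure0//.
  apply/seteqP; split => // x Sx; apply: nS.
  by have [[[_ Kx] xe] _] := Sx; rewrite -xe.
rewrite (_ : seqDU F n = [set e n]) ?H//.
by apply/seteqP; split => x; [move=> [[_ ->]]|move=> ->].
Qed.

End atomic_measures.

(** * Sums of jumps that determine their summands *)

Section independent_sums.
Context {R : realType} (A : set R).
Hypotheses (cA : countable A) (iA : rat_independent A).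

Definition over (l : seq R) := forall a, a \in l -> A a.

Definition ssum (l : seq R) : R := \sum_(a <- l) a.

Lemma ssum_cons a l : ssum (a :: l) = a + ssum l.
Proof. exact: big_cons. Qed.

Lemma over_cons a l : over (a :: l) <-> A a /\ over l.
Proof.
split=> [H|[Aa H] b]; first split.
- by apply: H; rewrite inE eqxx.
- by move=> b bl; apply: H; rewrite inE bl orbT.
- by rewrite inE => /orP[/eqP ->|/H].
Qed.

Let ssum_count (u l : seq R) : uniq u -> {subset l <= u} ->
  ssum l = \sum_(x <- u) (count_mem x l)%:R * x.
Proof.
move=> uu; elim: l => [|b l ih] lu.
  by rewrite /ssum big_nil big1// => x _; rewrite mul0r.
rewrite ssum_cons ih => [|x xl]; last by apply: lu; rewrite inE xl orbT.
rewrite -[in LHS](_ : \sum_(x <- u) (b == x)%:R * x = b).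
  by rewrite -big_split/=; apply: eq_bigr => x _; rewrite natrD mulrDl.
rewrite (bigD1_seq b)//=; last by apply: lu; rewrite inE eqxx.
by rewrite eqxx mul1r big1 ?addr0// => x /negbTE xb; rewrite eq_sym xb mul0r.
Qed.

(** The differences of multiplicities are the coefficients of a rational relation between distinct
    elements of [A], hence zero. *)
Lemma ssum_inj l l' : over l -> over l' -> ssum l = ssum l' -> perm_eq l l'.
Proof.
move=> Al Al' E; pose u := undup (l ++ l').
have uu : uniq u by exact: undup_uniq.
have lu : {subset l <= u} by move=> x xl; rewrite mem_undup mem_cat xl.
have l'u : {subset l' <= u} by move=> x xl; rewrite mem_undup mem_cat xl orbT.
pose q (i : 'I_(size u)) : rat := (count_mem (u`_i) l)%:R - (count_mem (u`_i) l')%:R.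
have := iA (n := size u) (a := fun i => u`_i) (q := q).
have inj : injective (fun i : 'I_(size u) => u`_i).
  by move=> i i' /eqP; rewrite nth_uniq// => /eqP; exact: val_inj.
have Au (i : 'I_(size u)) : A u`_i.
  have : u`_i \in u by rewrite mem_nth.
  by rewrite mem_undup mem_cat => /orP[/Al|/Al'].
move=> /(_ inj Au) H.
have qE : forall i, q i = 0.
  apply: H; transitivity (ssum l - ssum l'); last by rewrite E subrr.
  rewrite (ssum_count uu lu) (ssum_count uu l'u) -sumrB (big_nth 0) big_mkord.
  by apply: eq_bigr => i _; rewrite /q raddfB/= !ratr_nat mulrBl.
apply/allP => x; rewrite -mem_undup -/u => xu.
have ix : (index x u < size u)%N by rewrite index_mem.
have /eqP := qE (Ordinal ix); rewrite /q /= nth_index// subr_eq0.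
by rewrite eqr_nat.
Qed.

Definition sums : set R := [set x | exists2 l, over l & x = ssum l].

Definition sumsn n : set R := [set x | exists2 l, over l & size l = n /\ x = ssum l].

Lemma sumsn_sums n : sumsn n `<=` sums.
Proof. by move=> x [l Al [_ xl]]; exists l. Qed.

Lemma over_enum : exists e : nat -> R, forall l, over l -> exists s, map e s = l.
Proof.
have [e eA] := countable_enum cA; exists e; elim=> [_|a l ih].
  by exists [::].
by move=> /over_cons[/eA[n <-] /ih[s <-]]; exists (n :: s).
Qed.

Lemma countable_sums : countable sums.
Proof.
have [e eE] := over_enum.
apply: (@sub_countable _ _ _ ((fun s : seq nat => ssum (map e s)) @` setT)).
  apply: subset_card_le => x [l /eE[s <-] ->]; by exists s.
by apply: (sub_countable (card_image_le _ _)).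
Qed.

Lemma measurable_sums : measurable sums.
Proof. exact: (measurable_countable countable_sums). Qed.

Lemma measurable_sumsn n : measurable (sumsn n).
Proof.
apply: measurable_countable; apply: sub_countable countable_sums.
exact/subset_card_le/sumsn_sums.
Qed.

(** The number of distinct arrangements of the multiset [l] if it has size [n], and 0 otherwise. The
    recursion chooses the first jump; [undup] prevents equal values from being counted twice. *)
Fixpoint orderings n (l : seq R) : R :=
  if n is k.+1 then \sum_(a <- undup l) orderings k (rem a l) else (l == [::])%:R.

Lemma orderings_ge0 n l : 0 <= orderings n l.
Proof.
elim: n l => [|n ih] l /=; first by rewrite ler0n.
by apply: sumr_ge0 => a _; exact: ih.
Qed.

Lemma orderings_size n l : size l != n -> orderings n l = 0.
Proof.
elim: n l => [|n ih] l /=; first by case: l.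
move=> sl; rewrite big_seq big1// => a; rewrite mem_undup => al.
by apply: ih; rewrite size_rem//; case: l sl al.
Qed.

Lemma orderings_gt0 l : 0 < orderings (size l) l.
Proof.
have [n] := ubnP (size l); elim: n l => // n ih [|b l] /= ln.
  by rewrite ltr01.
have bu : b \in undup (b :: l) by rewrite mem_undup inE eqxx.
rewrite -[if b \in l then _ else _]/(undup (b :: l)) (big_rem b)//=.
rewrite eqxx; apply: ltr_pwDl; first exact: ih.
by apply: sumr_ge0 => a _; exact: orderings_ge0.
Qed.

Section atoms.
Variable mu : giry R R.
Hypothesis muA : mu (~` A) = 0%E.

Let mA : measurable A := measurable_countable cA.

Let atom (x : R) : R := fine (mu [set x]).

Let indic1 (B : set R) x : `|\1_B x : R| <= 1.
Proof. by rewrite indicE normr_nat; case: (_ \in _); rewrite ?ler01. Qed.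

Let aeA : {ae mu, forall x, A x}.
Proof. by exists (~` A); split => //; exact: measurableC. Qed.

Lemma convpow_sums n : convpow mu n (~` sumsn n) = 0%E.
Proof.
have mC k : measurable (~` sumsn k) by apply: measurableC; exact: measurable_sumsn.
elim: n => [|n ih].
  by rewrite /= /giry_ret/= diracE memNset//=; apply; exists [::] => //; rewrite /ssum big_nil.
change (conv mu (convpow mu n) (~` sumsn n.+1) = 0%E).
apply: finite_measureE => //.
rewrite -Rintegral_indic// conv_integral//.
rewrite -[RHS](_ : \int[mu]_x 0 = 0); last by rewrite Rintegral_cst// mul0r.
apply: ae_eq_Rintegral => //; first exact: measurable_Rintegral_shift.
apply: filterS aeA => x Ax.
rewrite -[RHS](_ : \int[convpow mu n]_x 0 = 0); last by rewrite Rintegral_cst// mul0r.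
apply: ae_eq_Rintegral => //.
  by apply: measurableT_comp => //; exact: measurable_funD.
have : {ae convpow mu n, forall y, sumsn n y} by exists (~` sumsn n); split.
apply: filterS => y [l Al [ln ->]].
rewrite indicE memNset//=; apply; exists (x :: l); first exact/over_cons.
by rewrite /= ln ssum_cons.
Qed.

(** Conditioning on the first jump: by [ssum_inj] it must be a member of [l], and the remaining
    jumps must then have the sum of [rem]. *)
Lemma convpow_atom n l : over l -> fine (convpow mu n [set ssum l]) =
  orderings n l * \prod_(a <- l) atom a.
Proof.
elim: n l => [|n ih] l Al.
  rewrite -Rintegral_indic; last exact: measurable_set1.
  rewrite Rintegral_giry_ret ?indicE; last first.
    by apply: measurable_indic; exact: measurable_set1.
  have [->|l0] := eqVneq l [::].
    by rewrite big_nil mulr1 mem_set//= /ssum big_nil.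
  rewrite [orderings 0 l]/= (negbTE l0) mul0r memNset//= => e.
  have /perm_size : perm_eq l [::] by apply: ssum_inj => //; rewrite -e /ssum big_nil.
  by move=> /eqP; rewrite size_eq0; exact/negP.
pose F x : R := \sum_(a <- undup l) (\1_[set a] x) *
  fine (convpow mu n [set ssum (rem a l)]).
change (fine (conv mu (convpow mu n) [set ssum l]) = orderings n.+1 l * \prod_(a <- l) atom a).
have ms x : measurable [set x : R] by exact: measurable_set1.
rewrite -Rintegral_indic// conv_integral//.
have mF a : measurable_fun setT (fun x : R => (\1_[set a] x : R) *
    fine (convpow mu n [set ssum (rem a l)])).
  by apply: measurable_funM.
have F1 a x : `|(\1_[set a] x : R) * fine (convpow mu n [set ssum (rem a l)])| <= 1.
  rewrite normrM mulr_ile1//.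
  by have /andP[p q] := subprobability_fine_itv (convpow mu n) (ms (ssum (rem a l))); rewrite ger0_norm.
transitivity (\int[mu]_x F x).
  apply: ae_eq_Rintegral; first exact: measurable_Rintegral_shift.
    by apply: measurable_sum => a; exact: mF.
  apply: filterS aeA => x Ax; rewrite /F.
  have [xl|xl] := boolP (x \in l).
    rewrite (bigD1_seq x) ?undup_uniq ?mem_undup//= big1 ?addr0 => [|a ax]; last first.
      by rewrite indicE memNset ?mul0r//= => xa; move: ax; rewrite xa eqxx.
    rewrite indicE mem_set// mul1r -Rintegral_indic//; apply: eq_Rintegral => y _.
    rewrite !indicE; congr (nat_of_bool _)%:R; apply/idP/idP; rewrite !inE/=.
      by rewrite /ssum (big_rem x xl)/= => /addrI.
    by rewrite /ssum [in X in _ -> X](big_rem x xl)/= => ->.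
  rewrite big_seq big1 => [|a al]; last first.
    rewrite indicE memNset ?mul0r//= => xa.
    by move: al xl; rewrite mem_undup xa => ->.
  rewrite -[RHS](_ : \int[convpow mu n]_x 0 = 0); last by rewrite Rintegral_cst// mul0r.
  apply: ae_eq_Rintegral => //.
    by apply: measurableT_comp => //; exact: measurable_funD.
  have : {ae convpow mu n, forall y, sumsn n y}.
    exists (~` sumsn n); split => //; first by apply: measurableC; exact: measurable_sumsn.
    exact: convpow_sums.
  apply: filterS => y [l' Al' [_ ->]].
  rewrite indicE memNset//= -ssum_cons => e.
  have /perm_mem/(_ x) : perm_eq (x :: l') l by apply: ssum_inj => //; exact/over_cons.
  by rewrite inE eqxx (negbTE xl).
rewrite /F (@Rintegral_sum _ _ _ mu _ _ _ (fun=> 1))//= mulr_suml.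
apply: eq_big_seq => a; rewrite mem_undup => al.
transitivity (\int[mu]_x (fine (convpow mu n [set ssum (rem a l)]) * \1_[set a] x)).
  by apply: eq_Rintegral => x _; rewrite mulrC.
rewrite (Rintegral_scale mu _ _ (indic1 [set a]))// Rintegral_indic//.
have Ar : over (rem a l) by move=> b /mem_rem; exact: Al.
by rewrite ih// [in RHS](big_rem a al)/= mulrA -!mulrA; congr (_ * _); rewrite mulrC.
Qed.

Definition atom_weight (t : R) (l : seq R) : R :=
  expR (- t) * (t ^+ size l / (size l)`!%:R) * orderings (size l) l.

Lemma compound_poisson_atom t l : 0 <= t -> over l ->
  fine (compound_poisson t mu [set ssum l]) = atom_weight t l * \prod_(a <- l) atom a.
Proof.
move=> t0 Al; have := compound_poisson_measure (mu := mu) t0 (measurable_set1 (ssum l)).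
move=> /(cvg_lim (@Rhausdorff R)) <-.
apply: cvg_lim => //; apply: (@cvgn_near_cst _ _ _ (size l).+1) => n ln.
rewrite /series/= (big_cat_nat (leq0n (size l).+1) ln)/= [X in _ + X](_ : _ = 0) ?addr0; last first.
  rewrite big_nat big1// => i /andP[li _].
  by rewrite convpow_atom// orderings_size ?mul0r ?mulr0// ltn_eqF.
rewrite big_nat_recr//= [X in X + _](_ : _ = 0) ?add0r; last first.
  rewrite big_nat big1// => i il.
  by rewrite convpow_atom// orderings_size ?mul0r ?mulr0// gtn_eqF.
by rewrite convpow_atom// mulrA.
Qed.

Lemma compound_poisson_null t B : 0 <= t -> measurable B ->
  (forall n, convpow mu n B = 0%E) -> compound_poisson t mu B = 0%E.
Proof.
move=> t0 mB B0; apply: finite_measureE => //.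
have := compound_poisson_measure (mu := mu) t0 mB.
move=> /(cvg_lim (@Rhausdorff R)) <-.
apply: cvg_lim => //; apply: (@cvgn_near_cst _ _ _ 0%N) => n _.
by rewrite /series/= big1// => i _; rewrite B0 mulr0.
Qed.

Lemma compound_poisson_sums t : 0 <= t -> compound_poisson t mu (~` sums) = 0%E.
Proof.
move=> t0; apply: compound_poisson_null => // [|n].
  by apply: measurableC; exact: measurable_sums.
apply: (subset_measure0 _ _ _ (convpow_sums n)).
- by apply: measurableC; exact: measurable_sums.
- by apply: measurableC; exact: measurable_sumsn.
- by apply: subsetC; exact: sumsn_sums.
Qed.

(** An element of [A] is a sum of n elements of [A] only for n = 1, so the mass of [A] is the
    probability of exactly one jump. In [LISPP_atomsP] this condition makes the recovered jump law a
    probability. *)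
Lemma compound_poisson_support : mu setT = 1%E ->
  compound_poisson 1 mu A = (expR (-1))%:E.
Proof.
move=> mu1; apply: finite_measureE => //.
have := compound_poisson_measure (mu := mu) ler01 mA.
move=> /(cvg_lim (@Rhausdorff R)) <-.
have A0 n : n != 1%N -> convpow mu n A = 0%E.
  move=> n1; apply: (subset_measure0 _ _ _ (convpow_sums n)) => //.
    by apply: measurableC; exact: measurable_sumsn.
  move=> a Aa [l Al [ln al]].
  have /perm_size : perm_eq [:: a] l.
    apply: ssum_inj => //; first by apply/over_cons.
    by rewrite ssum_cons /ssum big_nil addr0.
  by rewrite ln => /eqP; rewrite eq_sym (negbTE n1).
have A1 : fine (convpow mu 1 A) = 1.
  change (fine (conv mu (giry_ret (0 : R)) A) = 1).
  rewrite -Rintegral_indic// conv_integral//.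
  transitivity (\int[mu]_x (\1_A x : R)).
    apply: eq_Rintegral => x _; rewrite Rintegral_giry_ret ?addr0//.
    by apply: measurableT_comp => //; exact: measurable_funD.
  have AT : mu A = mu setT by have := measure_null_setI measurableT mA muA; rewrite setTI.
  by rewrite Rintegral_indic//; transitivity (fine (mu A)) => //; rewrite AT mu1.
apply: cvg_lim => //; apply: (@cvgn_near_cst _ _ _ 2) => n n2.
rewrite /series/= (big_cat_nat (leq0n 2) n2)/= [X in _ + X](_ : _ = 0) ?addr0; last first.
  rewrite big_nat big1// => i /andP[i2 _].
  by rewrite A0 ?mulr0// gtn_eqF.
pose u i := expR (-1) * (1 ^+ i / i`!%:R) * fine (convpow mu i A).
transitivity (u 0%N + u 1%N); first by rewrite big_nat_recr//= big_nat1.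
by rewrite /u A0// A1 mulr0 add0r expr1 divr1 !mulr1.
Qed.

End atoms.

Lemma atom_weight_gt0 l : 0 < atom_weight 1 l.
Proof.
by rewrite !mulr_gt0 ?expR_gt0 ?orderings_gt0// ?exprn_gt0// invr_gt0 ltr0n fact_gt0.
Qed.

Let mA : measurable A := measurable_countable cA.

Lemma supported_inP (mu : pprobability R R) : supported_in A mu <-> mu (~` A) = 0%E.
Proof.
split=> [[B [mB B0 AB]]|A0]; last by exists (~` A); split => //; exact: measurableC.
by apply: (subset_measure0 _ _ AB B0) => //; exact: measurableC.
Qed.

Lemma LISPP_atoms g : LISPP (supported_in A) g -> exists f : R -> R,
  forall (t : {nonneg R}) l, over l ->
    fine (marginal t g [set ssum l]) = atom_weight t%:num l * \prod_(a <- l) f a.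
Proof.
move=> /LISPP_marginal[mu /supported_inP mu0 gE].
exists (fun a => fine (mu [set a])) => t l Al.
by rewrite gE; [exact: compound_poisson_atom|exact: measurable_set1].
Qed.

Lemma LISPP_sums g : LISPP (supported_in A) g -> forall t,
  marginal t g (~` sums) = 0%E.
Proof.
move=> /LISPP_marginal[mu /supported_inP mu0 gE] t.
rewrite gE; last by apply: measurableC; exact: measurable_sums.
exact: compound_poisson_sums.
Qed.

Let ssum1 (a : R) : [set a] = [set ssum [:: a]].
Proof. by rewrite /ssum big_seq1. Qed.

Lemma atom_weight1 (t a : R) : atom_weight t [:: a] = expR (- t) * t.
Proof.
by rewrite /atom_weight/= big_seq1/= ?eqxx/= ?eqxx mulr1 expr1 divr1.
Qed.

(* [mu] is [expR 1] times the restriction of [m] to [A]: the jump law is read off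
   the paths with a single jump. *)
Lemma compound_poisson_of_atoms (m : probability R R) :
  m (~` sums) = 0%E -> m A = (expR (-1))%:E ->
  (forall l, over l -> fine (m [set ssum l]) =
    atom_weight 1 l * \prod_(a <- l) (expR 1 * fine (m [set a]))) ->
  exists2 mu : pprobability R R, mu (~` A) = 0%E &
    forall B, measurable B -> m B = compound_poisson 1 mu B.
Proof.
have ee : expR 1 * expR (-1) = 1 :> R by rewrite -expRD subrr expR0.
move=> m0 meA mE.
pose m' : {measure set R -> \bar R} := mscale (NngNum (expR_ge0 (1 : R))) (mrestr m mA).
have m'E B : m' B = ((expR 1)%:E * m (B `&` A))%E by [].
have m1 : m' setT = 1%E by rewrite m'E setTI meA -EFinM ee.
pose mu : pprobability R R := prob_of_measure m1.
have mu0 : mu (~` A) = 0%E.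
  by rewrite -[LHS]/(m' _) m'E setICl measure0 mule0.
exists mu => //.
apply: (eq_measure_atoms countable_sums) => //.
  by apply: compound_poisson_sums.
move=> _ [l Al ->]; have ms (x : R) : measurable [set x] by exact: measurable_set1.
suff E : fine (m [set ssum l]) = fine (compound_poisson 1 mu [set ssum l]).
  by rewrite -[LHS]fineK ?fin_num_measure// E fineK// fin_num_measure.
rewrite mE// compound_poisson_atom//; congr (_ * _).
apply: eq_big_seq => a /Al Aa.
rewrite -[X in _ = fine X]/(m' [set a]) m'E (_ : [set a] `&` A = [set a]).
  by rewrite fineM// fin_num_measure.
by apply/seteqP; split => [x []//|x ->]; split.
Qed.

Let one : {nonneg R} := 1%:nng.

(** The jump law has disappeared, expressed by point masses of the marginal itself. Since the lists
    over [A] can be enumerated, countably many conditions remain, which yields measurability. *)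
Lemma LISPP_atomsP (g : levy_law R) : LISPP (supported_in A) g <->
  [/\ marginal one g (~` sums) = 0%E, marginal one g A = (expR (-1))%:E &
    forall l, over l -> fine (marginal one g [set ssum l]) =
      atom_weight 1 l * \prod_(a <- l) (expR 1 * fine (marginal one g [set a]))].
Proof.
split=> [Lg|[g0 gA gE]].
  split; first exact: LISPP_sums.
    have /LISPP_marginal[mu /supported_inP mu0 gE] := Lg.
    rewrite gE//; apply: compound_poisson_support => //.
    exact: (@probability_setT _ _ _ (mu : probability R R)).
  move=> l Al; have [f fE] := LISPP_atoms Lg; rewrite fE//=; congr (_ * _).
  apply: eq_big_seq => a /Al Aa.
  rewrite ssum1 fE ?big_seq1; last exact/over_cons.
  by rewrite atom_weight1/= mulr1 mulrA -expRD subrr expR0 mul1r.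
have [mu mu0 muE] := compound_poisson_of_atoms g0 gA gE.
by apply/LISPP_compound_poissonP; exists mu; first exact/supported_inP.
Qed.

Lemma measurable_LISPP_independent : measurable (LISPP (supported_in A)).
Proof.
have [e eE] := over_enum.
pose E (l : seq R) := [set g : levy_space R | over l ->
  fine (marginal one g [set ssum l]) =
  atom_weight 1 l * \prod_(a <- l) (expR 1 * fine (marginal one g [set a]))].
have mf (x : R) : measurable_fun setT (fun g : levy_space R => fine (marginal one g [set x])).
  apply: (measurableT_comp (f := fine)) => //.
  by apply: measurable_marginal_eval; exact: measurable_set1.
have mE l : measurable (E l).
  have [Al|nAl] := pselect (over l); last first.
    by rewrite (_ : E l = setT)//; apply/seteqP; split => // g _ /nAl.
  pose f (g : levy_space R) := fine (marginal one g [set ssum l]) -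
    atom_weight 1 l * \prod_(a <- l) (expR 1 * fine (marginal one g [set a])).
  have mff : measurable_fun setT f.
    apply: measurable_funB => //; apply: measurable_funM => //.
    by apply: measurable_prod => a _; apply: measurable_funM.
  have := mff measurableT _ (measurable_set1 0); rewrite setTI.
  rewrite (_ : f @^-1` _ = E l)//; apply/seteqP; split => g; rewrite /f /E/=.
    by move=> /eqP; rewrite subr_eq0 => /eqP.
  by move=> /(_ Al) ->; rewrite subrr.
rewrite (_ : LISPP _ = [set g | marginal one g (~` sums) = 0%E] `&`
    [set g | marginal one g A = (expR (-1))%:E] `&`
    \bigcap_p (if unpickle p is Some s then E (map e s) else setT)); last first.
  apply/seteqP; split => g.
    move=> /LISPP_atomsP[h1 h2 h3]; split; first by split.
    by move=> p _; case: unpickle => // s Al; exact: h3.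
  move=> [[h1 h2] h3]; apply/LISPP_atomsP; split => // l Al.
  by have [s sl] := eE l Al; have := h3 (pickle s) I; rewrite pickleK sl; exact.
apply: measurableI; first apply: measurableI.
- by apply: measurable_marginal_eq; apply: measurableC; exact: measurable_sums.
- exact: measurable_marginal_eq.
- by apply: bigcapT_measurable => p; case: (@unpickle (seq nat) p) => [s|].
Qed.

Theorem good_independent : good (LISPP (supported_in A)).
Proof.
(* The tests are indexed by all lists of reals; deleting the entries outside [A] turns each into a
   list over [A]. *)
pose clean (l : seq R) := [seq a <- l | `[< A a >]].
have Aclean l : over (clean l) by move=> a; rewrite mem_filter => /andP[/asboolP].
have ms (x : R) : measurable [set x] by exact: measurable_set1.
apply: (good_criterion (K := sums) (test := fun l => \1_[set ssum (clean l)] : R -> R) [::]).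
- exact: measurable_LISPP_independent.
- exact: measurable_sums.
- exact: LISPP_sums.
- by move=> l; exact: measurable_indic.
- by move=> l x; rewrite indicE; case: (_ \in _); rewrite /= ?lexx ?ler01.
- move=> m1 m2 m10 m20 H; apply: (eq_measure_atoms countable_sums m10 m20).
  move=> _ [l Al ->]; have := H l; rewrite !Rintegral_indic//.
  rewrite (_ : clean l = l) => [E|]; last first.
    by apply/all_filterP/allP => a /Al Aa; exact/asboolP.
  by rewrite -[LHS]fineK ?fin_num_measure// -[RHS]fineK ?fin_num_measure// E.
move=> T1 T2 T1L T2L H s n j.
pose fl := flatten [seq clean (j i) | i <- index_iota 0 n].
have Afl : over fl by move=> a /flatten_mapP[i _]; exact: Aclean.
(* The constant exchanges the weights at the separate times for the weight of the concatenated list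
   at time 1; the factor that depends on the jump law is the same on both sides. *)
pose c := (\prod_(0 <= i < n) atom_weight (s i)%:num (clean (j i))) / atom_weight 1 fl.
have mf (x : R) : measurable_fun setT (fun g : levy_space R => fine (marginal one g [set x])).
  apply: (measurableT_comp (f := fine)) => //; exact: measurable_marginal_eval.
have f1 (x : R) (g : levy_space R) : `|fine (marginal one g [set x])| <= 1.
  by have /andP[p q] := subprobability_fine_itv (marginal one g) (ms x); rewrite ger0_norm.
have K (Theta : probability (levy_space R) R) : Theta (LISPP (supported_in A)) = 1%E ->
    \int[Theta]_g \prod_(0 <= i < n) \int[marginal (s i) g]_x \1_[set ssum (clean (j i))] x =
    c * \int[Theta]_g fine (marginal one g [set ssum fl]).
  move=> TL; rewrite -(Rintegral_scale Theta c (mf (ssum fl)) (f1 (ssum fl))).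
  apply: ae_eq_Rintegral.
  - apply: measurable_prod => i _; apply: measurable_marginal_Rintegral.
      exact: measurable_indic.
    by move=> x; rewrite indicE; case: (_ \in _); rewrite /= ?lexx ?ler01.
  - exact: measurable_funM.
  have : {ae Theta, forall g, LISPP (supported_in A) g}.
    exists (~` LISPP (supported_in A)); split => //.
      by apply: measurableC; exact: measurable_LISPP_independent.
    by rewrite probability_setC ?TL ?subee//; exact: measurable_LISPP_independent.
  apply: filterS => g /LISPP_atoms[f fE].
  under eq_bigr do rewrite Rintegral_indic// fE//.
  rewrite fE// big_split/= /c mulrA divfK ?gt_eqF ?atom_weight_gt0//.
  by congr (_ * _); rewrite /fl big_flatten/= big_map.
by rewrite (K _ T1L) (K _ T2L) H.
Qed.

End independent_sums.

(** * The compound Poisson process *)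

Section poisson_cells.
Context {R : realType}.

(** The probability of strictly fewer than [n] points, hence the shift by one in [ltn_count]. *)
Definition poisson_cdf n : R := \sum_(0 <= k < n) expR (- 1) / k`!%:R.

Lemma poisson_cdf_homo : {homo poisson_cdf : n m / (n <= m)%N >-> n <= m}.
Proof.
move=> n m nm; rewrite /poisson_cdf (big_cat_nat (leq0n n) nm)//= lerDl sumr_ge0//.
Qed.

Lemma poisson_cdf_cvg (c : R) :
  (fun n => \sum_(0 <= k < n) expR (- 1) / k`!%:R * c ^+ k) @ \oo --> expR (c - 1).
Proof.
rewrite addrC expRD (_ : (fun n => _) =
    (fun n => expR (- 1) * series (exp_coeff c) n)); last first.
  apply/funext => n; rewrite /series/= big_distrr/=; apply: eq_bigr => k _.
  by rewrite /exp_coeff /=; ring.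
by apply: cvgM; [exact: cvg_cst|exact: is_cvg_series_exp_coeff].
Qed.

Lemma poisson_cdf_exists u : u < 1 -> exists j, u <= poisson_cdf j.+1.
Proof.
move=> u1; have := @poisson_cdf_cvg 1; rewrite subrr expR0 => /cvgr_gt/(_ _ u1)[N _ HN].
exists N; rewrite ltW//; have := HN N.+1 (leqnSn _).
by under eq_bigr do rewrite expr1n mulr1.
Qed.

(* The quantile function of the Poisson law of parameter 1. *)
Definition count (u : R) : nat :=
  if pselect (u < 1) is left u1 then ex_minn (poisson_cdf_exists u1) else 0.

Lemma ltn_count j u : (j < count u)%N = (u < 1) && (poisson_cdf j.+1 < u).
Proof.
rewrite /count; case: pselect => [u1|/negP/negbTE->//]; rewrite u1/=.
case: ex_minnP => m um mmin; apply/idP/idP => [jm|ju].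
  by rewrite ltNge; apply: contraTN jm => /mmin; rewrite leqNgt.
by rewrite ltnNge; apply/negP => mj; have := lt_le_trans ju um;
  rewrite ltNge poisson_cdf_homo.
Qed.

Let ind (b : bool) : R := b%:R.

Lemma measurable_natr_bool d (T : measurableType d) (b : T -> bool) :
  measurable_fun setT b -> measurable_fun setT (fun x => (b x)%:R : R).
Proof.
move=> mb; rewrite (_ : (fun x => _) = fun x => if b x then 1 else 0 : R); last first.
  by apply/funext => x; case: (b x).
exact: measurable_fun_ifT.
Qed.

Lemma measurable_ltn_count j : measurable_fun setT (fun u => (j < count u)%N).
Proof.
under eq_fun do rewrite ltn_count.
apply: measurable_and; exact: measurable_fun_ltr.
Qed.

Lemma measurable_count n : measurable_fun setT (fun u => (count u == n)%:R : R).
Proof.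
apply: measurable_natr_bool; case: n => [|n].
  under eq_fun do rewrite -leqn0 leqNgt.
  exact: measurable_neg (measurable_ltn_count 0).
under eq_fun do rewrite eqn_leq leqNgt.
by apply: measurable_and; [apply: measurable_neg|]; exact: measurable_ltn_count.
Qed.

Lemma poisson_cdf_itv n : 0 <= poisson_cdf n < 1.
Proof.
apply/andP; split; first by rewrite -(_ : poisson_cdf 0 = 0) ?poisson_cdf_homo// /poisson_cdf big_nil.
have /lt_le_trans -> // : poisson_cdf n < poisson_cdf n.+1.
  by rewrite /poisson_cdf [ltRHS]big_nat_recr//= ltrDl divr_gt0 ?expR_gt0// ltr0n fact_gt0.
have c1 : poisson_cdf @ \oo --> (1 : R).
  rewrite -[X in _ --> X](@expR0 R) -(subrr (1 : R)).
  rewrite (_ : poisson_cdf = fun n => \sum_(0 <= k < n) expR (- 1) / k`!%:R * 1 ^+ k).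
    exact: poisson_cdf_cvg.
  by apply/funext => j; apply: eq_bigr => k _; rewrite expr1n mulr1.
rewrite -(cvg_lim (@Rhausdorff R) c1); apply: nondecreasing_cvgn_le.
  by move=> a b; exact: poisson_cdf_homo.
exact: cvgP c1.
Qed.

Lemma Rintegral_unif_ltn (c : R) : 0 <= c < 1 ->
  \int[unif]_u (c < u)%R%:R = 1 - c.
Proof.
move=> /andP[c0 c1]; transitivity (\int[unif]_u (\1_(`]c, +oo[%classic) u : R)).
  by apply: eq_Rintegral => u _; rewrite indicE; congr (nat_of_bool _)%:R;
    apply/idP/idP; rewrite inE/= in_itv/= andbT.
rewrite Rintegral_indic//.
by have -> := congr1 fine (unif_ray c); rewrite /= ltNge c0/= c1.
Qed.

Lemma Rintegral_leq_count n : \int[unif]_u (n <= count u)%N%:R = 1 - poisson_cdf n.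
Proof.
case: n => [|n].
  under eq_Rintegral do rewrite /=.
  by rewrite Rintegral_prob_cst /poisson_cdf big_nil subr0.
rewrite -(Rintegral_unif_ltn (poisson_cdf_itv _)); apply: ae_eq_Rintegral.
- by apply: measurable_natr_bool; exact: measurable_ltn_count.
- by apply: measurable_natr_bool; exact: measurable_fun_ltr.
- by apply: filterS unif_ae => u /andP[_ u1]; rewrite ltn_count u1.
Qed.

Lemma Rintegral_count n : \int[unif]_u (count u == n)%:R = expR (- 1) / n`!%:R.
Proof.
rewrite (_ : _ / _ = 1 * (1 - poisson_cdf n) + (-1) * (1 - poisson_cdf n.+1)); last first.
  by rewrite /poisson_cdf big_nat_recr//=; ring.
have m k : measurable_fun setT (fun u => (k <= count u)%N%:R : R).
  by apply: measurable_natr_bool; case: k => [|k]; [exact: measurable_cst|exact: measurable_ltn_count].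
have b k u : `|(k <= count u)%N%:R : R| <= 1 by rewrite normr_nat; case: (_ <= _)%N; rewrite ?ler01.
rewrite -!Rintegral_leq_count -(Rintegral_lin2 unif _ _ (m _) (m _) (b _) (b _)).
apply: eq_Rintegral => u _; rewrite eqn_leq [in LHS]andbC leqNgt.
by case: ltngtP => //= _; lra.
Qed.

Definition points (j : nat) (c : R) : R := uniforms j (odd_digits c).

Lemma measurable_points j : measurable_fun setT (points j).
Proof. exact: (measurableT_comp (measurable_uniforms j) measurable_odd_digits). Qed.

(** One seed [c] encodes a Poisson number of independent uniform points: even digits for the number,
    odd digits for the points. Given k points the product has as mean the k-th power of the mean of
    [h], and the exponential series sums these cases. *)
Lemma Rintegral_cell (h : R -> R) : measurable_fun setT h ->
  (forall e, 0 <= h e <= 1) ->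
  \int[unif]_c \prod_(0 <= j < count (even_digits c)) h (points j c) =
  expR (\int[unif]_e h e - 1).
Proof.
move=> mh h01.
pose G k (c : R) := \prod_(0 <= j < k) h (uniforms j c).
have mG k : measurable_fun setT (G k).
  by apply: measurable_prod => j _; exact: (measurableT_comp mh (measurable_uniforms j)).
have G01 k c : 0 <= G k c <= 1 by apply: prod_itv01 => j.
pose F k (c : R) := (count (even_digits c) == k)%:R * G k (odd_digits c).
have mF k : measurable_fun setT (F k).
  apply: measurable_funM; first exact: (measurableT_comp (measurable_count k) measurable_even_digits).
  exact: (measurableT_comp (mG k) measurable_odd_digits).
have F01 k c : 0 <= F k c <= 1.
  have /andP[G0 G1] := G01 k (odd_digits c).
  by rewrite /F; case: eqP => _; rewrite ?mul1r ?mul0r ?G0// lexx ler01.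
pose S n (c : R) := \sum_(0 <= k < n) F k c.
have SE n c : S n c = if (count (even_digits c) < n)%N then
    G (count (even_digits c)) (odd_digits c) else 0.
  rewrite /S -[LHS](_ : \sum_(0 <= k < n | count (even_digits c) == k) G k (odd_digits c) = _).
    by under eq_bigl do rewrite eq_sym; rewrite big_nat1_eq.
  by rewrite big_mkcond; apply: eq_bigr => k _; rewrite /F; case: eqP => _;
    rewrite ?mul1r ?mul0r.
have H1 : (fun n => \int[unif]_c S n c) @ \oo -->
    \int[unif]_c \prod_(0 <= j < count (even_digits c)) h (points j c).
  apply: (Rintegral_bounded_cvg (m := unif) (C := 1)) => [n|n|c].
  - by apply: measurable_sum => k.
  - by apply: itv01_norm => c; rewrite SE; case: ifP => _; rewrite ?G01// lexx ler01.
  - by apply: (cvgn_near_cst (N := (count (even_digits c)).+1)) => n cn; rewrite SE cn.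
have SI n : \int[unif]_c S n c =
    \sum_(0 <= k < n) expR (- 1) / k`!%:R * (\int[unif]_e h e) ^+ k.
  rewrite (@Rintegral_sum _ _ _ unif _ _ _ (fun=> 1))//; last by move=> k; exact: itv01_norm.
  apply: eq_bigr => k _; rewrite /F.
  rewrite (digits_indep (f := fun u => (count u == k)%:R) (g := G k))//.
  - rewrite Rintegral_count; congr (_ * _).
    by rewrite /G (@uniforms_iid R (fun=> h))// big_const_nat iter_mulr_1 subn0.
  - exact: measurable_count.
  - by move=> u; rewrite ler0n lern1 leq_b1.
have : (fun n => \int[unif]_c S n c) @ \oo --> expR (\int[unif]_e h e - 1).
  by under eq_fun do rewrite SI; exact: poisson_cdf_cvg.
by move: H1 => /(cvg_unique (@Rhausdorff R)); apply.
Qed.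

End poisson_cells.

(** * The process assembled from unit cells *)

Section compound_poisson_process.
Context {R : realType} (m : {RV (@unif R) >-> R}).
Hypothesis m_ge0 : forall v, 0 <= m v.

(** Cell [k] covers the time from k to k + 1. A point with seed [e] arrives at time k + even_digits
    e and carries the jump m (odd_digits e). *)
Let ind k (t e : R) : R := (k%:R + even_digits e < t)%R%:R.
Let jump k (t : R) (e : R) : R := ind k t e * m (odd_digits e).
Let cell k (t : R) (c : R) : R :=
  \sum_(0 <= j < count (even_digits c)) jump k t (points j c).
Let Z (t : {nonneg R}) (w : R) : R :=
  \sum_(0 <= k < `|Num.ceil t%:num|%N) cell k t%:num (uniforms k w).

Let even_ge0 (e : R) : 0 <= even_digits e. Proof. by have [] := digits_ge0 e. Qed.

Let mm : measurable_fun setT m. Proof. exact: measurable_funP. Qed.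

Let mind k t : measurable_fun setT (ind k t).
Proof.
apply: measurable_natr_bool; apply: measurable_fun_ltr => //.
by apply: measurable_funD => //; exact: measurable_even_digits.
Qed.

Let mjump k t : measurable_fun setT (jump k t).
Proof.
apply: measurable_funM; first exact: mind.
exact: (measurableT_comp mm measurable_odd_digits).
Qed.

Let mcell k t : measurable_fun setT (cell k t).
Proof.
pose f n c := \sum_(0 <= j < n) (j < count (even_digits c))%N%:R * jump k t (points j c).
apply: (measurable_fun_cvg (h := f)) => [n|c _].
  apply: measurable_sum => j; apply: measurable_funM.
    apply: (measurableT_comp (measurable_natr_bool (measurable_ltn_count j))).
    exact: measurable_even_digits.
  exact: (measurableT_comp (mjump k t) (measurable_points j)).
apply: (cvgn_near_cst (N := count (even_digits c))) => n cn.
rewrite /f (big_cat_nat (leq0n _) cn)//=.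
rewrite [X in _ + X](_ : _ = 0) ?addr0; last first.
  by rewrite big_nat big1// => j /andP[cj _]; rewrite ltnNge cj mul0r.
by rewrite /cell big_nat [RHS]big_nat; apply: eq_bigr => j /andP[_ ->]; rewrite mul1r.
Qed.

Let mZ t : measurable_fun setT (Z t).
Proof.
by apply: measurable_sum => k; exact: (measurableT_comp (mcell k _) (measurable_uniforms k)).
Qed.

HB.instance Definition _ t := isMeasurableFun.Build _ _ R R (Z t) (mZ t).

Let ind_out k t e : t <= k%:R -> ind k t e = 0.
Proof.
move=> tk; rewrite /ind (_ : _ < _ = false)//; apply/negbTE; rewrite -leNgt.
by rewrite (le_trans tk)// lerDl.
Qed.

Let Z_trunc (t : {nonneg R}) (K : nat) w : t%:num <= K%:R ->
  Z t w = \sum_(0 <= k < K) cell k t%:num (uniforms k w).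
Proof.
move=> tK; have c0 : (0 <= Num.ceil t%:num)%R by rewrite ceil_ge0 (lt_le_trans (ltrN10 R)).
have nK : (`|Num.ceil t%:num| <= K)%N.
  by rewrite -lez_nat gez0_abs// ceil_le_int.
rewrite [RHS](big_cat_nat (leq0n _) nK)//= [X in _ + X](_ : _ = 0) ?addr0//.
rewrite big_nat big1// => k /andP[ck _]; rewrite /cell big1// => j _; rewrite /jump ind_out ?mul0r//.
rewrite (le_trans (ceil_ge _))// -[X in X <= _](_ : `|Num.ceil t%:num|%N%:R = _) ?ler_nat//.
by rewrite natr_absz ger0_norm.
Qed.

Section increments.
Variable t : nat -> {nonneg R}.
Hypothesis t_homo : forall i, (t i)%:num <= (t i.+1)%:num.

Let D i w := Z (t i.+1) w - Z (t i) w.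
Let dind k i e := ind k (t i.+1)%:num e - ind k (t i)%:num e.

Let dind01 k i e : dind k i e = 0 \/
  dind k i e = 1 /\ (t i)%:num <= k%:R + even_digits e.
Proof.
rewrite /dind /ind; have := t_homo i.
case: ltP => h1; case: ltP => h2 h3; rewrite ?subrr ?subr0; try by left.
- by right.
- by move: h1 h2 h3; lra.
Qed.

Let dind_disj k n e : (t n)%:num <= k%:R + even_digits e ->
  forall i, (i < n)%N -> dind k i e = 0.
Proof.
move=> tn i ni; have tin : (t i.+1)%:num <= (t n)%:num.
  by apply: (homo_leq (r := fun a b : {nonneg R} => a%:num <= b%:num)) => // a b c; exact: le_trans.
have h1 : (k%:R + even_digits e < (t i.+1)%:num) = false.
  by apply/negbTE; rewrite -leNgt (le_trans tin).
have h2 : (k%:R + even_digits e < (t i)%:num) = false.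
  by apply/negbTE; rewrite -leNgt (le_trans (t_homo i))// (le_trans tin).
by rewrite /dind /ind h1 h2 subrr.
Qed.

Let DE n K w : (t n)%:num <= K%:R -> forall i, (i < n)%N ->
  D i w = \sum_(0 <= k < K) \sum_(0 <= j < count (even_digits (uniforms k w)))
    dind k i (points j (uniforms k w)) * m (odd_digits (points j (uniforms k w))).
Proof.
move=> tK i ni; have tin : (t i.+1)%:num <= (t n)%:num.
  by apply: (homo_leq (r := fun a b : {nonneg R} => a%:num <= b%:num)) => // a b c; exact: le_trans.
rewrite /D !(@Z_trunc _ K) ?(le_trans tin)// ?(le_trans (t_homo i)) ?(le_trans tin)//.
rewrite -sumrB; apply: eq_bigr => k _; rewrite -sumrB; apply: eq_bigr => j _.
by rewrite /jump -mulrBl.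
Qed.

Lemma process_increment_ge0 i w : 0 <= D i w.
Proof.
have [K /ltW tK] : exists K : nat, (t i.+1)%:num < K%:R.
  by exists (Num.bound (t i.+1)%:num); exact: archi_boundP.
rewrite (DE w tK)//; apply: sumr_ge0 => k _; apply: sumr_ge0 => j _.
by apply: mulr_ge0 => //; have [->|[-> _]] := dind01 k i (points j (uniforms k w)).
Qed.

Let L l := \int[unif]_v exp_neg l (m v).

Let hk n (l : nat -> R) k (e : R) : R :=
  1 + \sum_(0 <= i < n) dind k i e * (exp_neg (l i) (m (odd_digits e)) - 1).

(** The intervals between successive times are disjoint, so a point contributes to at most one
    increment, and at most one factor of the product differs from 1. *)
Let hkE n (l : nat -> R) k (e : R) :
  \prod_(0 <= i < n) exp_neg (l i) (dind k i e * m (odd_digits e)) = hk n l k e.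
Proof.
rewrite /hk; elim: n => [|n ih]; first by rewrite !big_nil addr0.
rewrite !big_nat_recr//= ih.
have [d0|[d1 tn]] := dind01 k n e.
  by rewrite d0 !mul0r addr0 /exp_neg maxxx mulr0 expR0 mulr1.
rewrite big_nat big1 ?addr0 => [|i /andP[_ ni]]; last by rewrite (dind_disj tn)// mul0r.
by rewrite d1 !mul1r add0r addrC subrK.
Qed.

Let hk01 n (l : nat -> R) k (e : R) : (forall i, 0 <= l i) -> 0 <= hk n l k e <= 1.
Proof.
by move=> l0; rewrite -hkE; apply: prod_itv01 => i; exact: exp_neg_itv01.
Qed.

Let mdind k i : measurable_fun setT (dind k i).
Proof. by apply: measurable_funB; exact: mind. Qed.

Let mexpm l : measurable_fun setT (fun e => exp_neg l (m (odd_digits e))).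
Proof.
apply: (measurableT_comp (measurable_exp_neg l)).
exact: (measurableT_comp mm measurable_odd_digits).
Qed.

Let mhk n (l : nat -> R) k : measurable_fun setT (hk n l k).
Proof.
apply: measurable_funD => //; apply: measurable_sum => i.
by apply: measurable_funM; [exact: mdind|apply: measurable_funB].
Qed.

(** The length of the part of [k, k + 1] that lies before [s]. *)
Let len (k : nat) (s : R) : R := if s <= k%:R then 0 else if s <= k%:R + 1 then s - k%:R else 1.

Let Rintegral_ind k s : \int[unif]_p (k%:R + p < s)%R%:R = len k s.
Proof.
have mb : measurable_fun setT (fun p : R => (s - k%:R < p)%R%:R : R).
  by apply: measurable_natr_bool; exact: measurable_fun_ltr.
rewrite (ae_eq_Rintegral (m := unif) (g := fun p => 1 * 1 + (-1) * (s - k%:R < p)%R%:R)).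
- have b1 (x : R) : `|cst 1 x : R| <= 1 by rewrite normr1.
  have b2 (x : R) : `|(s - k%:R < x)%R%:R : R| <= 1.
    by rewrite normr_nat; case: ltP; rewrite ?ler01.
  rewrite (Rintegral_lin2 unif 1 (-1) (measurable_cst (1 : R)) mb b1 b2).
  rewrite Rintegral_prob_cst.
  transitivity (1 * 1 + (-1) * \int[unif]_u (\1_(`]s - k%:R, +oo[%classic) u : R)).
    congr (_ + _ * _).
    by apply: eq_Rintegral => u _; rewrite indicE; congr (nat_of_bool _)%:R;
      apply/idP/idP; rewrite inE/= in_itv/= andbT.
  rewrite Rintegral_indic//; have -> := congr1 fine (unif_ray (s - k%:R)).
  rewrite /= /len.
  by repeat case: ltP => ?; repeat case: leP => ?; lra.
- apply: measurable_natr_bool; apply: measurable_fun_ltr => //.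
  exact: measurable_funD.
- by apply: measurable_funD => //; apply: measurable_funM.
- exists [set s - k%:R]; split => //; first exact: unif_set1.
  move=> p /=; apply: contra_notP => psk.
  case: (ltgtP (s - k%:R) p) => h; last by case: psk.
  + by rewrite (_ : _ < s = false) ?mulr1 ?subrr//; apply/negP; lra.
  + by rewrite (_ : _ < s = true) ?mulr0 ?addr0 ?mulr1//; lra.
Qed.

Let len_sum K s : 0 <= s -> s <= K%:R -> \sum_(0 <= k < K) len k s = s.
Proof.
move=> s0 sK; suff -> : \sum_(0 <= k < K) len k s = Num.min s K%:R by rewrite min_l.
elim: K {sK} => [|K ih]; first by rewrite big_nil min_r.
rewrite big_nat_recr//= ih /len -natr1.
by repeat case: leP => ?; lra.
Qed.

Let ind01 k s e : 0 <= ind k s e <= 1.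
Proof. by rewrite /ind ler0n lern1 leq_b1. Qed.

Let Rintegral_hk n (l : nat -> R) k : (forall i, 0 <= l i) ->
  \int[unif]_e hk n l k e = 1 + \sum_(0 <= i < n)
    (len k (t i.+1)%:num - len k (t i)%:num) * (L (l i) - 1).
Proof.
move=> l0.
have e01 i (v : R) : 0 <= exp_neg (l i) (m v) <= 1 by exact: exp_neg_itv01.
have d1 i e : `|dind k i e * (exp_neg (l i) (m (odd_digits e)) - 1)| <= 1.
  rewrite normrM mulr_ile1// ?normr_ge0//.
    by have [->|[-> _]] := dind01 k i e; rewrite ?normr0 ?normr1 ?ler01.
  have /andP[a b] := e01 i (odd_digits e).
  by rewrite ler_norml; apply/andP; split; lra.
have md i : measurable_fun setT (fun e => dind k i e * (exp_neg (l i) (m (odd_digits e)) - 1)).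
  by apply: measurable_funM; [exact: mdind|apply: measurable_funB].
have iS s i : \int[unif]_e (ind k s e * exp_neg (l i) (m (odd_digits e))) = len k s * L (l i).
  rewrite -Rintegral_ind /L -digits_indep//.
  - apply: measurable_natr_bool; apply: measurable_fun_ltr => //.
    exact: measurable_funD.
  - exact: (measurableT_comp (measurable_exp_neg _) mm).
  - by move=> x; rewrite ler0n lern1 leq_b1.
have iS1 s : \int[unif]_e ind k s e = len k s.
  transitivity (\int[unif]_e (ind k s e * cst 1 (odd_digits e))).
    by apply: eq_Rintegral => e _; rewrite mulr1.
  rewrite (digits_indep (f := fun p => (k%:R + p < s)%R%:R) (g := cst 1)).
  - by rewrite Rintegral_ind Rintegral_prob_cst mulr1.
  - apply: measurable_natr_bool; apply: measurable_fun_ltr => //.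
    exact: measurable_funD.
  - exact: measurable_cst.
  - by move=> x; rewrite ler0n lern1 leq_b1.
  - by move=> x; rewrite ler01 lexx.
rewrite /hk.
transitivity (1 + \int[unif]_e \sum_(0 <= i < n)
    dind k i e * (exp_neg (l i) (m (odd_digits e)) - 1)).
  have := Rintegral_lin2 unif 1 1 (measurable_cst (1 : R))
    (measurable_sum (index_iota 0 n) (fun i => md i)) (C := 1)
    (D := \sum_(0 <= i < n) 1) _ _.
  rewrite !mul1r Rintegral_prob_cst => <-.
  - by apply: eq_Rintegral => e _; rewrite !mul1r.
  - by move=> ?; rewrite /= normr1.
  - by move=> e; apply: le_trans (ler_norm_sum _ _ _) _; apply: ler_sum => i _.
congr (_ + _); rewrite (@Rintegral_sum _ _ _ unif _ _ _ (fun=> 1))//; apply: eq_bigr => i _.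
have mi s : measurable_fun setT (fun e => ind k s e * exp_neg (l i) (m (odd_digits e))).
  by apply: measurable_funM => //; exact: mind.
have bi s e : `|ind k s e * exp_neg (l i) (m (odd_digits e))| <= 1.
  have /andP[a b] := ind01 k s e; have /andP[c d] := e01 i (odd_digits e).
  by rewrite ger0_norm ?mulr_ge0// mulr_ile1.
have bi1 s e : `|ind k s e| <= 1 by apply: itv01_norm => x; exact: ind01.
transitivity (\int[unif]_e (1 * (1 * (ind k (t i.+1)%:num e * exp_neg (l i) (m (odd_digits e))) +
      (-1) * (ind k (t i)%:num e * exp_neg (l i) (m (odd_digits e)))) +
      (-1) * (1 * ind k (t i.+1)%:num e + (-1) * ind k (t i)%:num e))).
  by apply: eq_Rintegral => e _; rewrite /dind; ring.
have b2 (f g : R -> R) : (forall e, `|f e| <= 1) -> (forall e, `|g e| <= 1) ->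
    forall e, `|1 * f e + (-1) * g e| <= 2.
  move=> hf hg e; rewrite mul1r mulN1r (le_trans (ler_normB _ _))//.
  by have := hf e; have := hg e; lra.
rewrite (Rintegral_lin2 unif _ _ _ _ (b2 _ _ (bi _) (bi _)) (b2 _ _ (bi1 _) (bi1 _))).
- rewrite (Rintegral_lin2 unif _ _ (mi _) (mi _) (bi _) (bi _)).
  rewrite (Rintegral_lin2 unif _ _ (mind _ _) (mind _ _) (bi1 _) (bi1 _)).
  by rewrite !iS !iS1; ring.
- by apply: measurable_funD; apply: measurable_funM => //; exact: mi.
- by apply: measurable_funD; apply: measurable_funM => //; exact: mind.
Qed.

(** Exchanging products turns the integrand into a product over independent cells of products over
    points with factors [hk]. Each cell gives an exponential, and the exponents add up to the
    interval lengths. The formula contains both the independence and the laws of the increments. *)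
Lemma process_increments_laplace n (l : nat -> R) : (forall i, 0 <= l i) ->
  \int[unif]_w \prod_(0 <= i < n) exp_neg (l i) (D i w) =
  \prod_(0 <= i < n) expR (((t i.+1)%:num - (t i)%:num) * (L (l i) - 1)).
Proof.
move=> l0; have [K /ltW tK] : exists K : nat, (t n)%:num < K%:R.
  by exists (Num.bound (t n)%:num); exact: archi_boundP.
have tiK i : (i <= n)%N -> (t i)%:num <= K%:R.
  move=> ni; apply: le_trans tK.
  by apply: (homo_leq (r := fun a b : {nonneg R} => a%:num <= b%:num)) => // a b c; exact: le_trans.
pose H k (c : R) := \prod_(0 <= j < count (even_digits c)) hk n l k (points j c).
have exp_neg_sum (I : Type) (s : seq I) a (f : I -> R) : (forall x, 0 <= f x) ->
    exp_neg a (\sum_(x <- s) f x) = \prod_(x <- s) exp_neg a (f x).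
  move=> f0; elim: s => [|x s ih]; first by rewrite !big_nil /exp_neg maxxx mulr0 expR0.
  by rewrite !big_cons exp_negD ?ih// sumr_ge0.
have d0 k i e : 0 <= dind k i e * m (odd_digits e).
  by apply: mulr_ge0 => //; have [->|[-> _]] := dind01 k i e.
transitivity (\int[unif]_w \prod_(0 <= k < K) H k (uniforms k w)).
  apply: eq_Rintegral => w _.
  transitivity (\prod_(0 <= i < n) \prod_(0 <= k < K)
      \prod_(0 <= j < count (even_digits (uniforms k w)))
      exp_neg (l i) (dind k i (points j (uniforms k w)) * m (odd_digits (points j (uniforms k w))))).
    rewrite big_nat [RHS]big_nat; apply: eq_bigr => i /andP[_ ni].
    rewrite (DE w tK)// exp_neg_sum => [|k]; last by apply: sumr_ge0.
    by apply: eq_bigr => k _; rewrite exp_neg_sum.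
  rewrite exchange_big; apply: eq_bigr => k _; rewrite exchange_big.
  by apply: eq_bigr => j _; rewrite hkE.
rewrite uniforms_iid.
- transitivity (\prod_(0 <= k < K) expR (\int[unif]_e hk n l k e - 1)).
    by apply: eq_bigr => k _; rewrite /H Rintegral_cell// => e; exact: hk01.
  rewrite -[LHS]expR_sum -[RHS]expR_sum; congr expR.
  under eq_bigr do rewrite Rintegral_hk// addrC addKr.
  rewrite exchange_big big_nat [RHS]big_nat; apply: eq_bigr => i /andP[_ ni].
  by rewrite -big_distrl/= sumrB !len_sum// ?tiK// ltnW.
- move=> k; pose f M (c : R) := \prod_(0 <= j < M)
    (if (j < count (even_digits c))%N then hk n l k (points j c) else 1).
  apply: (measurable_fun_cvg (h := f)) => [M|c _].
    apply: measurable_prod => j _; apply: measurable_fun_ifT => //.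
      exact: (measurableT_comp (measurable_ltn_count j) measurable_even_digits).
    exact: (measurableT_comp (mhk n l k) (measurable_points j)).
  apply: (cvgn_near_cst (N := count (even_digits c))) => M cM.
  rewrite /f (big_cat_nat (leq0n _) cM)//=.
  rewrite [X in _ * X](_ : _ = 1) ?mulr1; last first.
    by rewrite big_nat big1// => j /andP[cj _]; rewrite ltnNge cj.
  by rewrite /H big_nat [RHS]big_nat; apply: eq_bigr => j /andP[_ ->].
- by move=> k c; apply: prod_itv01 => j; exact: hk01.
Qed.

End increments.

Let mu : probability R R := distribution unif m.

Let mu_ge0 : mu (~` `[0, +oo[%classic) = 0%E.
Proof.
rewrite -[LHS]/(unif (m @^-1` ~` `[0, +oo[%classic)) (_ : _ @^-1` _ = set0) ?measure0//.
by apply/seteqP; split => // v /=; rewrite in_itv/= m_ge0.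
Qed.

Let mu_laplace l : 0 <= l -> \int[unif]_v exp_neg l (m v) = \int[mu]_x exp_neg l x.
Proof.
move=> l0; rewrite /Rintegral [in RHS]ge0_integral_distribution//.
- by apply/measurable_EFinP; exact: measurable_exp_neg.
- by move=> x; rewrite lee_fin; case/andP: (exp_neg_itv01 x l0).
Qed.

Section joint_law.
Variable t : nat -> {nonneg R}.
Hypothesis t_homo : forall i, (t i)%:num <= (t i.+1)%:num.

Let D i w := Z (t i.+1) w - Z (t i) w.

Let mD i : measurable_fun setT (D i).
Proof. exact: measurable_funB. Qed.

(** The joint Laplace transform becomes joint probabilities by [eq_multi_kernel], which compares the
    point masses at the increments with constant kernels. *)
Lemma process_increments_law n (B : nat -> set R) : (forall i, measurable (B i)) ->
  fine (unif (\bigcap_(i in [set i | (i < n)%N]) D i @^-1` B i)) =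
  \prod_(0 <= i < n) fine (compound_poisson ((t i.+1)%:num - (t i)%:num) mu (B i)).
Proof.
move=> mB.
have s0 i : 0 <= (t i.+1)%:num - (t i)%:num by rewrite subr_ge0.
pose k1 (i : nat) (w : R) : subprobability R R := giry_ret (D i w).
pose k2 (i : nat) (w : R) : subprobability R R :=
  compound_poisson ((t i.+1)%:num - (t i)%:num) mu.
have mk1 i A : measurable A -> measurable_fun setT (fun w => k1 i w A).
  move=> mA; apply: (measurableT_comp (measurable_giry_ev (R := R) mA)).
  by apply: measurableT_comp => //; exact: measurable_giry_ret.
have mk2 i A : measurable A -> measurable_fun setT (fun w => k2 i w A).
  by move=> mA; exact: measurable_cst.
have := @eq_multi_kernel _ _ _ R R unif unif nat nat 0%N k1 k2 mk1 mk2
  (`[0, +oo[%classic) (fun j => exp_neg j%:R) (measurable_itv _) _ _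
  (fun j => measurable_exp_neg j%:R) (fun j x => exp_neg_itv01 x (ler0n _ j)) _
  (index_iota 0 n) (iota_uniq _ _).
move=> /(_ _ _ _ _ B mB) H.
have k1E i w A : fine (k1 i w A) = (D i w \in A)%:R by [].
transitivity (\int[unif]_x \prod_(0 <= i < n) fine (k1 i x (B i))).
  rewrite -Rintegral_indic; last first.
    apply: bigcap_measurableType => // i _.
    by rewrite -[X in measurable X]setTI; apply: mD.
  apply: eq_Rintegral => w _; rewrite indicE.
  case: (pselect (forall i, (i < n)%N -> B i (D i w))) => [Bw|nBw].
    rewrite mem_set => [|i /= ni]; last exact: Bw.
    rewrite big_nat big1// => i /andP[_ ni].
    by rewrite k1E mem_set//; exact: Bw.
  rewrite memNset => [|Bw]; last by apply: nBw => i ni; exact: Bw.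
  move/existsNP : nBw => [i /not_implyP[ni nB]].
  rewrite (bigD1_seq i)//= ?mem_index_iota ?iota_uniq//.
  by rewrite [\1_(B i) _]indicE memNset// mul0r.
rewrite H.
- exact: (Rintegral_prob_cst unif (\prod_(0 <= i < n)
    fine (compound_poisson ((t i.+1)%:num - (t i)%:num) mu (B i)))).
- move=> i; apply: aeW => w; rewrite /k1 /giry_ret/= diracE memNset//= in_itv/= andbT.
  by move=> H'; apply: H'; exact: (process_increment_ge0 t_homo).
- by move=> i; apply: aeW => w; exact: compound_poisson_ge0.
- by move=> m1 m2 m10 m20 E; apply: eq_from_laplace.
- move=> j; transitivity (\int[unif]_w \prod_(0 <= i < n) exp_neg (j i)%:R (D i w)).
    apply: eq_Rintegral => w _; apply: eq_bigr => i _.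
    by rewrite Rintegral_dirac_giry//; exact: measurable_exp_neg.
  rewrite (process_increments_laplace t_homo n (fun i => ler0n R (j i))).
  rewrite -[LHS](Rintegral_prob_cst unif); apply: eq_Rintegral => w _.
  apply: eq_bigr => i _.
  rewrite mu_laplace//; apply: esym.
  exact: (compound_poisson_laplace mu_ge0 (s0 i) (ler0n R (j i))).
Qed.

End joint_law.

Let Y : {nonneg R} -> {RV (@unif R) >-> R} := fun t => Z t.

Let Z0 w : Z 0%:nng w = 0. Proof. by rewrite /Z ceil0 big_nil. Qed.

Let single (s t : {nonneg R}) (i : nat) : {nonneg R} := if i is 0 then s else t.

Lemma process_increment_law (s t : {nonneg R}) B : s%:num <= t%:num -> measurable B ->
  unif (increment Y s t @^-1` B) = compound_poisson (t%:num - s%:num) mu B.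
Proof.
move=> st mB; have mI : measurable (increment Y s t @^-1` B).
  by rewrite -[X in measurable X]setTI; apply: (measurable_funB (mZ t) (mZ s)).
have h i : (single s t i)%:num <= (single s t i.+1)%:num by case: i => /=.
have := process_increments_law h 1 (fun=> mB); rewrite big_nat1.
rewrite (_ : \bigcap_(i in _) _ = increment Y s t @^-1` B); last first.
  apply/seteqP; split => w /=; first by move=> /(_ 0%N); exact.
  by move=> H [].
move=> H; rewrite -[LHS]fineK ?fin_num_measure// H fineK//.
exact: (fin_num_measure (compound_poisson (t%:num - s%:num) mu)).
Qed.

Lemma compound_poisson_process_levy : levy_process Y.
Proof.
have CPfin s B : measurable B -> (compound_poisson s mu B) \is a fin_num.
  by move=> mB; exact: (fin_num_measure (compound_poisson s mu)).
split.
- by apply: aeW; exact: Z0.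
- move=> s t h B mB.
  have E (u : {nonneg R}) : unif (increment Y u (u%:num + h%:num)%:nng @^-1` B) =
      compound_poisson h%:num mu B.
    have le : u%:num <= ((u%:num + h%:num)%:nng)%:num by rewrite /= lerDl.
    have e : ((u%:num + h%:num)%:nng)%:num - u%:num = h%:num by rewrite /= addrC addKr.
    by rewrite (process_increment_law le mB) e.
  by rewrite !E.
- move=> n t t_homo B mB.
  pose B' (i : nat) := if insub i is Some j then B j else setT.
  have B'E (i : 'I_n) : B' i = B i by rewrite /B' valK.
  have mB' i : measurable (B' i) by rewrite /B'; case: insub.
  have mI : measurable (\bigcap_(i in [set: 'I_n]) (increment Y (t i) (t i.+1) @^-1` B i)).
    apply: fin_bigcap_measurable => // i _.
    by rewrite -[X in measurable X]setTI; apply: (measurable_funB (mZ _) (mZ _)).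
  rewrite -[LHS]fineK ?fin_num_measure//.
  rewrite (_ : \bigcap_i _ = \bigcap_(i in [set i | (i < n)%N])
      ((fun w => Z (t i.+1) w - Z (t i) w) @^-1` B' i)); last first.
    apply/seteqP; split => w /= H i.
      by move=> /= ni; have := H (Ordinal ni) I; rewrite -B'E.
    by move=> _; have /= := H i (ltn_ord i); rewrite B'E.
  rewrite process_increments_law// big_mkord.
  under [in RHS]eq_bigr => i _ do rewrite process_increment_law// -B'E -(fineK (CPfin _ _ (mB' i))).
  by rewrite prodEFin.
(* An increment over a length h is nonzero with probability at most 1 - exp (- h) <= h, so [eta]
   itself serves as the radius, whatever [eps] is. *)
- move=> t eps eta e0 n0; exists eta => // s st.
  wlog le_st : s t st / s%:num <= t%:num.
    move=> W; case: (leP s%:num t%:num) => [|/ltW] ts; first exact: W.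
    have := W t s; rewrite distrC => /(_ st ts).
    by under [X in (unif X < _)%E -> _]eq_set do rewrite distrC.
  have dt : 0 <= t%:num - s%:num by rewrite subr_ge0.
  have mI : measurable (increment Y s t @^-1` [set 0]).
    by rewrite -[X in measurable X]setTI; apply: (measurable_funB (mZ t) (mZ s)).
  apply: (@le_lt_trans _ _ (unif (~` (increment Y s t @^-1` [set 0])))).
    apply: le_measure; rewrite ?inE.
    - rewrite (_ : [set w | _] = (increment Y t s) @^-1` ((fun x => `|x|) @^-1` `]eps, +oo[%classic)).
        rewrite -[X in measurable X]setTI; apply: (measurable_funB (mZ s) (mZ t)) => //.
        by rewrite -[X in measurable X]setTI; apply: normr_measurable.
      by apply/seteqP; split => w /=; rewrite in_itv/= andbT.
    - exact: measurableC.
    - move=> w /= + H; rewrite distrC -[_ - _]/(increment Y s t w) H normr0.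
      by move=> /(lt_trans e0); rewrite ltxx.
  rewrite probability_setC// process_increment_law//.
  rewrite -[X in (_ - X)%E](fineK (CPfin _ _ _))// -EFinB lte_fin.
  have := compound_poisson_set0 mu dt; have := expR_ge1Dx (- (t%:num - s%:num)).
  by move: st; rewrite distrC ger0_norm//; lra.
Qed.

Lemma compound_poisson_levy_law : exists g : levy_law R,
  (forall t B, measurable B -> marginal t g B = compound_poisson t%:num mu B) /\
  (forall (t : nat -> {nonneg R}) n (l : nat -> R),
    (forall i, (t i)%:num <= (t i.+1)%:num) -> (forall i, 0 <= l i) ->
    \int[levy_law_val g]_w \prod_(0 <= i < n) exp_neg (l i) (w (t i.+1) - w (t i)) =
    \prod_(0 <= i < n) expR (((t i.+1)%:num - (t i)%:num) *
      (\int[unif]_v exp_neg (l i) (m v) - 1))).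
Proof.
have lY : is_levy_law (law Y).
  by exists _, _, unif, Y; split; [exact: compound_poisson_process_levy|].
exists (LevyLaw lY); split => [t B mB|t n l t_homo l0].
  rewrite (law_marginal (P := unif) (X := Y))//.
  have -> : t%:num = t%:num - (0 : R) by rewrite subr0.
  rewrite -(process_increment_law (s := 0%:nng))//=.
  have -> // : increment Y 0%:nng t @^-1` B = Y t @^-1` B.
  by apply/seteqP; split => w; rewrite /= /increment; have -> : Y 0%:nng w = 0 := Z0 w;
    rewrite subr0.
rewrite -process_increments_laplace//.
rewrite /Rintegral [in LHS]ge0_integral_distribution//.
- apply/measurable_EFinP; apply: measurable_prod => i _.
  exact: (measurableT_comp (measurable_exp_neg (l i)) (measurable_increment _ _)).
- move=> w; rewrite lee_fin; apply: prodr_ge0 => i _.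
  by case/andP: (exp_neg_itv01 (w (t i.+1) - w (t i)) (l0 i)).
Qed.

End compound_poisson_process.

(** * Jumps in {0, 1, 2, 3} *)

Section counterexample_laws.
Context {R : realType}.

Lemma squeeze1 (u v : nat -> R) : u @ \oo --> (1 : R) -> (forall n, u n <= v n <= 1) ->
  v @ \oo --> (1 : R).
Proof.
move=> u1 uv; apply: (@squeeze_cvgr _ _ _ _ u (cst 1)) => //; last exact: cvg_cst.
exact: nearW.
Qed.

(** No antiderivative is used: a psi(a) / (1 - exp (- a)) is unchanged when [a] is halved, and along
    the halvings both psi(h) and (1 - exp (- h)) / h tend to 1. *)
Lemma unif_laplace (a : R) : 0 < a ->
  a * \int[unif]_x exp_neg a x = 1 - expR (- a).
Proof.
move=> a0; pose psi (a : R) := \int[unif]_x exp_neg a x.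
pose h m := a / 2 ^+ m.
have h0 m : 0 < h m by rewrite divr_gt0// exprn_gt0.
have hS m : h m = 2 * h m.+1 by rewrite /h exprS invfM; field; rewrite expf_neq0.
have E m : a * psi a * (1 - expR (- h m)) = (1 - expR (- a)) * (h m * psi (h m)).
  elim: m => [|m ih]; first by rewrite /h expr0 divr1 mulrC.
  have e0 : 1 + expR (- h m.+1) != 0 by rewrite gt_eqF// ltr_pwDl// expR_ge0.
  apply: (mulIf e0); move: ih.
  have -> : psi (h m) = 2^-1 * (1 + expR (- h m.+1)) * psi (h m.+1).
    rewrite /psi (unif_laplace_split (ltW (h0 m))).
    have -> : h m / 2 = h m.+1 by rewrite hS; field.
    by [].
  have -> : expR (- h m) = expR (- h m.+1) * expR (- h m.+1).
    by rewrite -expRD; congr expR; rewrite hS; ring.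
  rewrite (hS m) => ih.
  rewrite -[LHS]mulrA (_ : (1 - _) * (1 + _) = 1 - expR (- h m.+1) * expR (- h m.+1)); last by ring.
  by rewrite ih; field.
have hc : h @ \oo --> (0 : R).
  rewrite -[X in _ --> X](mulr0 a); apply: cvgM; first exact: cvg_cst.
  rewrite (_ : (fun n => _) = (fun n => (2^-1 : R) ^+ n)); last first.
    by apply/funext => n; rewrite exprVn.
  by apply: cvg_expr; rewrite ger0_norm//; lra.
have ec : (fun m => expR (- h m)) @ \oo --> (1 : R).
  by rewrite -[X in _ --> X](@expR0 R) -[X in expR X]oppr0; apply: cvg_expR; exact: cvgN.
have q1 : (fun m => (1 - expR (- h m)) / h m) @ \oo --> (1 : R).
  apply: (squeeze1 ec) => m.
  rewrite ler_pdivlMr// ler_pdivrMr// mul1r; apply/andP; split.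
    have := expR_ge1Dx (h m); rewrite -(ler_pM2l (expR_gt0 (- h m))) -expRD addNr expR0.
    by lra.
  by have := expR_ge1Dx (- h m); lra.
have p1 : (fun m => psi (h m)) @ \oo --> (1 : R).
  apply: (squeeze1 ec) => m; apply/andP; split.
    rewrite -[X in X <= _](Rintegral_prob_cst unif); apply: le_Rintegral_unif.
    - by move=> _; rewrite expR_ge0/= -expR0 ler_expR oppr_le0 ltW.
    - by move=> x; exact: exp_neg_itv01 (ltW _).
    - exact: measurable_cst.
    - exact: measurable_exp_neg.
    - move=> x /andP[x0 x1]; rewrite /exp_neg ler_expR max_l// mulNr lerN2.
      by rewrite ler_piMr// ltW.
  have /andP[] // := Rintegral_itv01 unif (measurable_exp_neg (h m))
    (fun x => exp_neg_itv01 x (ltW (h0 m))).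
have L1 : (fun m => a * psi a * ((1 - expR (- h m)) / h m)) @ \oo --> a * psi a * 1.
  by apply: cvgM => //; exact: cvg_cst.
have L2 : (fun m => (1 - expR (- a)) * psi (h m)) @ \oo --> (1 - expR (- a)) * 1.
  by apply: cvgM => //; exact: cvg_cst.
have L12 : (fun m => a * psi a * ((1 - expR (- h m)) / h m)) =
    (fun m => (1 - expR (- a)) * psi (h m)).
  apply/funext => m; have hm : h m != 0 by rewrite gt_eqF.
  by rewrite mulrA E; field.
rewrite L12 !mulr1 in L1; rewrite !mulr1 in L2.
exact: (cvg_unique (@Rhausdorff R) L1 L2).
Qed.

(** The quantile function of a perturbed uniform law on {0, 1, 2, 3}: the thresholds i / 4 are moved
    by x_i / 8, which keeps them in order for |x_i| <= 1. Moving threshold i adds (1 - z) z^(i - 1)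
    x_i / 8 to the generating function. *)
Definition mark (x1 x2 x3 v : R) : R :=
  ((1 / 4 + x1 / 8 <= v)%R%:R + (2 / 4 + x2 / 8 <= v)%R%:R + (3 / 4 + x3 / 8 <= v)%R%:R).

Lemma measurable_mark x1 x2 x3 : measurable_fun setT (mark x1 x2 x3).
Proof.
by apply: measurable_funD; [apply: measurable_funD|];
  apply: measurable_natr_bool; exact: measurable_fun_ler.
Qed.

HB.instance Definition _ x1 x2 x3 := isMeasurableFun.Build _ _ R R (mark x1 x2 x3)
  (measurable_mark x1 x2 x3).

Definition mark_law (x1 x2 x3 : R) : probability R R := distribution unif (mark x1 x2 x3).

Lemma mark_ge0 x1 x2 x3 v : 0 <= mark x1 x2 x3 v.
Proof. by rewrite /mark !addr_ge0. Qed.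

Lemma mark_values x1 x2 x3 v : [set (0 : R); 1; 2; 3] (mark x1 x2 x3 v).
Proof.
rewrite /mark; case: (1 / 4 + x1 / 8 <= v); case: (2 / 4 + x2 / 8 <= v);
  case: (3 / 4 + x3 / 8 <= v) => /=.
all: rewrite ?addr0 ?add0r; try by right; lra.
all: left; try by right; lra.
all: left; try by right; lra.
all: by left; lra.
Qed.

Let Rintegral_leq (c : R) : 0 <= c <= 1 -> \int[unif]_v (c <= v)%R%:R = 1 - c.
Proof.
move=> /andP[c0 c1]; transitivity (\int[unif]_v (c < v)%R%:R).
  apply: ae_eq_Rintegral.
  - by apply: measurable_natr_bool; exact: measurable_fun_ler.
  - by apply: measurable_natr_bool; exact: measurable_fun_ltr.
  - exists [set c]; split => //; first exact: unif_set1.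
    by move=> v /=; apply: contra_notP => vc; rewrite le_eqVlt; case: eqP => // cv; case: vc.
move: c1; rewrite le_eqVlt => /orP[/eqP ->|c1]; last by rewrite Rintegral_unif_ltn// c0.
rewrite subrr (ae_eq_Rintegral (m := unif) (g := cst 0)).
- exact: Rintegral_prob_cst.
- by apply: measurable_natr_bool; exact: measurable_fun_ltr.
- exact: measurable_cst.
- by apply: filterS unif_ae => v /andP[_ v1]; rewrite ltNge (ltW v1).
Qed.

Lemma Rintegral_mark x1 x2 x3 (F : R -> R) :
  -1 <= x1 <= 1 -> -1 <= x2 <= 1 -> -1 <= x3 <= 1 ->
  \int[unif]_v F (mark x1 x2 x3 v) = F 0 + (F 1 - F 0) * (3 / 4 - x1 / 8) +
    (F 2 - F 1) * (2 / 4 - x2 / 8) + (F 3 - F 2) * (1 / 4 - x3 / 8).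
Proof.
move=> h1 h2 h3.
pose I (c v : R) : R := (c <= v)%R%:R.
have mI c : measurable_fun setT (I c) by apply: measurable_natr_bool; exact: measurable_fun_ler.
have bI c v : `|I c v| <= 1 by rewrite /I normr_nat lern1 leq_b1.
pose c1 := 1 / 4 + x1 / 8; pose c2 := 2 / 4 + x2 / 8; pose c3 := 3 / 4 + x3 / 8.
have E v : F (mark x1 x2 x3 v) = 1 * (F 0 * 1 + (F 1 - F 0) * I c1 v) +
    1 * ((F 2 - F 1) * I c2 v + (F 3 - F 2) * I c3 v).
  rewrite /mark /I -/c1 -/c2 -/c3.
  case: (leP c1 v) => v1; case: (leP c2 v) => v2; case: (leP c3 v) => v3; rewrite /= ?mulr1n ?mulr0n.
  - by rewrite (_ : 1 + 1 + 1 = 3 :> R); [ring|lra].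
  - by rewrite (_ : 1 + 1 + 0 = 2 :> R); [ring|lra].
  - by exfalso; move: v2 v3; rewrite /c2 /c3; lra.
  - by rewrite (_ : 1 + 0 + 0 = 1 :> R); [ring|lra].
  - by exfalso; move: v1 v2; rewrite /c1 /c2; lra.
  - by exfalso; move: v1 v2; rewrite /c1 /c2; lra.
  - by exfalso; move: v1 v3; rewrite /c1 /c3; lra.
  - by rewrite (_ : 0 + 0 + 0 = 0 :> R); [ring|lra].
have b1 (x : R) : `|cst 1 x : R| <= 1 by rewrite normr1.
have b2 (s t : R) (f g : R -> R) : (forall v, `|f v| <= 1) -> (forall v, `|g v| <= 1) ->
    forall v, `|s * f v + t * g v| <= `|s| + `|t|.
  move=> hf hg v; rewrite (le_trans (ler_normD _ _))// lerD// normrM ler_piMr//.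
have m2 (s t : R) (f g : R -> R) : measurable_fun setT f -> measurable_fun setT g ->
    measurable_fun setT (fun v => s * f v + t * g v).
  by move=> mf mg; apply: measurable_funD; apply: measurable_funM.
have m1 : measurable_fun setT (cst (1 : R) : R -> R) by exact: measurable_cst.
under eq_Rintegral do rewrite E.
rewrite (Rintegral_lin2 unif 1 1 (m2 (F 0) (F 1 - F 0) _ _ m1 (mI c1))
  (m2 (F 2 - F 1) (F 3 - F 2) _ _ (mI c2) (mI c3)) (b2 _ _ _ _ b1 (bI c1))
  (b2 _ _ _ _ (bI c2) (bI c3))).
rewrite (Rintegral_lin2 unif (F 0) (F 1 - F 0) m1 (mI c1) b1 (bI c1)).
rewrite (Rintegral_lin2 unif _ _ (mI c2) (mI c3) (bI c2) (bI c3)).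
rewrite Rintegral_prob_cst !Rintegral_leq /c1 /c2 /c3; first by field.
- by apply/andP; split; lra.
- by apply/andP; split; lra.
- by apply/andP; split; lra.
Qed.

Lemma mark_laplace x1 x2 x3 l :
  -1 <= x1 <= 1 -> -1 <= x2 <= 1 -> -1 <= x3 <= 1 ->
  \int[unif]_v exp_neg l (mark x1 x2 x3 v) - 1 =
  let z := expR (- l) in
  (z - 1) * (3 / 4) + (z ^+ 2 - z) * (2 / 4) + (z ^+ 3 - z ^+ 2) * (1 / 4) +
  (1 - z) / 8 * (x1 + x2 * z + x3 * z ^+ 2).
Proof.
move=> h1 h2 h3; rewrite Rintegral_mark//=.
have E (n : nat) : exp_neg l n%:R = expR (- l) ^+ n.
  by rewrite /exp_neg max_l// -expRM_natr.
by rewrite (E 0%N) (E 1%N) (E 2%N) (E 3%N) expr0 expr1; field.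
Qed.

Lemma supported_mark_law x1 x2 x3 :
  supported_in [set (0 : R); 1; 2; 3] (mark_law x1 x2 x3).
Proof.
exists (~` [set (0 : R); 1; 2; 3]); split => //.
  by apply: measurableC; do 3 (apply: measurableU => //).
rewrite -[LHS]/(unif (mark x1 x2 x3 @^-1` ~` [set (0 : R); 1; 2; 3])).
rewrite (_ : _ @^-1` _ = set0) ?measure0//.
by apply/seteqP; split => // v /=; apply; exact: mark_values.
Qed.

Section measurable_family.
Context {d} {T : measurableType d} (x1 x2 x3 : T -> R).
Hypotheses (m1 : measurable_fun setT x1) (m2 : measurable_fun setT x2)
  (m3 : measurable_fun setT x3).
Hypotheses (h1 : forall w, -1 <= x1 w <= 1) (h2 : forall w, -1 <= x2 w <= 1)
  (h3 : forall w, -1 <= x3 w <= 1).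

(** A jump takes only four values, so one convolution step is a finite sum with coefficients affine
    in the parameters, and measurability passes through the induction. *)
Lemma measurable_convpow_mark n B : measurable B ->
  measurable_fun setT (fun w => fine (convpow (mark_law (x1 w) (x2 w) (x3 w)) n B)).
Proof.
elim: n B => [|n ih] B mB; first exact: measurable_cst.
pose nu w := convpow (mark_law (x1 w) (x2 w) (x3 w)) n.
have mS (y : R) : measurable ((fun x : R => y + x) @^-1` B).
  by rewrite -[X in measurable X]setTI; apply: measurable_funD.
pose G w y := fine (nu w ((fun x : R => y + x) @^-1` B)).
have GE w : fine (conv (mark_law (x1 w) (x2 w) (x3 w)) (nu w) B) =
    \int[unif]_v G w (mark (x1 w) (x2 w) (x3 w) v).
  have mB1 : measurable_fun setT (\1_B : R -> R) by exact: measurable_indic.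
  have B1 (x : R) : `|\1_B x : R| <= 1.
    by rewrite indicE normr_nat; case: (_ \in _); rewrite ?ler01.
  rewrite -(Rintegral_indic (conv _ _) mB) (conv_integral _ _ mB1 B1).
  transitivity (\int[mark_law (x1 w) (x2 w) (x3 w)]_y G w y).
    by apply: eq_Rintegral => y _; rewrite /G -(Rintegral_indic (nu w) (mS y)).
  have G01 y : 0 <= G w y <= 1 := subprobability_fine_itv (nu w) (mS y).
  rewrite /Rintegral [in LHS]ge0_integral_distribution//.
  - apply/measurable_EFinP.
    rewrite (_ : G w = fun y => \int[nu w]_x (\1_B (y + x) : R)).
      exact: measurable_Rintegral_shift.
    by apply/funext => y; rewrite /G -(Rintegral_indic (nu w) (mS y)).
  - by move=> y; rewrite lee_fin; case/andP: (G01 y).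
rewrite (_ : (fun w => _) = fun w => G w 0 + (G w 1 - G w 0) * (3 / 4 - x1 w / 8) +
    (G w 2 - G w 1) * (2 / 4 - x2 w / 8) + (G w 3 - G w 2) * (1 / 4 - x3 w / 8)); last first.
  by apply/funext => w; rewrite -[LHS]/(fine (conv _ (nu w) B)) GE Rintegral_mark.
have mG y : measurable_fun setT (fun w => G w y) by exact: ih.
have mx (c : R) (x : T -> R) : measurable_fun setT x ->
    measurable_fun setT (fun w => c - x w / 8).
  by move=> mx; apply: measurable_funB => //; apply: measurable_funM.
by apply: measurable_funD; [apply: measurable_funD; [apply: measurable_funD|]|] => //;
  apply: measurable_funM; try exact: measurable_funB; exact: mx.
Qed.

Lemma measurable_compound_poisson_mark (t : R) B : 0 <= t -> measurable B ->
  measurable_fun setT (fun w => compound_poisson t (mark_law (x1 w) (x2 w) (x3 w)) B).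
Proof.
move=> t0 mB.
rewrite (_ : (fun w => _) = fun w =>
    (fine (compound_poisson t (mark_law (x1 w) (x2 w) (x3 w)) B))%:E); last first.
  apply/funext => w; rewrite fineK//.
  exact: (fin_num_measure (compound_poisson t (mark_law (x1 w) (x2 w) (x3 w)))).
apply/measurable_EFinP.
apply: (measurable_fun_cvg (h := fun n w => series (fun k => expR (- t) * (t ^+ k / k`!%:R) *
   fine (convpow (mark_law (x1 w) (x2 w) (x3 w)) k B)) n)) => [n|w _].
  apply: measurable_sum => k; apply: measurable_funM => //.
  exact: measurable_convpow_mark.
exact: compound_poisson_measure.
Qed.

Definition mark_levy_law (w : T) : levy_space R :=
  sval (cid (compound_poisson_levy_law (m := mark (x1 w) (x2 w) (x3 w))
    (mark_ge0 (x1 w) (x2 w) (x3 w)))).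

Lemma mark_levy_lawE w t B : measurable B -> marginal t (mark_levy_law w) B =
  compound_poisson t%:num (mark_law (x1 w) (x2 w) (x3 w)) B.
Proof. by rewrite /mark_levy_law; case: cid => /= g [H _]; exact: H. Qed.

Lemma mark_levy_law_laplace w (t : nat -> {nonneg R}) n (l : nat -> R) :
  (forall i, (t i)%:num <= (t i.+1)%:num) -> (forall i, 0 <= l i) ->
  \int[levy_law_val (mark_levy_law w)]_p
    \prod_(0 <= i < n) exp_neg (l i) (p (t i.+1) - p (t i)) =
  \prod_(0 <= i < n) expR (((t i.+1)%:num - (t i)%:num) *
      (\int[unif]_v exp_neg (l i) (mark (x1 w) (x2 w) (x3 w) v) - 1)).
Proof. by rewrite /mark_levy_law; case: cid => /= g [_ H]; exact: H. Qed.

(** The laws are picked by choice, but the sigma-algebra looks at their marginals only, and these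
    are compound Poisson laws that depend measurably on the parameter. *)
Lemma measurable_mark_levy_law : measurable_fun setT mark_levy_law.
Proof.
apply: (measurability (@marginal_preimages R : set (set (levy_space R)))) => //.
move=> _ [_ [t _ [B mB <-]] <-]; rewrite setTI.
have mm : measurable_fun setT (fun w => marginal t (mark_levy_law w) : pprobability R R).
  apply: (measurability (@pset _ _ _ : set (set (pprobability R R)))) => //.
  move=> _ [_ [r r01] [Ys mYs <-]] <-.
  apply: emeasurable_fun_infty_o => //.
  rewrite (_ : (fun x => _) = fun w => compound_poisson t%:num (mark_law (x1 w) (x2 w) (x3 w)) Ys).
    exact: measurable_compound_poisson_mark.
  by apply/funext => w; exact: mark_levy_lawE.
by have := mm measurableT B mB; rewrite !setTI.
Qed.

Lemma LISPP_mark_levy_law w : LISPP (supported_in [set (0 : R); 1; 2; 3]) (mark_levy_law w).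
Proof.
apply/LISPP_compound_poissonP; exists (mark_law (x1 w) (x2 w) (x3 w)).
  exact: supported_mark_law.
by move=> A mA; exact: mark_levy_lawE.
Qed.

End measurable_family.

End counterexample_laws.

(** * From mixing measures to processes *)

Section coordinate_process.
Context {R : realType}.

Definition coord_process (P : probability (path_space R) R) (t : {nonneg R}) :
  {RV P >-> R} := Defs.coord t.

Let lev (g : levy_space R) : giry (path_space R) R := levy_law_val g.

Let mlev : measurable_fun setT lev.
Proof.
by apply: measurable_giry_codensity => // B mB; exact: measurable_levy_eval.
Qed.

Lemma mixture_exists (Theta : probability (levy_space R) R) :
  exists P : probability (path_space R) R, mixture_of_levy (coord_process P) Theta /\
    forall f : path_space R -> R, measurable_fun setT f -> (forall p, `|f p| <= 1) ->
      \int[P]_p f p = \int[Theta]_g \int[levy_law_val g]_p f p.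
Proof.
pose m : giry (path_space R) R := giry_bind (Theta : giry _ R) mlev.
have mE D : measurable D -> m D = (\int[Theta]_g levy_law_val g D)%E.
  move=> mD; rewrite /m /giry_bind/=.
  by rewrite [LHS](giry_int_map mlev (Theta : giry _ R) (measurable_giry_ev (R := R) mD)).
have m1 : m setT = 1%E.
  rewrite mE// (eq_integral (cst 1%E)) => [|g _]; last exact: probability_setT.
  by rewrite integral_cst//= probability_setT mule1.
exists (prob_of_measure m1); split=> [D mD|f mf f1].
  by rewrite -mE.
exact: (giry_bind_Rintegral (Theta : giry _ R) mlev mf f1).
Qed.

(** The mixtures are realised on the path space itself. One bounded functional with different means
    suffices, since equal laws would integrate it equally. *)
Lemma not_good_criterion (L : set (levy_space R)) (Theta1 Theta2 : probability (levy_space R) R)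
    (f : path_space R -> R) :
  Theta1 L = 1%E -> Theta2 L = 1%E ->
  (forall t B, measurable B -> \int[Theta1]_g fine (marginal t g B) =
    \int[Theta2]_g fine (marginal t g B)) ->
  measurable_fun setT f -> (forall p, `|f p| <= 1) ->
  \int[Theta1]_g \int[levy_law_val g]_p f p <> \int[Theta2]_g \int[levy_law_val g]_p f p ->
  ~ good L.
Proof.
move=> T1 T2 TE mf f1 fN [_ gd]; apply: fN.
have [P1 [mS1 I1]] := mixture_exists Theta1.
have [P2 [mS2 I2]] := mixture_exists Theta2.
rewrite -I1// -I2//; congr fine; apply: eq_measure_integral => D mD _.
have lawE := gd _ _ _ _ P1 P2 _ _ _ _ mS1 mS2 T1 T2.
apply: (lawE _ _ mD) => t B mB.
rewrite -[LHS]fineK ?fin_num_measure// -[RHS]fineK ?fin_num_measure//.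
by rewrite (mixture_marginal mS1 t mB) (mixture_marginal mS2 t mB) TE.
Qed.

End coordinate_process.

(** * Two mixtures with equal marginals and different laws *)

Section counterexample.
Context {R : realType}.

(* The mixing variables: a fair choice among four cases, made with the even
   digits, and two independent uniform variables read off the odd digits. *)
Let a (w : R) : R := 1 - even_digits (odd_digits w).
Let b (w : R) : R := 1 - odd_digits (odd_digits w).

Definition select (y0 y1 y2 y3 : R -> R) (w : R) : R :=
  if even_digits w < 1 / 4 then y0 w else if even_digits w < 2 / 4 then y1 w
  else if even_digits w < 3 / 4 then y2 w else y3 w.

(** The tent is the density of a + b - 1; its second derivative is the sum of the masses at 1 and -1
    minus twice the mass at 0. The mixed derivative of the indicator of the unit square is the sum
    of its corners with alternating signs. In d2 d2 - d1 d3 applied to their product, the positive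
    terms are the four cases of [x1], [x2], [x3] and the negative terms those of [y1], [y2],
    [y3]. *)
Let x1 := select a a (cst 0) (cst 1).
Let x2 := select (cst 1) (cst (-1)) (fun w => a w + b w - 1) (fun w => a w + b w - 1).
Let x3 := select b b (cst 1) (cst 0).
Let y1 := select a a (cst 0) (cst 1).
Let y2 := select (cst 0) (cst 0) (fun w => a w + b w - 1) (fun w => a w + b w - 1).
Let y3 := select b b (cst 0) (cst 1).

Lemma measurable_select y0 y1' y2' y3' : measurable_fun setT y0 ->
  measurable_fun setT y1' -> measurable_fun setT y2' -> measurable_fun setT y3' ->
  measurable_fun setT (select y0 y1' y2' y3').
Proof.
move=> h0 h1 h2 h3; have me := @measurable_even_digits R.
by do 3 (apply: measurable_fun_ifT => //; first exact: measurable_fun_ltr).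
Qed.

Lemma select_itv y0 y1' y2' y3' : (forall w, -1 <= y0 w <= 1) ->
  (forall w, -1 <= y1' w <= 1) -> (forall w, -1 <= y2' w <= 1) ->
  (forall w, -1 <= y3' w <= 1) -> forall w, -1 <= select y0 y1' y2' y3' w <= 1.
Proof. by move=> h0 h1 h2 h3 w; rewrite /select; do 3 (case: ifP => _ //). Qed.

Let ma : measurable_fun setT a.
Proof.
apply: measurable_funB => //.
exact: (measurableT_comp measurable_even_digits measurable_odd_digits).
Qed.
Let mb : measurable_fun setT b.
Proof.
apply: measurable_funB => //.
exact: (measurableT_comp measurable_odd_digits measurable_odd_digits).
Qed.

Let a01 w : 0 <= a w <= 1.
Proof.
have [_ h] := digits_ge0 (odd_digits w); have := even_digits_le1 (odd_digits w).
by rewrite /a; move: h; lra.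
Qed.
Let b01 w : 0 <= b w <= 1.
Proof.
have [h _] := digits_ge0 (odd_digits w); have := odd_digits_le1 (odd_digits w).
by rewrite /b; move: h; lra.
Qed.

Let aN1 w : -1 <= a w <= 1. Proof. by have := a01 w; lra. Qed.
Let bN1 w : -1 <= b w <= 1. Proof. by have := b01 w; lra. Qed.
Let cN1 (c : R) : -1 <= c <= 1 -> forall w : R, -1 <= cst c w <= 1. Proof. by []. Qed.
Let abN1 w : -1 <= a w + b w - 1 <= 1. Proof. by have := a01 w; have := b01 w; lra. Qed.
Let mab : measurable_fun setT (fun w => a w + b w - 1).
Proof. by apply: measurable_funB => //; exact: measurable_funD. Qed.

Let N1 : -1 <= (-1 : R) <= 1. Proof. lra. Qed.
Let Z1 : -1 <= (0 : R) <= 1. Proof. lra. Qed.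
Let O1 : -1 <= (1 : R) <= 1. Proof. lra. Qed.

Let psi (c : R) := \int[unif]_x exp_neg c x.

Let psiE (c : R) : 0 < c -> c * psi c = 1 - expR (- c).
Proof. exact: unif_laplace. Qed.

(* Each of the four cases contributes an exponential of an affine function of
   the two uniform variables. *)
Let Rintegral_quarter (lo hi al be c : R) : 0 <= lo -> lo <= hi -> hi <= 1 ->
  0 <= al -> 0 <= be ->
  \int[unif]_w ((lo <= even_digits w < hi)%R%:R * expR (al * a w + be * b w + c)) =
  (hi - lo) * (expR (al + be + c) * (psi al * psi be)).
Proof.
move=> lo0 lohi hi1 al0 be0.
pose f (u : R) : R := (lo <= u < hi)%R%:R.
have mf : measurable_fun setT f.
  apply: measurable_natr_bool; apply: measurable_and;
    [exact: measurable_fun_ler|exact: measurable_fun_ltr].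
pose g (u : R) : R := exp_neg be (odd_digits u) * exp_neg al (even_digits u).
have mg : measurable_fun setT g.
  apply: measurable_funM.
    exact: (measurableT_comp (measurable_exp_neg be) measurable_odd_digits).
  exact: (measurableT_comp (measurable_exp_neg al) measurable_even_digits).
have g01 u : 0 <= g u <= 1.
  have /andP[p0 p1] := exp_neg_itv01 (odd_digits u) be0.
  have /andP[q0 q1] := exp_neg_itv01 (even_digits u) al0.
  by rewrite /g mulr_ge0//= mulr_ile1.
have f01 u : 0 <= f u <= 1 by rewrite /f ler0n lern1 leq_b1.
transitivity (\int[unif]_w (expR (al + be + c) * (f (even_digits w) * g (odd_digits w)))).
  apply: eq_Rintegral => w _; rewrite mulrCA; congr (_ * _).
  have [h0 h1] := digits_ge0 (odd_digits w).
  rewrite /g /exp_neg !max_l// -!expRD; congr expR; rewrite /a /b; ring.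
rewrite (Rintegral_scale unif (expR (al + be + c)) (C := 1)); last 2 first.
- apply: measurable_funM; first exact: (measurableT_comp mf measurable_even_digits).
  exact: (measurableT_comp mg measurable_odd_digits).
- move=> w; have /andP[p0 p1] := f01 (even_digits w).
  have /andP[q0 q1] := g01 (odd_digits w).
  by rewrite (ger0_norm (mulr_ge0 p0 q0)); exact: mulr_ile1.
rewrite digits_indep//.
have -> : \int[unif]_x f x = hi - lo.
  have -> : \int[unif]_x f x = \int[unif]_x (\1_(`]lo, hi]%classic) x : R).
    apply: ae_eq_Rintegral => //.
    exists ([set lo] `|` [set hi]); split; first exact: measurableU.
      apply/eqP; rewrite -measure_le0 (le_trans (measureU2 _ _ _))//.
      by rewrite [X in (X + _)%E]unif_set1 [X in (_ + X)%E]unif_set1 adde0.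
    move=> u /=; apply: contra_notP => /not_orP[ulo uhi].
    rewrite /f indicE; congr (nat_of_bool _)%:R; apply/idP/idP.
      move=> /andP[l r]; rewrite inE/= in_itv/= (ltW r) andbT lt_neqAle l andbT.
      by apply/eqP => E; apply: ulo.
    rewrite inE/= in_itv/= => /andP[l r]; rewrite (ltW l)/= lt_neqAle r andbT.
    by apply/eqP => E; apply: uhi.
  by rewrite Rintegral_indic//; have -> := congr1 fine (unif_itv lo0 lohi hi1).
have -> : \int[unif]_x g x = psi be * psi al.
  by rewrite /g; under eq_Rintegral do idtac; exact: digits_laplace.
by ring.
Qed.

(** The last interval ends at 2 because [even_digits] may equal 1; that null event is removed only
    in [emgf_select]. *)
Let sel_sum (A0 A1 A2 A3 : R -> R) w : 0 <= even_digits w ->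
  select A0 A1 A2 A3 w =
  (0 <= even_digits w < 1 / 4)%R%:R * A0 w + (1 / 4 <= even_digits w < 2 / 4)%R%:R * A1 w +
  ((2 / 4 <= even_digits w < 3 / 4)%R%:R * A2 w + (3 / 4 <= even_digits w < 2)%R%:R * A3 w).
Proof.
move=> e0; have e1 := even_digits_le1 w; rewrite /select e0/=.
have -> : even_digits w < 2 by lra.
rewrite andbT.
case: (ltP (even_digits w) (1 / 4)) => h1.
  have -> : (2 / 4 <= even_digits w) = false by apply/negbTE; lra.
  have -> : (3 / 4 <= even_digits w) = false by apply/negbTE; lra.
  by rewrite !mul0r !addr0 mul1r.
case: (ltP (even_digits w) (2 / 4)) => h2 /=.
  have -> : (3 / 4 <= even_digits w) = false by apply/negbTE; lra.
  by rewrite !mul0r !addr0 add0r mul1r.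
case: (ltP (even_digits w) (3 / 4)) => h3 /=.
  by rewrite !mul0r !addr0 add0r mul1r.
by rewrite !mul0r !add0r mul1r.
Qed.

(* [psi] turns the exponential moments of the two mixtures into elementary
   functions; they agree exactly on the cone [xi1 * xi3 = xi2 ^+ 2]. *)
Let emgf (A1 A2 A3 : R -> R) (t1 t2 t3 : R) : R :=
  \int[unif]_w expR (t1 * A1 w + t2 * A2 w + t3 * A3 w).

Let emgf_select (al0 be0 c0 al1 be1 c1 al2 be2 c2 al3 be3 c3 : R) (A : R -> R) :
  0 <= al0 -> 0 <= be0 -> 0 <= al1 -> 0 <= be1 ->
  0 <= al2 -> 0 <= be2 -> 0 <= al3 -> 0 <= be3 ->
  (forall w, A w = select (fun w => expR (al0 * a w + be0 * b w + c0))
    (fun w => expR (al1 * a w + be1 * b w + c1))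
    (fun w => expR (al2 * a w + be2 * b w + c2))
    (fun w => expR (al3 * a w + be3 * b w + c3)) w) ->
  \int[unif]_w A w =
    4^-1 * (expR (al0 + be0 + c0) * (psi al0 * psi be0)) +
    4^-1 * (expR (al1 + be1 + c1) * (psi al1 * psi be1)) +
    (4^-1 * (expR (al2 + be2 + c2) * (psi al2 * psi be2)) +
    4^-1 * (expR (al3 + be3 + c3) * (psi al3 * psi be3))).
Proof.
move=> p0 q0 p1 q1 p2 q2 p3 q3 AE.
have unit_weights (x y z w : R) : 1 * (1 * x + 1 * y) + 1 * (1 * z + 1 * w) = x + y + (z + w).
  by rewrite !mul1r.
pose I (lo hi al be c w : R) : R :=
  (lo <= even_digits w < hi)%R%:R * expR (al * a w + be * b w + c).
have mI lo hi al be c : measurable_fun setT (I lo hi al be c).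
  apply: measurable_funM.
    apply: measurable_natr_bool; have me := @measurable_even_digits R.
    by apply: measurable_and; [exact: measurable_fun_ler|exact: measurable_fun_ltr].
  apply: measurableT_comp => //; apply: measurable_funD => //.
  by apply: measurable_funD; apply: measurable_funM.
have bI lo hi al be c : 0 <= al -> 0 <= be -> forall w, `|I lo hi al be c w| <= expR (al + be + c).
  move=> al0' be0' w; rewrite normrM normr_nat (ger0_norm (expR_ge0 _)).
  apply: (@le_trans _ _ (1 * expR (al * a w + be * b w + c))).
    by rewrite ler_wpM2r ?expR_ge0// lern1 leq_b1.
  rewrite mul1r ler_expR lerD2r; have := a01 w; have := b01 w.
  move=> /andP[_ hb] /andP[_ ha]; apply: lerD.
    by rewrite -[leRHS]mulr1 ler_wpM2l.
  by rewrite -[leRHS]mulr1 ler_wpM2l.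
have m2 (f g : R -> R) : measurable_fun setT f -> measurable_fun setT g ->
    measurable_fun setT (fun v => 1 * f v + 1 * g v).
  by move=> mf mg; apply: measurable_funD; apply: measurable_funM.
have b2 (f g : R -> R) (C D : R) : (forall v, `|f v| <= C) -> (forall v, `|g v| <= D) ->
    forall v, `|1 * f v + 1 * g v| <= C + D.
  by move=> hf hg v; rewrite !mul1r (le_trans (ler_normD _ _))// lerD.
transitivity (\int[unif]_w (1 * (1 * I 0 (1 / 4) al0 be0 c0 w + 1 * I (1 / 4) (2 / 4) al1 be1 c1 w) +
    1 * (1 * I (2 / 4) (3 / 4) al2 be2 c2 w + 1 * I (3 / 4) 1 al3 be3 c3 w))).
  apply: ae_eq_Rintegral.
  - rewrite (_ : A = select (fun w => expR (al0 * a w + be0 * b w + c0))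
      (fun w => expR (al1 * a w + be1 * b w + c1))
      (fun w => expR (al2 * a w + be2 * b w + c2))
      (fun w => expR (al3 * a w + be3 * b w + c3))); last exact/funext.
    have me al be c : measurable_fun setT (fun w => expR (al * a w + be * b w + c)).
      apply: measurableT_comp => //; apply: measurable_funD => //.
      by apply: measurable_funD; apply: measurable_funM.
    exact: measurable_select.
  - by apply: (m2); apply: (m2).
  - apply: filterS even_digits_lt1 => w e1.
    rewrite AE sel_sum ?(proj2 (digits_ge0 w))// !mul1r /I.
    have -> : (even_digits w < 2) = true by rewrite (lt_trans e1)// ltr1n.
    by rewrite e1 (proj2 (digits_ge0 w)).
rewrite (Rintegral_lin2 unif 1 1 (m2 _ _ (mI _ _ _ _ _) (mI _ _ _ _ _))
  (m2 _ _ (mI _ _ _ _ _) (mI _ _ _ _ _))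
  (b2 _ _ _ _ (bI _ _ _ _ _ p0 q0) (bI _ _ _ _ _ p1 q1))
  (b2 _ _ _ _ (bI _ _ _ _ _ p2 q2) (bI _ _ _ _ _ p3 q3))).
rewrite (Rintegral_lin2 unif 1 1 (mI _ _ _ _ _) (mI _ _ _ _ _) (bI _ _ _ _ _ p0 q0) (bI _ _ _ _ _ p1 q1)).
rewrite (Rintegral_lin2 unif 1 1 (mI _ _ _ _ _) (mI _ _ _ _ _) (bI _ _ _ _ _ p2 q2) (bI _ _ _ _ _ p3 q3)).
have EQ lo hi al be c : 0 <= lo -> hi - lo = 4^-1 -> hi <= 1 -> 0 <= al -> 0 <= be ->
    \int[unif]_w I lo hi al be c w = 4^-1 * (expR (al + be + c) * (psi al * psi be)).
  move=> h1 h2 h3 h4 h5; rewrite -h2; apply: Rintegral_quarter => //.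
  by rewrite -subr_ge0 h2 invr_ge0.
have q1' : 0 <= 1 / 4 :> R by lra.
have q2' : 0 <= 2 / 4 :> R by lra.
have q3' : 0 <= 3 / 4 :> R by lra.
have r1 : 1 / 4 <= 1 :> R by lra.
have r2 : 2 / 4 <= 1 :> R by lra.
have r3 : 3 / 4 <= 1 :> R by lra.
have s0 : 1 / 4 - 0 = 4^-1 :> R by lra.
have s1 : 2 / 4 - 1 / 4 = 4^-1 :> R by lra.
have s2 : 3 / 4 - 2 / 4 = 4^-1 :> R by lra.
have s3 : 1 - 3 / 4 = 4^-1 :> R by lra.
rewrite (EQ _ _ _ _ _ (lexx 0) s0 r1 p0 q0) (EQ _ _ _ _ _ q1' s1 r2 p1 q1).
rewrite (EQ _ _ _ _ _ q2' s2 r3 p2 q2) (EQ _ _ _ _ _ q3' s3 (lexx 1) p3 q3).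
exact: unit_weights.
Qed.

Let emgf1 t1 t2 t3 : 0 <= t1 -> 0 <= t2 -> 0 <= t3 -> 4 * emgf x1 x2 x3 t1 t2 t3 =
  expR (t1 + t3) * (psi t1 * psi t3) * (expR t2 + expR (- t2)) +
  expR t2 * (psi t2 * psi t2) * (expR t3 + expR t1).
Proof.
move=> p1 p2 p3; rewrite /emgf (@emgf_select t1 t3 t2 t1 t3 (- t2) t2 t2 (t3 - t2) t2 t2 (t1 - t2))//.
  rewrite !expRD; have e := expRxMexpNx_1 t2.
  move: (psi t1) (psi t2) (psi t3) (expR t1) (expR t2) (expR t3) (expR (- t2)) e.
  move=> P1 P2 P3 E1 E2 E3 N2 e.
  have -> : E2 * E2 * (E3 * N2) = E2 * E3 by rewrite mulrACA e mulr1.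
  have -> : E2 * E2 * (E1 * N2) = E2 * E1 by rewrite mulrACA e mulr1.
  by field.
move=> w; rewrite /x1 /x2 /x3 /select /=.
by do 3 (case: ifP => _; first by congr expR; ring); congr expR; ring.
Qed.

Let emgf2 t1 t2 t3 : 0 <= t1 -> 0 <= t2 -> 0 <= t3 -> 4 * emgf y1 y2 y3 t1 t2 t3 =
  expR (t1 + t3) * (psi t1 * psi t3) * 2 +
  expR t2 * (psi t2 * psi t2) * (1 + expR (t1 + t3)).
Proof.
move=> p1 p2 p3; rewrite /emgf (@emgf_select t1 t3 0 t1 t3 0 t2 t2 (- t2) t2 t2 (t1 + t3 - t2))//.
  rewrite !addr0 addrK !expRD; have e := expRxMexpNx_1 t2.
  move: (psi t1) (psi t2) (psi t3) (expR t1) (expR t2) (expR t3) (expR (- t2)) e.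
  move=> P1 P2 P3 E1 E2 E3 N2 e.
  have -> : E2 * E2 * (E1 * E3 * N2) = E2 * (E1 * E3) by rewrite mulrACA e mulr1.
  by field.
move=> w; rewrite /y1 /y2 /y3 /select /=.
by do 3 (case: ifP => _; first by congr expR; ring); congr expR; ring.
Qed.

(** [P] and [D] stand for values of [psi] and of exp (- t). As t psi(t) = 1 - exp (- t), the factor
    t2^2 clears the terms with P2 and leaves E2 + D2 - 2 with the coefficient (E1 - 1) (E3 - 1),
    which is t1 t3 P1 P3 E1 E3. *)
Let emgf_algebra (t1 t2 t3 P1 P2 P3 E1 E2 E3 D1 D2 D3 : R) :
  E1 * D1 = 1 -> E2 * D2 = 1 -> E3 * D3 = 1 ->
  t1 * P1 = 1 - D1 -> t2 * P2 = 1 - D2 -> t3 * P3 = 1 - D3 ->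
  t2 ^+ 2 * (E1 * E3 * (P1 * P3) * (E2 + D2) + E2 * (P2 * P2) * (E3 + E1) -
    (E1 * E3 * (P1 * P3) * 2 + E2 * (P2 * P2) * (1 + E1 * E3))) =
  E1 * E3 * (P1 * P3) * (E2 + D2 - 2) * (t2 ^+ 2 - t1 * t3).
Proof.
move=> e1 e2 e3 q1 q2 q3.
transitivity (E1 * E3 * (P1 * P3) * (E2 + D2 - 2) * t2 ^+ 2 -
  E2 * (t2 * P2) ^+ 2 * (1 + E1 * E3 - E3 - E1)); first by ring.
transitivity (E1 * E3 * (P1 * P3) * (E2 + D2 - 2) * t2 ^+ 2 -
  E1 * E3 * ((t1 * P1) * (t3 * P3)) * (E2 + D2 - 2)); last by ring.
congr (_ - _); rewrite q1 q2 q3.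
have -> : E2 * (1 - D2) ^+ 2 = E2 - 2 * (E2 * D2) + (E2 * D2) * D2 by ring.
have -> : E1 * E3 * ((1 - D1) * (1 - D3)) = (E1 - E1 * D1) * (E3 - E3 * D3) by ring.
by rewrite e1 e2 e3; ring.
Qed.

Let emgf_diff t1 t2 t3 : 0 < t1 -> 0 < t2 -> 0 < t3 ->
  4 * t2 ^+ 2 * (emgf x1 x2 x3 t1 t2 t3 - emgf y1 y2 y3 t1 t2 t3) =
  expR (t1 + t3) * (psi t1 * psi t3) * (expR t2 + expR (- t2) - 2) * (t2 ^+ 2 - t1 * t3).
Proof.
move=> p1 p2 p3; have h1 := emgf1 (ltW p1) (ltW p2) (ltW p3).
have h2 := emgf2 (ltW p1) (ltW p2) (ltW p3).
have dist (x y z : R) : 4 * x * (y - z) = x * (4 * y - 4 * z) by ring.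
rewrite dist.
rewrite h1 h2 !expRD.
have e1 := expRxMexpNx_1 t1; have e2 := expRxMexpNx_1 t2; have e3 := expRxMexpNx_1 t3.
have q1 := psiE p1; have q2 := psiE p2; have q3 := psiE p3.
move: (psi t1) (psi t2) (psi t3) (expR t1) (expR t2) (expR t3) (expR (- t1)) (expR (- t2))
  (expR (- t3)) e1 e2 e3 q1 q2 q3.
exact: emgf_algebra.
Qed.

Section mixing.
Variables (A1 A2 A3 : R -> R).
Hypotheses (m1 : measurable_fun setT A1) (m2 : measurable_fun setT A2)
  (m3 : measurable_fun setT A3).
Hypotheses (h1 : forall w, -1 <= A1 w <= 1) (h2 : forall w, -1 <= A2 w <= 1)
  (h3 : forall w, -1 <= A3 w <= 1).

Let G : R -> levy_space R := mark_levy_law A1 A2 A3.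
Let mG : measurable_fun setT G := measurable_mark_levy_law m1 m2 m3 h1 h2 h3.

Let ThetaT : giry_map mG (unif : giry R R) setT = 1%E.
Proof. exact: (@probability_setT _ _ _ unif). Qed.

Definition mark_mixing : probability (levy_space R) R := prob_of_measure ThetaT.

Lemma mark_mixing_LISPP : mark_mixing (LISPP (supported_in [set (0 : R); 1; 2; 3])) = 1%E.
Proof.
rewrite -[LHS]/(unif (G @^-1` LISPP (supported_in [set (0 : R); 1; 2; 3]))).
rewrite (_ : _ @^-1` _ = setT) ?probability_setT//.
by apply/seteqP; split => // w _; exact: LISPP_mark_levy_law.
Qed.

Lemma Rintegral_mark_mixing (f : levy_space R -> R) : measurable_fun setT f ->
  (forall g, 0 <= f g <= 1) -> \int[mark_mixing]_g f g = \int[unif]_w f (G w).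
Proof. exact: Rintegral_giry_map. Qed.

Lemma Rintegral_mark_law_laplace w l :
  \int[mark_law (A1 w) (A2 w) (A3 w)]_y exp_neg l y =
  \int[unif]_v exp_neg l (mark (A1 w) (A2 w) (A3 w) v).
Proof.
rewrite /Rintegral [in LHS]ge0_integral_distribution//.
- by apply/measurable_EFinP; exact: measurable_exp_neg.
- by move=> y; rewrite lee_fin expR_ge0.
Qed.

(** The generating function of the uniform law on {0, 1, 2, 3} minus 1: the exponent without
    perturbation. *)
Definition slope0 (z : R) : R :=
  (z - 1) * (3 / 4) + (z ^+ 2 - z) * (2 / 4) + (z ^+ 3 - z ^+ 2) * (1 / 4).

Lemma measurable_emgf t1 t2 t3 :
  measurable_fun setT (fun w => expR (t1 * A1 w + t2 * A2 w + t3 * A3 w)).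
Proof.
apply: measurableT_comp => //; apply: measurable_funD; last exact: measurable_funM.
by apply: measurable_funD; apply: measurable_funM.
Qed.

Lemma emgf_bounded t1 t2 t3 w :
  `|expR (t1 * A1 w + t2 * A2 w + t3 * A3 w)| <= expR (`|t1| + `|t2| + `|t3|).
Proof.
have E (t x : R) : -1 <= x <= 1 -> t * x <= `|t|.
  by move=> xN1; rewrite (le_trans (ler_norm _))// normrM ler_piMr// ler_norml.
by rewrite ger0_norm ?expR_ge0// ler_expR !lerD// E.
Qed.

Lemma Rintegral_mark_mgf (t l z u : R) : z = expR (- l) -> u = t * ((1 - z) / 8) ->
  \int[unif]_w expR (t * (\int[mark_law (A1 w) (A2 w) (A3 w)]_y exp_neg l y - 1)) =
  expR (t * slope0 z) * emgf A1 A2 A3 u (u * z) (u * z ^+ 2).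
Proof.
move=> zE uE; rewrite /emgf -(Rintegral_scale unif _ (measurable_emgf _ _ _) (emgf_bounded _ _ _)).
apply: eq_Rintegral => w _; rewrite Rintegral_mark_law_laplace mark_laplace//= -expRD.
by congr expR; rewrite uE -zE /slope0; ring.
Qed.

Lemma marginal_mark_mixing (t : {nonneg R}) B : measurable B ->
  \int[mark_mixing]_g fine (marginal t g B) =
  \int[unif]_w fine (compound_poisson t%:num (mark_law (A1 w) (A2 w) (A3 w)) B).
Proof.
move=> mB; rewrite Rintegral_mark_mixing.
- by apply: eq_Rintegral => w _; rewrite mark_levy_lawE.
- apply: measurableT_comp => //; exact: measurable_marginal_eval.
- by move=> g; exact: (subprobability_fine_itv (marginal t g)).
Qed.

Let time (i : nat) : {nonneg R} := i%:R%:nng.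

Definition two_increments (l : nat -> R) (p : path_space R) : R :=
  \prod_(0 <= i < 2) exp_neg (l i) (p (time i.+1) - p (time i)).

Lemma measurable_two_increments l : measurable_fun setT (two_increments l).
Proof.
apply: measurable_prod => i _.
exact: (measurableT_comp (measurable_exp_neg (l i)) (measurable_increment _ _)).
Qed.

Lemma two_increments01 l p : (forall i, 0 <= l i) -> 0 <= two_increments l p <= 1.
Proof. by move=> l0; apply: prod_itv01 => i; exact: exp_neg_itv01. Qed.

(** Independent increments multiply exponentials, so the argument of the moment generating function
    is a sum of multiples of (1, z, z^2) and (1, y, y^2). *)
Lemma two_increments_mark_mixing (l : nat -> R) (z y : R) : (forall i, 0 <= l i) ->
  z = expR (- l 0%N) -> y = expR (- l 1%N) ->
  \int[mark_mixing]_g \int[levy_law_val g]_p two_increments l p =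
  expR (slope0 z + slope0 y) * emgf A1 A2 A3 ((1 - z) / 8 + (1 - y) / 8)
    ((1 - z) / 8 * z + (1 - y) / 8 * y) ((1 - z) / 8 * z ^+ 2 + (1 - y) / 8 * y ^+ 2).
Proof.
move=> l0 zE yE; rewrite Rintegral_mark_mixing; first last.
- by move=> g; apply: Rintegral_itv01 => [|p]; [exact: measurable_two_increments|exact: two_increments01].
- apply: (@measurable_Rintegral_kernel R _ (levy_space R) _ (path_space R)
    (fun g => levy_law_val g : subprobability _ R)).
  + exact: measurable_levy_eval.
  + exact: measurable_two_increments.
  + by move=> p; exact: two_increments01.
rewrite /emgf -(Rintegral_scale unif _ (measurable_emgf _ _ _) (emgf_bounded _ _ _)).
apply: eq_Rintegral => w _; rewrite /two_increments mark_levy_law_laplace//; last first.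
  by move=> i; rewrite /time /= ler_nat.
rewrite 2?big_nat_recr//= big_nil mul1r !mark_laplace//= -!expRD.
have E (i : nat) : (i.+1)%:R - i%:R = 1 :> R by rewrite -natr1 addrC addKr.
rewrite (E 0%N) (E 1%N) !mul1r.
by congr expR; rewrite /slope0 -zE -yE; ring.
Qed.

End mixing.

Let mx1 : measurable_fun setT x1. Proof. by apply: measurable_select. Qed.
Let mx2 : measurable_fun setT x2. Proof. by apply: measurable_select. Qed.
Let mx3 : measurable_fun setT x3. Proof. by apply: measurable_select. Qed.
Let my1 : measurable_fun setT y1. Proof. by apply: measurable_select. Qed.
Let my2 : measurable_fun setT y2. Proof. by apply: measurable_select. Qed.
Let my3 : measurable_fun setT y3. Proof. by apply: measurable_select. Qed.
Let hx1 : forall w, -1 <= x1 w <= 1. Proof. exact: select_itv. Qed.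
Let hx2 : forall w, -1 <= x2 w <= 1. Proof. exact: select_itv. Qed.
Let hx3 : forall w, -1 <= x3 w <= 1. Proof. exact: select_itv. Qed.
Let hy1 : forall w, -1 <= y1 w <= 1. Proof. exact: select_itv. Qed.
Let hy2 : forall w, -1 <= y2 w <= 1. Proof. exact: select_itv. Qed.
Let hy3 : forall w, -1 <= y3 w <= 1. Proof. exact: select_itv. Qed.

Let Theta1 := mark_mixing mx1 mx2 mx3 hx1 hx2 hx3.
Let Theta2 := mark_mixing my1 my2 my3 hy1 hy2 hy3.

Let emgf_cone u z : 0 <= u -> 0 < z ->
  emgf x1 x2 x3 u (u * z) (u * z ^+ 2) = emgf y1 y2 y3 u (u * z) (u * z ^+ 2).
Proof.
(* At u = 0 all arguments vanish, and [emgf_diff], which requires positive ones, does not apply. *)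
rewrite le_eqVlt => /orP[/eqP <-|u0] z0.
  by rewrite !mul0r /emgf; apply: eq_Rintegral => w _; rewrite !mul0r.
have uz : 0 < u * z by rewrite mulr_gt0.
have uz2 : 0 < u * z ^+ 2 by rewrite mulr_gt0// exprn_gt0.
have := emgf_diff u0 uz uz2.
rewrite (_ : (u * z) ^+ 2 - u * (u * z ^+ 2) = 0) ?mulr0; last by ring.
move=> /eqP; rewrite mulf_eq0 mulf_eq0 pnatr_eq0/= expf_eq0/= (gt_eqF uz)/=.
by rewrite subr_eq0 => /eqP.
Qed.

Let scale_ge0 (t z : R) : 0 <= t -> z <= 1 -> 0 <= t * ((1 - z) / 8).
Proof. by move=> t0 z1; rewrite mulr_ge0// divr_ge0// subr_ge0. Qed.

Let marginal_eq (t : {nonneg R}) B : measurable B ->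
  \int[Theta1]_g fine (marginal t g B) = \int[Theta2]_g fine (marginal t g B).
Proof.
move=> mB; rewrite (marginal_mark_mixing mx1 mx2 mx3 hx1 hx2 hx3 t mB).
rewrite (marginal_mark_mixing my1 my2 my3 hy1 hy2 hy3 t mB).
pose k (A1 A2 A3 : R -> R) (_ : unit) (w : R) : subprobability R R :=
  compound_poisson t%:num (mark_law (A1 w) (A2 w) (A3 w)).
have t0 : 0 <= t%:num by [].
have mark0 (c1 c2 c3 : R) : mark_law c1 c2 c3 (~` `[0, +oo[%classic) = 0%E.
  rewrite -[LHS]/(unif (mark c1 c2 c3 @^-1` ~` `[0, +oo[%classic)).
  rewrite (_ : _ @^-1` _ = set0) ?measure0//.
  by apply/seteqP; split => // v /=; rewrite in_itv/= mark_ge0.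
(* A single index is used, to pass from Laplace transforms averaged over the mixing variable to
   averaged probabilities. *)
have := @eq_multi_kernel R _ _ R R unif unif unit nat 0%N (k x1 x2 x3) (k y1 y2 y3)
  (fun _ B mB => measurable_compound_poisson_mark mx1 mx2 mx3 hx1 hx2 hx3 t0 mB)
  (fun _ B mB => measurable_compound_poisson_mark my1 my2 my3 hy1 hy2 hy3 t0 mB)
  (`[0, +oo[%classic) (fun j => exp_neg j%:R) (measurable_itv _) _ _
  (fun j => measurable_exp_neg j%:R) (fun j x => exp_neg_itv01 x (ler0n _ j)) _
  [:: tt] isT.
move=> /(_ _ _ _ _ (fun=> B) (fun=> mB)) H.
transitivity (\int[unif]_w \prod_(i <- [:: tt]) fine (k x1 x2 x3 i w B)).
  by apply: eq_Rintegral => w _; rewrite big_seq1.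
rewrite H.
- by apply: eq_Rintegral => w _; rewrite big_seq1.
- by move=> i; apply: aeW => w; apply: (compound_poisson_ge0 (mark0 _ _ _) t0).
- by move=> i; apply: aeW => w; apply: (compound_poisson_ge0 (mark0 _ _ _) t0).
- by move=> m1 m2 m10 m20 E; apply: eq_from_laplace.
- move=> j.
  have E (A1 A2 A3 : R -> R) :
      \int[unif]_w \prod_(i <- [:: tt]) \int[k A1 A2 A3 i w]_y exp_neg (j i)%:R y =
      \int[unif]_w expR (t%:num *
        (\int[mark_law (A1 w) (A2 w) (A3 w)]_y exp_neg (j tt)%:R y - 1)).
    apply: eq_Rintegral => w _; rewrite big_seq1.
    exact: (compound_poisson_laplace (mark0 _ _ _) t0 (ler0n R (j tt))).
  pose z := expR (- (j tt)%:R) : R; pose u := t%:num * ((1 - z) / 8).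
  apply: (etrans (E x1 x2 x3)).
  apply: (etrans (Rintegral_mark_mgf mx1 mx2 mx3 hx1 hx2 hx3 (erefl z) (erefl u))).
  apply: esym; apply: (etrans (E y1 y2 y3)).
  apply: (etrans (Rintegral_mark_mgf my1 my2 my3 hy1 hy2 hy3 (erefl z) (erefl u))).
  congr (_ * _); apply/esym; apply: emgf_cone.
    have z1 : z <= 1 by rewrite /z -[X in _ <= X](@expR0 R) ler_expR oppr_le0 ler0n.
    exact: (scale_ge0 t0 z1).
  exact: expR_gt0.
Qed.

Let psi_gt0 c : 0 < c -> 0 < psi c.
Proof.
move=> c0; have := psiE c0; rewrite -(pmulr_rgt0 (psi c) c0) => ->.
by rewrite subr_gt0 -[ltRHS]expR0 ltr_expR oppr_lt0.
Qed.

Theorem LISPP_0123_not_good : ~ good (LISPP (supported_in [set (0 : R); 1; 2; 3])).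
Proof.
(* The parameters 1 and 2 for the two increments; what matters is that z and y are distinct and
   below 1. *)
pose l (i : nat) : R := i.+1%:R.
have l0 i : 0 <= l i by rewrite /l ler0n.
apply: (@not_good_criterion R _ Theta1 Theta2 (two_increments l)
  (mark_mixing_LISPP _ _ _ _ _ _) (mark_mixing_LISPP _ _ _ _ _ _) marginal_eq
  (measurable_two_increments l)) => [p|].
  by have /andP[a0 a1] := two_increments01 p l0; rewrite ger0_norm.
pose z := expR (- l 0%N); pose y := expR (- l 1%N).
rewrite (two_increments_mark_mixing _ _ _ _ _ _ l0 (erefl z) (erefl y)).
rewrite (two_increments_mark_mixing _ _ _ _ _ _ l0 (erefl z) (erefl y)).
have lt1 i : expR (- l i) < 1 by rewrite -[ltRHS]expR0 ltr_expR oppr_lt0 /l ltr0n.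
have z1 : z < 1 by exact: lt1.
have y1' : y < 1 by exact: lt1.
have z0 : 0 < z by exact: expR_gt0.
have y0 : 0 < y by exact: expR_gt0.
have yz : y < z by rewrite /y /z ltr_expR ltrN2 /l ltr_nat.
pose u := (1 - z) / 8; pose v := (1 - y) / 8.
have u0 : 0 < u by rewrite /u; lra.
have v0 : 0 < v by rewrite /v; lra.
rewrite -/u -/v; set t1 := u + v; set t2 := u * z + v * y; set t3 := u * z ^+ 2 + v * y ^+ 2.
move=> /(mulfI _); rewrite gt_eqF ?expR_gt0// => /(_ isT) E.
have p1 : 0 < t1 := addr_gt0 u0 v0.
have p2 : 0 < t2 := addr_gt0 (mulr_gt0 u0 z0) (mulr_gt0 v0 y0).
have p3 : 0 < t3 := addr_gt0 (mulr_gt0 u0 (exprn_gt0 2 z0)) (mulr_gt0 v0 (exprn_gt0 2 y0)).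
have := emgf_diff p1 p2 p3; rewrite E subrr mulr0 => /esym/eqP.
rewrite !mulf_eq0 (gt_eqF (expR_gt0 _)) (gt_eqF (psi_gt0 p1)) (gt_eqF (psi_gt0 p3))/=.
move=> /orP[|]; last first.
  (* Lagrange's identity for the sums t1, t2, t3; as z and y differ, the point lies strictly off the
     cone. *)
  rewrite (_ : _ - _ = - (u * v * (z - y) ^+ 2)); last by rewrite /t1 /t2 /t3; ring.
  have uvz : 0 < u * v * (z - y) ^+ 2.
    by apply: mulr_gt0; [exact: mulr_gt0|rewrite exprn_gt0// subr_gt0].
  by rewrite oppr_eq0 (gt_eqF uvz).
have e2 := expRxMexpNx_1 t2.
(* The remaining factor is 2 cosh t2 - 2, a positive number times a square that vanishes only at t2
   = 0. *)
have -> : expR t2 + expR (- t2) - 2 = expR (- t2) * (expR t2 - 1) ^+ 2.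
  have -> : expR (- t2) * (expR t2 - 1) ^+ 2 =
    (expR t2 * expR (- t2)) * expR t2 - 2 * (expR t2 * expR (- t2)) + expR (- t2) by ring.
  by rewrite e2; ring.
rewrite mulf_eq0 (gt_eqF (expR_gt0 _)) expf_eq0/= subr_eq0.
by rewrite -(expR0 R) (inj_eq (@expR_inj R)) gt_eqF.
Qed.

End counterexample.

Theorem corollary3p2p6 (R : realType) :
  [/\ forall nu1 nu2 nu3 : pprobability R R,
        supported_in `[0, +oo[ nu1 ->
        supported_in `[0, +oo[ nu2 ->
        supported_in `[0, +oo[ nu3 ->
        good (LISPP (convex_hull [set nu1; nu2; nu3])),
      forall A : set R, limit_point A = set0 -> countable A ->
        rat_independent A -> good (LISPP (supported_in A)) &
      measurable (LISPP (supported_in [set (0 : R); 1; 2; 3])) /\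
      ~ good (LISPP (supported_in [set (0 : R); 1; 2; 3]))].
Proof.
split.
- by move=> nu1 nu2 nu3; exact: good_convex_hull3.
- by move=> A _; exact: good_independent.
- by split; [exact: measurable_LISPP_0123|exact: LISPP_0123_not_good].
Qed.
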